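(* Let $G$ be a compact Lie group, let $\mathcal{A}$ be a unital $C^*$-algebra, and let $\alpha : G \to \mathrm{Aut}(\mathcal{A})$ be a strongly continuous action which is ergodic. Then every Hilbert $C^*$ $G$-$\mathcal{A}$-module $(E,\beta)$ (with $E$ not necessarily countably generated) is embeddable; that is, there exist a Hilbert space $\mathcal{H}$ (not necessarily separable) with a strongly continuous unitary representation $\gamma$ of $G$ on $\mathcal{H}$, and an $\mathcal{A}$-linear isometry $T : E \to \mathcal{A} \otimes \mathcal{H}$ such that $T(\beta_g(\xi)) = (\alpha_g \otimes \gamma_g)(T(\xi))$ for all $g \in G$, $\xi \in E$.
   Context: Strong continuity of $\alpha$ means $g \mapsto \alpha_g(a)$ is norm-continuous for each $a \in \mathcal{A}$. The action $\alpha$ on the unital $C^*$-algebra $\mathcal{A}$ is called ergodic if $\alpha_g(a) = a$ for all $g \in G$ holds if and only if $a$ is a scalar multiple of $1$. A Hilbert $C^*$ $G$-$\mathcal{A}$-module is a pair $(E,\beta)$ where $E$ is a (right) Hilbert $C^*$-module over $\mathcal{A}$ and $\beta$ is a map from $G$ to the set of $\mathbb{C}$-linear (not necessarily $\mathcal{A}$-linear) maps from $E$ to $E$ such that: (i) $\beta_{gh} = \beta_g \circ \beta_h$ for $g,h\in G$ and $\beta_e = \mathrm{Id}$, where $e$ is the identity of $G$; (ii) $\beta_g(\xi a) = \beta_g(\xi)\alpha_g(a)$ for $\xi \in E$, $a \in \mathcal{A}$; (iii) $g \mapsto \beta_g(\xi)$ is (norm-)continuous for each fixed $\xi \in E$;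 (iv) $\langle \beta_g(\xi), \beta_g(\eta)\rangle = \alpha_g(\langle \xi,\eta\rangle)$ for all $\xi,\eta\in E$, where $\langle\cdot,\cdot\rangle$ is the $\mathcal{A}$-valued inner product of $E$ ($\mathcal{A}$-linear in the second variable). For a Hilbert space $\mathcal{H}$, $\mathcal{A}\otimes\mathcal{H}$ is the Hilbert $\mathcal{A}$-module obtained by completing the algebraic tensor product $\mathcal{A}\otimes_{\mathrm{alg}}\mathcal{H}$, with $\langle a\otimes x, b \otimes y\rangle = a^*b\,\langle x,y\rangle$; equivalently it is the norm closure of $\mathcal{A}\otimes_{\mathrm{alg}}\mathcal{H}$ in $\mathcal{B}(\mathcal{H}_0,\mathcal{H}_0\otimes\mathcal{H})$, where $\mathcal{H}_0$ is any Hilbert space with $\mathcal{A}\subseteq\mathcal{B}(\mathcal{H}_0)$ isometrically and $a\otimes x$ acts by $v\mapsto av\otimes x$. The $G$-action $\alpha_g\otimes\gamma_g$ is determined by $a\otimes x\mapsto \alpha_g(a)\otimes\gamma_g(x)$. Modules of this form are called trivial $G$-$\mathcal{A}$-modules. An isometry of Hilbert modules is an inner-product-preserving $\mathcal{A}$-linear map (not required to be adjointable), so embeddability means that $(E,\beta)$ is equivariantly isomorphic to a sub-$G$-$\mathcal{A}$-module of a trivial one. *)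

(* Defs.v *)
From HB Require Import structures.
From mathcomp Require Import all_boot all_order all_algebra.
From mathcomp Require Import complex.
From mathcomp Require Import all_classical all_reals all_analysis.

Set Implicit Arguments.
Unset Strict Implicit.
Unset Printing Implicit Defensive.

Import Order.TTheory GRing.Theory Num.Theory.
Import numFieldNormedType.Exports.

Local Open Scope classical_set_scope.
Local Open Scope ring_scope.
Local Open Scope complex_scope.

HB.mixin Record isTopologicalGroup G of Group G & Topological G := {
  mulg_continuous : continuous (fun p : G * G => (p.1 * p.2)%g) ;
  invg_continuous : continuous (fun x : G => (x^-1)%g)
}.

#[short(type="topologicalGroupType")]
HB.structure Definition TopologicalGroup :=
  {G of Group G & Topological G & isTopologicalGroup G}.

Section Smooth.
Variables (R : realType) (V W : normedModType R).

(* [Ck k U f] is the usual notion of a C^k map when V is finite-dimensional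
   and U is open. *)
Fixpoint Ck (k : nat) (U : set V) (f : V -> W) : Prop :=
  (forall x, U x -> {for x, continuous f}) /\
  (if k is k'.+1 then
     forall v : V, (forall x, U x -> derivable f x v) /\ Ck k' U ('D_v f)
   else True).

Definition smooth_on (U : set V) (f : V -> W) : Prop := forall k, Ck k U f.

End Smooth.

Section Charts.
Variables (R : realType) (n : nat) (G : topologicalType).

(* A homeomorphism [chart_map], with inverse [chart_inv], from the open set
   [chart_dom] of G onto the open set [chart_cod] of R^n; the values of the two
   total functions outside these sets are irrelevant. *)
Record chart := Chart {
  chart_dom : set G ;
  chart_cod : set 'rV[R]_n ;
  chart_map : G -> 'rV[R]_n ;
  chart_inv : 'rV[R]_n -> G ;
  chart_dom_open : open chart_dom ;
  chart_cod_open : open chart_cod ;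
  chart_map_cod : forall x, chart_dom x -> chart_cod (chart_map x) ;
  chart_inv_dom : forall u, chart_cod u -> chart_dom (chart_inv u) ;
  chart_mapK : forall x, chart_dom x -> chart_inv (chart_map x) = x ;
  chart_invK : forall u, chart_cod u -> chart_map (chart_inv u) = u ;
  chart_map_continuous : forall x, chart_dom x -> {for x, continuous chart_map} ;
  chart_inv_continuous : forall u, chart_cod u -> {for u, continuous chart_inv}
}.

End Charts.

HB.mixin Record isLieGroup (R : realType) G of TopologicalGroup G := {
  lie_dim : nat ;
  lie_atlas : set (chart R lie_dim G) ;
  lie_hausdorff : hausdorff_space G ;
  lie_second_countable : @second_countable G ;
  lie_atlas_cover : forall x : G, exists2 c, lie_atlas c & chart_dom c x ;
  lie_transition_smooth : forall c d, lie_atlas c -> lie_atlas d ->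
    smooth_on [set u | chart_cod c u /\ chart_dom d (chart_inv c u)]
      (fun u => chart_map d (chart_inv c u)) ;
  lie_mul_smooth : forall c d e, lie_atlas c -> lie_atlas d -> lie_atlas e ->
    smooth_on
      [set p : 'rV[R]_lie_dim * 'rV[R]_lie_dim |
        [/\ chart_cod c p.1, chart_cod d p.2 &
            chart_dom e (chart_inv c p.1 * chart_inv d p.2)%g]]
      (fun p => chart_map e (chart_inv c p.1 * chart_inv d p.2)%g) ;
  lie_inv_smooth : forall c d, lie_atlas c -> lie_atlas d ->
    smooth_on [set u | chart_cod c u /\ chart_dom d ((chart_inv c u)^-1)%g]
      (fun u => chart_map d ((chart_inv c u)^-1)%g)
}.

#[short(type="lieGroupType")]
HB.structure Definition LieGroup (R : realType) :=
  {G of TopologicalGroup G & isLieGroup R G}.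

(* Norms of complex spaces take their values in R[i], as nonnegative reals. *)

(* The multiplication is a field of the mixin, and the ring structure is
   declared afterwards: HB rejects a new join of the normed and the ring
   structures, because Num.NumDomain already inherits from both. *)
HB.mixin Record isCStarAlgebra (R : realType) A
    of CompleteNormedModule R[i] A := {
  cstar_mul : A -> A -> A ;
  cstar_one : A ;
  star : A -> A ;
  cstar_mulA : associative cstar_mul ;
  cstar_mul1l : left_id cstar_one cstar_mul ;
  cstar_mul1r : right_id cstar_one cstar_mul ;
  cstar_mulDl : left_distributive cstar_mul +%R ;
  cstar_mulDr : right_distributive cstar_mul +%R ;
  cstar_one_neq0 : cstar_one != 0 ;
  cstar_scaleAl : forall (c : R[i]) (a b : A),
    c *: cstar_mul a b = cstar_mul (c *: a) b ;
  cstar_scaleAr : forall (c : R[i]) (a b : A),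
    c *: cstar_mul a b = cstar_mul a (c *: b) ;
  cstar_ler_normM : forall a b : A, `|cstar_mul a b| <= `|a| * `|b| ;
  starK : involutive star ;
  starD : forall a b : A, star (a + b) = star a + star b ;
  starZ : forall (c : R[i]) (a : A), star (c *: a) = Num.conj c *: star a ;
  starM : forall a b : A, star (cstar_mul a b) = cstar_mul (star b) (star a) ;
  cstar_identity : forall a : A, `|cstar_mul (star a) a| = `|a| ^+ 2
}.

#[short(type="cstarAlgType")]
HB.structure Definition CStarAlgebra (R : realType) :=
  {A of CompleteNormedModule R[i] A & isCStarAlgebra R A}.

#[non_forgetful_inheritance]
HB.instance Definition _ (R : realType) (A : cstarAlgType R) :=
  GRing.Zmodule_isNzRing.Build (CStarAlgebra.sort A) (@cstar_mulA R A)
    (@cstar_mul1l R A) (@cstar_mul1r R A) (@cstar_mulDl R A)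
    (@cstar_mulDr R A) (@cstar_one_neq0 R A).
#[non_forgetful_inheritance]
HB.instance Definition _ (R : realType) (A : cstarAlgType R) :=
  GRing.LSemiModule_isLSemiAlgebra.Build R[i] (CStarAlgebra.sort A)
    (@cstar_scaleAl R A).
#[non_forgetful_inheritance]
HB.instance Definition _ (R : realType) (A : cstarAlgType R) :=
  GRing.LSemiAlgebra_isSemiAlgebra.Build R[i] (CStarAlgebra.sort A)
    (@cstar_scaleAr R A).

Definition cstar_positive (R : realType) (A : cstarAlgType R) (a : A) : Prop :=
  exists b : A, a = star b * b.

HB.mixin Record isHilbertSpace (R : realType) H
    of CompleteNormedModule R[i] H := {
  hdot : H -> H -> R[i] ;
  hdotDr : forall x y z, hdot x (y + z) = hdot x y + hdot x z ;
  hdotZr : forall (c : R[i]) x y, hdot x (c *: y) = c * hdot x y ;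
  hdot_conj : forall x y, hdot y x = Num.conj (hdot x y) ;
  hdot_norm : forall x : H, `|x| ^+ 2 = hdot x x
}.

#[short(type="hilbertType")]
HB.structure Definition HilbertSpace (R : realType) :=
  {H of CompleteNormedModule R[i] H & isHilbertSpace R H}.

(* [ract xi a] is the right action xi a. Definiteness of [inner] is implied by
   [inner_norm]. *)
HB.mixin Record isHilbertModule (R : realType) (A : cstarAlgType R) E
    of CompleteNormedModule R[i] E := {
  ract : E -> A -> E ;
  ractDl : forall (x y : E) (a : A), ract (x + y) a = ract x a + ract y a ;
  ractDr : forall (x : E) (a b : A), ract x (a + b) = ract x a + ract x b ;
  ractZl : forall (c : R[i]) (x : E) (a : A), ract (c *: x) a = c *: ract x a ;
  ractZr : forall (c : R[i]) (x : E) (a : A), ract x (c *: a) = c *: ract x a ;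
  ractM : forall (x : E) (a b : A), ract x (a * b) = ract (ract x a) b ;
  ract1 : forall x : E, ract x 1 = x ;
  inner : E -> E -> A ;
  innerDr : forall x y z : E, inner x (y + z) = inner x y + inner x z ;
  innerZr : forall (c : R[i]) (x y : E), inner x (c *: y) = c *: inner x y ;
  inner_ract : forall (x y : E) (a : A), inner x (ract y a) = inner x y * a ;
  inner_star : forall x y : E, inner y x = star (inner x y) ;
  inner_positive : forall x : E, cstar_positive (inner x x) ;
  inner_norm : forall x : E, `|x| ^+ 2 = `|inner x x|
}.

#[short(type="hilbertModType")]
HB.structure Definition HilbertModule (R : realType) (A : cstarAlgType R) :=
  {E of CompleteNormedModule R[i] E & isHilbertModule R A E}.

Section Equivariant.
Variables (R : realType) (G : topologicalGroupType) (A : cstarAlgType R).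

(* Together with the type of [alpha], the first three clauses say that [alpha]
   is a group homomorphism from G to the *-automorphisms of A. *)
Record strongly_continuous_action (alpha : G -> {lrmorphism A -> A}) : Prop := {
  action1 : forall a, alpha 1%g a = a ;
  actionM : forall g h a, alpha (g * h)%g a = alpha g (alpha h a) ;
  action_star : forall g a, alpha g (star a) = star (alpha g a) ;
  action_continuous : forall a, continuous (fun g => alpha g a)
}.

Definition ergodic (alpha : G -> {lrmorphism A -> A}) : Prop :=
  forall a : A, (forall g, alpha g a = a) <-> (exists c : R[i], a = c%:A).

Record hilbert_GA_module (alpha : G -> {lrmorphism A -> A})
    (E : hilbertModType A) (beta : G -> {linear E -> E}) : Prop := {
  gam_mul : forall g h xi, beta (g * h)%g xi = beta g (beta h xi) ;
  gam_one : forall xi, beta 1%g xi = xi ;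
  gam_ract : forall g (xi : E) (a : A),
    beta g (ract xi a) = ract (beta g xi) (alpha g a) ;
  gam_continuous : forall xi, continuous (fun g => beta g xi) ;
  gam_inner : forall g (xi eta : E),
    inner (beta g xi) (beta g eta) = alpha g (inner xi eta)
}.

Record unitary_representation (H : hilbertType R)
    (gamma : G -> {linear H -> H}) : Prop := {
  rep_mul : forall g h x, gamma (g * h)%g x = gamma g (gamma h x) ;
  rep_one : forall x, gamma 1%g x = x ;
  rep_unitary : forall g x y, hdot (gamma g x) (gamma g y) = hdot x y ;
  rep_continuous : forall x, continuous (fun g => gamma g x)
}.

(* The Hilbert module A (x) H, given by its defining property of being a
   completion of the algebraic tensor product: a Hilbert A-module F with a
   bilinear map of A x H to F that realises the prescribed inner products and
   whose values span a dense subspace. The induced linear map from the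
   algebraic tensor product to F is then isometric with dense range, so F is
   unique up to a unitary compatible with [tens]. *)
Record is_hilbert_tensor (H : hilbertType R) (F : hilbertModType A)
    (tens : {bilinear A -> H -> F}) : Prop := {
  tens_ract : forall (a b : A) (x : H), ract (tens a x) b = tens (a * b) x ;
  tens_inner : forall (a b : A) (x y : H),
    inner (tens a x) (tens b y) = hdot x y *: (star a * b) ;
  tens_dense : dense [set v : F | exists (n : nat) (a : 'I_n -> A)
    (x : 'I_n -> H), v = \sum_(i < n) tens (a i) (x i)]
}.

(* The trivial G-A-module (A (x) H, alpha (x) gamma). By [gam_inner] and
   [tens_dense], [tm_tens] determines [tm_act]. *)
Record trivial_module (alpha : G -> {lrmorphism A -> A}) (H : hilbertType R)
    (gamma : G -> {linear H -> H}) := TrivialModule {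
  tm_mod : hilbertModType A ;
  tm_tens : {bilinear A -> H -> tm_mod} ;
  tm_tensP : is_hilbert_tensor tm_tens ;
  tm_act : G -> {linear tm_mod -> tm_mod} ;
  tm_actP : hilbert_GA_module alpha tm_act ;
  tm_act_tens : forall g a x,
    tm_act g (tm_tens a x) = tm_tens (alpha g a) (gamma g x)
}.

Arguments tm_act {alpha H gamma} t _.

Record equivariant_isometry (E F : hilbertModType A)
    (beta : G -> {linear E -> E}) (delta : G -> {linear F -> F})
    (T : {linear E -> F}) : Prop := {
  isom_ract : forall (xi : E) (a : A), T (ract xi a) = ract (T xi) a ;
  isom_inner : forall xi eta : E, inner (T xi) (T eta) = inner xi eta ;
  isom_equivariant : forall g xi, T (beta g xi) = delta g (T xi)
}.

Definition embeddable (alpha : G -> {lrmorphism A -> A})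
    (E : hilbertModType A) (beta : G -> {linear E -> E}) : Prop :=
  exists (H : hilbertType R) (gamma : G -> {linear H -> H}),
    unitary_representation gamma /\
    exists (M : trivial_module alpha gamma) (T : {linear E -> tm_mod M}),
      equivariant_isometry beta (tm_act M) T.

End Equivariant.

(* Main.v *)
Require Import Defs.
From HB Require Import structures.
From mathcomp Require Import all_boot all_order all_algebra complex.
From mathcomp Require Import all_classical all_reals all_analysis.
From mathcomp Require Import ring lra.

Set Implicit Arguments.
Unset Strict Implicit.
Unset Printing Implicit Defensive.

Import Order.TTheory GRing.Theory Num.Theory.
Import numFieldNormedType.Exports.
Local Open Scope classical_set_scope.
Local Open Scope ring_scope.
Local Open Scope complex_scope.

(** The average of [alpha g a] over [G] is fixed by the action, hence by
   ergodicity a scalar [phi a]: this is the invariant state of [A]. Completing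
   [E] for the scalar product [phi (inner x y)] gives a Hilbert space on which
   [G] acts by [beta], and the Hilbert space of the embedding consists of
   countably many copies of it. The embedding is made of equivariant contractions
   into the tensor product with [A].

   For a continuous function [f] on [G], the smoothing of [x] is the average
   [smear f x] of [f g *: beta g x]. By ergodicity again it is bounded from the
   norm of the state to the norm of [E], even on combinations with coefficients
   in [A] ([smooth_bound]). So every [xi] in [E] defines a bounded functional
   [x |-> inner (smear f x) xi] on the tensor product. Hilbert modules are not
   self-dual, and the point is that this functional is nevertheless given by a
   vector of the tensor product ([coef_approx]). Its squared components along an
   orthonormal family have bounded sums, so the state of what lies beyond a
   suitable finite family is small; and these sums move equicontinuously under
   [alpha], so that their norms are small as soon as their states are
   ([mass_small]). When [f] is a class function, the resulting contraction from
   [E] to the tensor product is equivariant.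

   Letting [f] run through class functions that shrink to the identity of [G],
   and adding up the contractions with summable weights, yields an equivariant
   contraction [W] that is adjointable, and the range of its adjoint is dense.
   With [P] the composite of [W] with its adjoint and [Y] the square root of
   [1 - P],
      [inner (W x) (W y) = inner x y - inner (Y x) (Y y)],
   so that [W], [W Y], [W Y ^ 2] and so on, placed in orthogonal copies, telescope
   to an isometry, as the powers of [Y] tend to [0] strongly ([inner_ladder]).
   It is equivariant and [A]-linear because [Y] commutes with [G] and with [A].

   Three tools are built along the way. The means over [G] are limits of averages
   over minimal covers of [G] by translates of small neighbourhoods, which match
   by Hall's theorem ([min_cover_matching], [haar_net_exists]). Positivity in a
   C*-algebra rests on the square root of [1 - P] for a contraction [P], a power
   series with nonnegative coefficients ([sqrt1B_sqr], [mpos_starM]). Tensor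
   products are modules of [A]-valued functions attached to positive definite
   kernels, so that maps into them are determined by their values
   ([tens_is_tensor], [rk_ext]). *)

(** * Real-valued norms and convergence of sequences *)

Section ComplexOrder.
Variable R : realType.
Implicit Type z : R[i].

Lemma ge0_ReE z : 0 <= z -> z = (complex.Re z)%:C.
Proof. by case: z => a b; rewrite lecE /= => /andP[/eqP -> _]. Qed.

Lemma Re_ge0 z : 0 <= z -> 0 <= complex.Re z.
Proof. by rewrite lecE => /andP[]. Qed.

Lemma Re_norm_ge0 z : 0 <= complex.Re `|z|.
Proof. exact: Re_ge0 (normr_ge0 z). Qed.

Lemma Re_gt0 z : 0 < z -> 0 < complex.Re z.
Proof. by rewrite ltcE /= => /andP[]. Qed.

End ComplexOrder.

Section RealNorm.
Variables (R : realType) (V : normedModType R[i]).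
Implicit Types (x y : V) (u v : nat -> V).

(** The norms of complex spaces are complex numbers; this is the same norm,
   read in the totally ordered field [R]. *)
Definition rn x : R := complex.Re `|x|.

Lemma rnE x : `|x| = (rn x)%:C.
Proof. exact: ge0_ReE (normr_ge0 x). Qed.

Lemma rn_ge0 x : 0 <= rn x.
Proof. by have := normr_ge0 x; rewrite rnE ler0c. Qed.

Lemma rn_le x (r : R) : (`|x| <= r%:C) = (rn x <= r).
Proof. by rewrite rnE lecR. Qed.

Lemma rn0 : rn 0 = 0.
Proof. by rewrite /rn normr0. Qed.

Lemma rn_eq0 x : rn x = 0 -> x = 0.
Proof. by move=> x0; apply: normr0_eq0; rewrite rnE x0. Qed.

Lemma rnD x y : rn (x + y) <= rn x + rn y.
Proof. by rewrite -lecR rmorphD /= -!rnE ler_normD. Qed.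

Lemma rnN x : rn (- x) = rn x.
Proof. by rewrite /rn normrN. Qed.

Lemma rnB x y : rn (x - y) = rn (y - x).
Proof. by rewrite -rnN opprB. Qed.

Lemma rnBD x y : rn (x - y) <= rn x + rn y.
Proof. by rewrite -(rnN y) rnD. Qed.

Lemma rn_tri z x y : rn (x - y) <= rn (x - z) + rn (z - y).
Proof. by rewrite -[x - y](subrKA z) rnD. Qed.

Lemma rn_sub x y : rn x <= rn (x - y) + rn y.
Proof. by rewrite -{1}(subrK y x) rnD. Qed.

Lemma rnZ (r : R) x : rn (r%:C *: x) = `|r| * rn x.
Proof.
by rewrite /rn normrZ; case: (`|x|) => a b; rewrite normc_def /= expr0n /= addr0 sqrtr_sqr mul0r subr0.
Qed.

Lemma rnZ_ge0 (r : R) x : 0 <= r -> rn (r%:C *: x) = r * rn x.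
Proof. by move=> r0; rewrite rnZ ger0_norm. Qed.

Lemma rn_sum I (s : seq I) (F : I -> V) :
  rn (\sum_(i <- s) F i) <= \sum_(i <- s) rn (F i).
Proof.
elim: s => [|i s IH]; first by rewrite !big_nil rn0.
by rewrite !big_cons (le_trans (rnD _ _)) // lerD2l.
Qed.

Lemma le_addeps (a b : R) : (forall e, 0 < e -> a <= b + e) -> a <= b.
Proof. by move=> h; apply/ler_addgt0Pr => e /h. Qed.

Definition tends u (l : V) : Prop :=
  forall e : R, 0 < e -> exists N : nat, forall n, (N <= n)%N -> rn (u n - l) <= e.

Lemma tends_uniq u l l' : tends u l -> tends u l' -> l = l'.
Proof.
move=> h h'; apply/eqP; rewrite -subr_eq0; apply/eqP/rn_eq0/le_anti.
rewrite rn_ge0 andbT; apply/ler_addgt0Pr => e e0; rewrite add0r.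
have e2 : 0 < e / 2 by rewrite divr_gt0.
have [N hN] := h _ e2; have [M hM] := h' _ e2.
rewrite (le_trans (rn_tri (u (maxn N M)) _ _)) // (splitr e) lerD //.
  by rewrite rnB hN // leq_maxl.
by rewrite hM // leq_maxr.
Qed.

Lemma tends_cst l : tends (fun=> l) l.
Proof. by move=> e e0; exists 0%N => n _; rewrite subrr rn0 ltW. Qed.

Lemma tendsD u v l m : tends u l -> tends v m -> tends (fun n => u n + v n) (l + m).
Proof.
move=> h h' e e0; have e2 : 0 < e / 2 by rewrite divr_gt0.
have [N hN] := h _ e2; have [M hM] := h' _ e2; exists (maxn N M) => n.
rewrite geq_max => /andP[/hN a /hM b].
by rewrite opprD addrACA (le_trans (rnD _ _)) // (splitr e) lerD.
Qed.

Lemma tendsN u l : tends u l -> tends (fun n => - u n) (- l).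
Proof.
by move=> h e /h[N hN]; exists N => n /hN; rewrite -opprD rnN.
Qed.

Lemma tendsB u v l m : tends u l -> tends v m -> tends (fun n => u n - v n) (l - m).
Proof. by move=> h h'; apply: tendsD h (tendsN h'). Qed.

Lemma tends_ext u v l : (forall n, u n = v n) -> tends u l -> tends v l.
Proof. by move=> h hu e /hu[N hN]; exists N => n /hN; rewrite h. Qed.

Lemma tends_shift u l k : tends u l -> tends (fun n => u (n + k)%N) l.
Proof.
move=> h e /h[N hN]; exists N => n Nn; apply: hN.
by rewrite (leq_trans Nn) // leq_addr.
Qed.

Lemma tends_rn_le u l (C : R) : (forall n, rn (u n) <= C) -> tends u l -> rn l <= C.
Proof.
move=> hC h; apply: le_addeps => e /h[N /(_ N (leqnn _)) hN].
by rewrite addrC (le_trans (rn_sub l (u N))) // lerD // rnB.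
Qed.

End RealNorm.

Section LipMap.
Variables (R : realType) (V W : normedModType R[i]).

Lemma tends_lip (f : V -> W) (C : R) (u : nat -> V) l : 0 <= C ->
  (forall x y, rn (f x - f y) <= C * rn (x - y)) ->
  tends u l -> tends (fun n => f (u n)) (f l).
Proof.
move=> C0 hf h e e0; have C1 : 0 < C + 1 by rewrite ltr_wpDl.
have [N hN] := h _ (divr_gt0 e0 C1); exists N => n /hN hn.
rewrite (le_trans (hf _ _)) // (@le_trans _ _ ((C + 1) * (e / (C + 1)))) //.
  by rewrite ler_pM ?rn_ge0 // lerDl.
by rewrite mulrC divfK // gt_eqF.
Qed.

End LipMap.

Section Complete.
Variables (R : realType) (X : completeNormedModType R[i]).

Lemma tends_complete (u : nat -> X) :
  (forall e : R, 0 < e -> exists N : nat, forall m n, (N <= m)%N -> (m <= n)%N ->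
    rn (u m - u n) <= e) ->
  exists l, tends u l.
Proof.
move=> h; have /cvg_ex[l ul] : cvg (u @ \oo).
  apply: cauchy_cvg; apply/cauchy_ballP => e e0.
  have e0' := Re_gt0 e0; have eE := ge0_ReE (ltW e0).
  have [N hN] := h _ (divr_gt0 e0' (ltr0n R 2)).
  have key m n : (N <= m)%N -> (N <= n)%N -> `|u m - u n| < e.
    move=> Nm Nn; rewrite rnE eE ltcR.
    have e2 : complex.Re e / 2 < complex.Re e by rewrite ltr_pdivrMr // ltr_pMr // ltr1n.
    case/orP: (leq_total m n) => mn; first exact: le_lt_trans (hN _ _ Nm mn) e2.
    by rewrite rnB; exact: le_lt_trans (hN _ _ Nn mn) e2.
  exists (u @` [set n | (N <= n)%N], u @` [set n | (N <= n)%N]) => /=.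
    by split; exists N => // n /= Nn; exists n.
  by move=> [a b] /= [[m Nm <-] [n Nn <-]]; rewrite -ball_normE /=; exact: key.
exists l => e e0; have e0' : 0 < e%:C by rewrite ltcR.
move/cvgrPdist_le: ul => /(_ _ e0') [N _ hN]; exists N => n Nn.
by rewrite rnB -rn_le; exact: hN.
Qed.

End Complete.

Lemma bounded_mono_cauchy (R : realType) (a : nat -> R) (C : R) :
  {homo a : m n / (m <= n)%N >-> m <= n} -> (forall n, a n <= C) ->
  forall e : R, 0 < e -> exists N : nat, forall m n, (N <= m)%N -> (m <= n)%N ->
    a n - a m <= e.
Proof.
move=> am aC e e0.
have hs : has_sup (range a).
  by split; [exists (a 0%N), 0%N | exists C => _ [n _ <-]].
have [_ [N _ <-] hN] := sup_adherent e0 hs; exists N => m n Nm mn.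
have an : a n <= sup (range a) by apply: (sup_upper_bound hs); exists n.
have := am _ _ Nm; lra.
Qed.

(** * Square roots of operators *)

Section PolyOp.
Variables (R : realType) (X : normedModType R[i]) (P : {linear X -> X}).
Implicit Types (p q : {poly R}) (x : X).

Definition pev p x : X := \sum_(i < size p) (p`_i)%:C *: iter i P x.

Lemma pevE n p x : (size p <= n)%N -> pev p x = \sum_(i < n) (p`_i)%:C *: iter i P x.
Proof.
move=> pn; rewrite /pev -!(big_mkord xpredT (fun i => (p`_i)%:C *: iter i P x)).
rewrite (big_cat_nat (leq0n _) pn) /= [X in _ + X]big_nat_cond [X in _ + X]big1 ?addr0 //.
by move=> i /andP[/andP[pi _] _]; rewrite nth_default // scale0r.
Qed.

Lemma pevD p q x : pev (p + q) x = pev p x + pev q x.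
Proof.
pose n := maxn (size p) (size q).
rewrite (@pevE n) ?size_polyD // (@pevE n p) ?leq_maxl // (@pevE n q) ?leq_maxr //.
by rewrite -big_split; apply: eq_bigr => i _; rewrite coefD rmorphD scalerDl.
Qed.

Lemma pevZ c p x : pev (c *: p) x = c%:C *: pev p x.
Proof.
rewrite (@pevE (size p)) ?size_scale_leq // /pev scaler_sumr.
by apply: eq_bigr => i _; rewrite coefZ rmorphM scalerA.
Qed.

Lemma pev_lin p : linear (pev p).
Proof.
move=> c x y; rewrite /pev scaler_sumr -big_split /=; apply: eq_bigr => i _.
have -> : iter i P (c *: x + y) = c *: iter i P x + iter i P y.
  by elim: (i : nat) => //= k ->; rewrite linearP.
by rewrite scalerDr !scalerA mulrC.
Qed.

Lemma pevB p x y : pev p (x - y) = pev p x - pev p y.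
Proof. by rewrite addrC -scaleN1r pev_lin scaleN1r addrC. Qed.

Lemma pev_cX p c x : pev (p * 'X + c%:P) x = P (pev p x) + c%:C *: x.
Proof.
rewrite (@pevE (size p).+1); last first.
  rewrite (leq_trans (size_polyD _ _)) // geq_max size_polyC.
  rewrite (leq_trans (leq_b1 _)) // andbT.
  by have [->|/size_mulX ->] := eqVneq p 0; rewrite ?mul0r ?size_poly0.
rewrite big_ord_recl addrC; congr (_ + _); last first.
  by rewrite coefD coefMX coefC eqxx add0r.
rewrite /pev linear_sum; apply: eq_bigr => i _.
by rewrite coefD coefMX coefC /= addr0 linearZ.
Qed.

Lemma pevX x : pev 'X x = P x.
Proof. by rewrite /pev size_polyX !big_ord_recl big_ord0 !coefX /= scale0r scale1r add0r addr0. Qed.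

Lemma pev0 x : pev 0 x = 0.
Proof. by rewrite /pev size_poly0 big_ord0. Qed.

Lemma pevM p q x : pev (p * q) x = pev p (pev q x).
Proof.
elim/poly_ind: p => [|p c IH]; first by rewrite mul0r !pev0.
rewrite mulrDl pevD mulrAC pev_cX -IH.
rewrite -[X in pev X x]addr0 -(polyC0) pev_cX scale0r addr0; congr (_ + _).
by rewrite mul_polyC pevZ.
Qed.

Definition nnpoly p := forall i, 0 <= p`_i.

Lemma pev_bound p x : (forall y, rn (P y) <= rn y) -> nnpoly p ->
  rn (pev p x) <= p.[1] * rn x.
Proof.
move=> hP p0; rewrite /pev (le_trans (rn_sum _ _)) // horner_coef mulr_suml.
apply: ler_sum => i _; rewrite expr1n mulr1 rnZ_ge0 // ler_wpM2l //.
by elim: (i : nat) => //= k IH; exact: le_trans (hP _) IH.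
Qed.

Lemma pev_commute (L : X -> X) p x :
  {morph L : y z / y + z} -> (forall (c : R) y, L (c%:C *: y) = c%:C *: L y) ->
  (forall y, L (P y) = P (L y)) -> L (pev p x) = pev p (L x).
Proof.
move=> LD LZ LP; have L0 : L 0 = 0 by rewrite -[X in L X](scale0r x) (LZ 0) scale0r.
rewrite /pev (big_morph L LD L0); apply: eq_bigr => i _; rewrite LZ; congr (_ *: _).
by elim: (i : nat) => //= k IH; rewrite LP IH.
Qed.

End PolyOp.

Section SqrtPoly.
Variable R : realType.

(** The successive approximations of [z = (x + z ^+ 2) / 2], whose solution
   [z = 1 - sqrt (1 - x)] has a power series with nonnegative coefficients. *)
Fixpoint zpoly n : {poly R} :=
  if n is k.+1 then 2^-1 *: ('X + zpoly k ^+ 2) else 0.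

Lemma nnpolyD (p q : {poly R}) : nnpoly p -> nnpoly q -> nnpoly (p + q).
Proof. by move=> h k i; rewrite coefD addr_ge0. Qed.

Lemma nnpolyM (p q : {poly R}) : nnpoly p -> nnpoly q -> nnpoly (p * q).
Proof. by move=> h k i; rewrite coefM sumr_ge0 // => j _; rewrite mulr_ge0. Qed.

Lemma zpoly_nn n : nnpoly (zpoly n).
Proof.
elim: n => [|n IH] i /=; first by rewrite coef0.
rewrite coefZ mulr_ge0 // coefD addr_ge0 //; first by rewrite coefX; case: eqP.
by rewrite expr2; exact: nnpolyM.
Qed.

Lemma zpoly_incr n : nnpoly (zpoly n.+1 - zpoly n).
Proof.
elim: n => [|n IH].
  by rewrite subr0 => i; rewrite /= expr2 mul0r addr0 coefZ coefX; case: eqP => _; rewrite ?mulr1 ?mulr0.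
rewrite [zpoly n.+2]/= [X in _ - X]/= -scalerBr opprD addrACA subrr add0r subr_sqr => i.
rewrite coefZ mulr_ge0 //; apply: nnpolyM => //.
exact: nnpolyD (zpoly_nn n.+1) (zpoly_nn n).
Qed.

Lemma zpoly_mono m n : (m <= n)%N -> nnpoly (zpoly n - zpoly m).
Proof.
move=> /subnK <-; elim: (n - m)%N => [|k IH]; first by rewrite subrr => i; rewrite coef0.
by rewrite addSn -(subrKA (zpoly (k + m))); apply: nnpolyD => //; exact: zpoly_incr.
Qed.

Lemma nnpoly_horner1 (p : {poly R}) : nnpoly p -> 0 <= p.[1].
Proof. by move=> h; rewrite horner_coef sumr_ge0 // => i _; rewrite expr1n mulr1. Qed.

Lemma zpoly_le1 n : (zpoly n).[1] <= 1.
Proof.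
elim: n => [|n IH]; first by rewrite /= horner0 ler01.
have := nnpoly_horner1 (zpoly_nn n).
rewrite /= hornerZ hornerD hornerX horner_exp; nra.
Qed.

End SqrtPoly.

Section SqrtOp.
Variables (R : realType) (X : completeNormedModType R[i]) (P : {linear X -> X}).
Hypothesis P_contr : forall x, rn (P x) <= rn x.

Let z n x := pev P (zpoly R n) x.

Let z_le n x : rn (z n x) <= rn x.
Proof.
rewrite (le_trans (pev_bound _ P_contr (@zpoly_nn R n))) //.
by rewrite -[leRHS]mul1r ler_wpM2r ?rn_ge0 ?zpoly_le1.
Qed.

Let z_lim x : exists l, tends (z ^~ x) l.
Proof.
apply: tends_complete => e e0.
have x1 : 0 < rn x + 1 by rewrite ltr_wpDl ?rn_ge0.
have [||N hN] := @bounded_mono_cauchy R (fun n => (zpoly R n).[1]) 1 _ _ _ (divr_gt0 e0 x1).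
- move=> m n /(@zpoly_mono R)/nnpoly_horner1; by rewrite hornerD hornerN subr_ge0.
- exact: zpoly_le1.
exists N => m n Nm mn; rewrite rnB /z.
have -> : pev P (zpoly R n) x = pev P (zpoly R n - zpoly R m) x + pev P (zpoly R m) x.
  by rewrite -pevD subrK.
rewrite addrK (le_trans (pev_bound _ P_contr (zpoly_mono R mn))) //.
rewrite (hornerD (zpoly R n)) hornerN (@le_trans _ _ (e / (rn x + 1) * (rn x + 1))) //; last first.
  by rewrite divfK // gt_eqF.
by rewrite ler_pM ?rn_ge0 ?hN ?lerDl // -hornerN -hornerD nnpoly_horner1 //; exact: zpoly_mono.
Qed.

Let Z x := sval (cid (z_lim x)).

Let ZP x : tends (z ^~ x) (Z x).
Proof. exact: (svalP (cid (z_lim x))). Qed.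

Definition sqrt1B x : X := x - Z x.

Lemma sqrt1B_tends x : tends (fun n => x - pev P (zpoly R n) x) (sqrt1B x).
Proof. exact: tendsB (tends_cst x) (ZP x). Qed.

Lemma sqrt1B_sqr x : sqrt1B (sqrt1B x) = x - P x.
Proof.
have ZB y y' : Z (y - y') = Z y - Z y'.
  apply: tends_uniq (ZP _) _; apply: tends_ext (tendsB (ZP y) (ZP y')) => n.
  by rewrite /z pevB.
have ZZ : Z x + Z x = P x + Z (Z x).
  have lim2 : tends (fun n => z n x + z n x) (Z x + Z x) by exact: tendsD.
  apply: tends_uniq (tends_shift 1 lim2) _.
  have zz : tends (fun n => z n (z n x)) (Z (Z x)).
    have h1 : tends (fun n => z n (z n x - Z x)) 0.
      move=> e /(ZP x)[N hN]; exists N => n /hN h.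
      by rewrite subr0 (le_trans (z_le _ _)).
    rewrite -[Z (Z x)]add0r; apply: tends_ext (tendsD h1 (ZP (Z x))) => n.
    by rewrite /z pevB subrK.
  apply: tends_ext (tendsD (tends_cst (P x)) zz) => n.
  rewrite /z -pevD addn1 /= -scalerDl -mulr2n -[2^-1 *+ 2]mulr_natr mulVf // scale1r.
  by rewrite pevD pevX expr2 pevM.
have ZE : Z (Z x) = Z x + Z x - P x by rewrite ZZ addrAC subrr add0r.
by rewrite /sqrt1B ZB ZE -addrA opprB (addrAC (Z x + Z x)) addrK addKr.
Qed.

(** A square root is a limit of polynomials, so it commutes with every bounded
   real-linear map that commutes with the operator. *)
Lemma sqrt1B_commute (L : X -> X) (C : R) x : 0 <= C ->
  {morph L : y z / y + z} -> (forall (c : R) y, L (c%:C *: y) = c%:C *: L y) ->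
  (forall y, rn (L y) <= C * rn y) ->
  (forall y, L (P y) = P (L y)) -> L (sqrt1B x) = sqrt1B (L x).
Proof.
move=> C0 LD LZ LC LP.
have LB y z' : L (y - z') = L y - L z'.
  have LN w : L (- w) = - L w by rewrite -scaleN1r -[-1](rmorphN1 (@real_complex R)) LZ rmorphN1 scaleN1r.
  by rewrite LD LN.
apply: tends_uniq (sqrt1B_tends (L x)).
have h y y' : rn (L y - L y') <= C * rn (y - y') by rewrite -LB.
apply: tends_ext (tends_lip C0 h (sqrt1B_tends x)) => n.
by rewrite LB (pev_commute _ _ LD LZ LP).
Qed.

Lemma sqrt1B_lin : linear sqrt1B.
Proof.
move=> c x y.
have h : tends (fun n => c *: (x - pev P (zpoly R n) x) + (y - pev P (zpoly R n) y))
   (c *: sqrt1B x + sqrt1B y).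
  apply: tendsD (sqrt1B_tends y).
  apply: (@tends_lip R X X (fun u => c *: u) (complex.Re `|c|)) (sqrt1B_tends x).
    exact: Re_norm_ge0.
  move=> u v; rewrite -scalerBr /rn normrZ.
  have := normr_ge0 c; case: (`|c|) => a b; rewrite lecE /= => /andP[/eqP -> _].
  by have := rnE (u - v); rewrite /rn => -> /=; rewrite mul0r subr0.
apply: tends_uniq (sqrt1B_tends _) (tends_ext _ h) => n.
by rewrite pev_lin scalerBr opprD addrACA.
Qed.

End SqrtOp.

(** * Positive elements of a C*-algebra *)

Section Complex.
Variable R : realType.

Lemma conjC_real (r : R) : Num.conj (r%:C) = r%:C :> R[i].
Proof. by apply: conj_Creal; rewrite complex_real. Qed.

Lemma scale_half (V : lmodType R[i]) (x : V) : 2^-1%:C *: (x + x) = x.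
Proof.
have -> : x + x = 2%:C *: x by rewrite -[2]/(1 + 1) rmorphD scalerDl !scale1r.
by rewrite scalerA -rmorphM mulVf ?scale1r.
Qed.

Lemma rn_complex (V : normedModType R[i]) (c : R[i]) (x : V) :
  rn (c *: x) = complex.Re `|c| * rn x.
Proof.
rewrite /rn normrZ; have := rnE x; rewrite /rn => ->.
by case: (`|c|) => a b /=; rewrite mulr0 subr0.
Qed.

End Complex.

Section CStar.
Variables (R : realType) (A : cstarAlgType R).
Implicit Types (a b c d s v y : A) (t r : R).

Lemma rnM a b : rn (a * b) <= rn a * rn b.
Proof. by have := cstar_ler_normM a b; rewrite !rnE -rmorphM lecR. Qed.

Lemma rn_starM a : rn (star a * a) = rn a ^+ 2.
Proof. by have := cstar_identity a; rewrite !rnE -rmorphXn => -[]. Qed.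

Lemma star_mul a b : star (a * b) = star b * star a.
Proof. exact: starM. Qed.

Lemma star0 : star (0 : A) = 0.
Proof. by rewrite -[in LHS](scale0r 1) starZ conjC0 scale0r. Qed.

Lemma starN a : star (- a) = - star a.
Proof. by rewrite -scaleN1r starZ rmorphN1 scaleN1r. Qed.

Lemma starB a b : star (a - b) = star a - star b.
Proof. by rewrite starD starN. Qed.

Lemma star1 : star (1 : A) = 1.
Proof. by rewrite -[in LHS](mulr1 (star 1)) -{2}(starK 1) -star_mul mulr1 starK. Qed.

Lemma starZr r a : star (r%:C *: a) = r%:C *: star a.
Proof. by rewrite starZ conjC_real. Qed.

Lemma star_sum I (l : seq I) (F : I -> A) :
  star (\sum_(i <- l) F i) = \sum_(i <- l) star (F i).
Proof. exact: (big_morph _ (@starD _ A) star0). Qed.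

Lemma rn_star a : rn (star a) = rn a.
Proof.
have h b : rn b <= rn (star b).
  have [b0|b0] := eqVneq (rn b) 0; first by rewrite b0 rn_ge0.
  have b1 : 0 < rn b by rewrite lt_neqAle eq_sym b0 rn_ge0.
  by rewrite -(ler_pM2r b1) -expr2 -rn_starM rnM.
by apply/le_anti; rewrite h -{2}[a]starK h.
Qed.

Lemma rn1 : rn (1 : A) = 1.
Proof.
have h : rn (1 : A) != 0 by apply: contraNneq (oner_neq0 A) => /rn_eq0 ->.
by apply: (mulfI h); rewrite mulr1 -expr2 -rn_starM star1 mulr1.
Qed.

Lemma rnA t : 0 <= t -> rn (t%:C%:A : A) = t.
Proof. by move=> t0; rewrite rnZ_ge0 // rn1 mulr1. Qed.

Lemma realscaleAl t a b : t%:C *: (a * b) = (t%:C *: a) * b.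
Proof. exact: scalerAl. Qed.

Lemma realscaleAr t a b : t%:C *: (a * b) = a * (t%:C *: b).
Proof. exact: scalerAr. Qed.

Definition lmul a : A -> A := fun x => a * x.

Lemma lmul_linear a : linear (lmul a).
Proof. by move=> c x y; rewrite /lmul mulrDr scalerAr. Qed.
HB.instance Definition _ a := GRing.isLinear.Build R[i] A A *:%R (lmul a) (lmul_linear a).

Lemma sqrt_contr a : star a = a -> rn a <= 1 ->
  exists v, [/\ star v = v, v * v = 1 - a, rn (1 - v) <= 1 &
    forall c, c * a = a * c -> c * v = v * c].
Proof.
move=> sa a1; have ha x : rn (lmul a x) <= rn x.
  by rewrite (le_trans (rnM _ _)) // -[leRHS]mul1r ler_wpM2r ?rn_ge0.
pose v := sqrt1B ha 1.
have vr y : sqrt1B ha y = v * y.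
  rewrite -{1}[y]mul1r /v -(@sqrt1B_commute R A (lmul a) ha (fun x => x * y) (rn y)) //.
  - exact: rn_ge0.
  - by move=> ? ?; rewrite mulrDl.
  - by move=> ? ?; rewrite realscaleAl.
  - by move=> x /=; rewrite mulrC rnM.
  - by move=> x /=; rewrite /lmul mulrA.
exists v; split.
- apply: tends_uniq _ (sqrt1B_tends ha 1).
  have st : forall x y : A, rn (star x - star y) <= 1 * rn (x - y).
    by move=> x y; rewrite -starB rn_star mul1r.
  apply: tends_ext (tends_lip ler01 st (sqrt1B_tends ha 1)) => n.
  rewrite starB star1 /pev star_sum; congr (1 - _); apply: eq_bigr => i _.
  rewrite starZr; congr (_ *: _).
  have -> : iter i (lmul a) 1 = a ^+ i.
    by elim: (i : nat) => //= k ->; rewrite /lmul exprS.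
  elim: (i : nat) => [|k IH]; first by rewrite expr0 star1.
  by rewrite exprS star_mul IH sa -exprSr -exprS.
- by rewrite -vr /v sqrt1B_sqr /= /lmul mulr1.
- apply: (@tends_rn_le R A (fun n => pev (lmul a) (zpoly R n) 1)) => [n|].
    rewrite (le_trans (pev_bound _ ha (@zpoly_nn R n))) // rn1 mulr1.
    exact: zpoly_le1.
  have h := tendsB (tends_cst (1 : A)) (sqrt1B_tends ha 1).
  apply: tends_ext h => n.
  by rewrite opprB addrC subrK.
- move=> c ca; rewrite -vr -{2}[c]mulr1 /v.
  apply: (@sqrt1B_commute R A (lmul a) ha (fun x => c * x) (rn c)).
  - exact: rn_ge0.
  - by move=> ? ?; rewrite mulrDr.
  - by move=> ? ?; rewrite realscaleAr.
  - by move=> x; rewrite rnM.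
  - by move=> x; rewrite /= /lmul !mulrA ca.
Qed.

(** Two commuting self-adjoint elements with squares adding up to [1] are the
   real and imaginary parts of the unitary [v + i y]. *)
Lemma unitary_part v y : star v = v -> star y = y -> v * y = y * v ->
  v * v + y * y = 1 -> rn v <= 1.
Proof.
move=> sv sy vy vvyy; pose u := v + 'i%R *: y.
have su : star u = v - 'i%R *: y by rewrite starD starZ conjCi sv sy scaleNr.
have uu : star u * u = 1.
  rewrite su mulrDr !mulrDl -vvyy !mulNr -!scalerAl -!scalerAr vy scalerA -(expr2 'i%R) sqrCi.
  by rewrite scaleN1r opprK addrA subrK.
have u1 : rn u = 1.
  have /eqP := rn_starM u; rewrite uu rn1 eq_sym sqrf_eq1 => /orP[/eqP //|/eqP h].
  by have := rn_ge0 u; rewrite h; lra.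
have : rn (v + v) <= 2.
  have -> : v + v = u + star u by rewrite su addrACA subrr addr0.
  by rewrite (le_trans (rnD _ _)) // rn_star u1.
have -> : v + v = 2%:C *: v.
  by rewrite -[2]/(1 + 1) rmorphD scalerDl !scale1r.
by rewrite rnZ_ge0 //; lra.
Qed.

(** An element is positive when it is self-adjoint with spectrum in [0, 2t]
   for some [t]; the norm condition says the latter without the spectrum. *)
Definition mpos a : Prop :=
  star a = a /\ exists2 t, 0 <= t & rn (t%:C%:A - a) <= t.

Lemma mpos_sa a : mpos a -> star a = a.
Proof. by case. Qed.

Lemma mpos_sqr_bound y t : star y = y -> rn y ^+ 2 <= t -> rn (t%:C%:A - y * y) <= t.
Proof.
move=> sy yt.
have t0 : 0 <= t by rewrite (le_trans _ yt) // sqr_ge0.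
have [t0'|t_neq0] := eqVneq t 0.
  have /rn_eq0 -> : rn y = 0 by have := rn_ge0 y; nra.
  by rewrite t0' mul0r scale0r subr0 rn0.
have tp : 0 < t by rewrite lt_neqAle eq_sym t_neq0.
pose q := Num.sqrt t; have q0 : 0 < q by rewrite sqrtr_gt0.
have qq : q * q = t by rewrite -expr2 sqr_sqrtr.
pose w := q^-1%:C *: y.
have yw : y = q%:C *: w by rewrite scalerA -rmorphM divff ?scale1r // gt_eqF.
have sw : star w = w by rewrite starZr sy.
have w1 : rn w <= 1.
  rewrite rnZ_ge0 ?invr_ge0 ?(ltW q0) // ler_pdivrMl // mulr1.
  by rewrite -ler_sqr ?nnegrE ?rn_ge0 ?(ltW q0) // [leRHS]expr2 qq.
have ww1 : rn (w * w) <= 1.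
  by rewrite (le_trans (rnM _ _)) // mulr_ile1 // rn_ge0.
have sww : star (w * w) = w * w by rewrite star_mul sw.
have [v [sv vv _ vc]] := sqrt_contr sww ww1.
have v1 : rn v <= 1.
  by apply: (@unitary_part v w) => //; [rewrite vc // mulrA | rewrite vv subrK].
have -> : t%:C%:A - y * y = t%:C *: (v * v).
  rewrite vv scalerBr; congr (_ - _).
  have -> : y * y = (q%:C *: w) * (q%:C *: w) by rewrite -yw.
  by rewrite -realscaleAl -realscaleAr scalerA -rmorphM qq.
rewrite rnZ_ge0 // -[leRHS]mulr1 ler_wpM2l // (le_trans (rnM _ _)) //.
by rewrite mulr_ile1 // rn_ge0.
Qed.

Lemma mpos_sqr y : star y = y -> mpos (y * y).
Proof.
move=> sy; split; first by rewrite star_mul sy.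
by exists (rn y ^+ 2); [rewrite sqr_ge0 | exact: mpos_sqr_bound].
Qed.

Lemma mpos0 : mpos 0.
Proof. by rewrite -(mulr0 0); apply: mpos_sqr; rewrite star0. Qed.

Lemma mposZ r a : 0 <= r -> mpos a -> mpos (r%:C *: a).
Proof.
move=> r0 [sa [t t0 ht]]; split; first by rewrite starZr sa.
exists (r * t); first by rewrite mulr_ge0.
rewrite rmorphM -scalerA -scalerBr rnZ_ge0 //; exact: ler_wpM2l.
Qed.

Lemma mpos_sqrt a : mpos a -> exists y, [/\ mpos y, y * y = a &
  forall c, c * a = a * c -> c * y = y * c].
Proof.
case=> sa [t t0 ht].
have [t0'|t_neq0] := eqVneq t 0.
  move: ht; rewrite t0' scale0r sub0r rnN => /(conj (rn_ge0 a))/andP/le_anti/esym/rn_eq0 ->.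
  by exists 0; split; [exact: mpos0|rewrite mul0r|move=> c _; rewrite mulr0 mul0r].
have tp : 0 < t by rewrite lt_neqAle eq_sym t_neq0.
pose q := Num.sqrt t; have q0 : 0 < q by rewrite sqrtr_gt0.
have qq : q * q = t by rewrite -expr2 sqr_sqrtr.
pose b := 1 - t^-1%:C *: a.
have sb : star b = b by rewrite starB star1 starZr sa.
have tb : t%:C *: b = t%:C%:A - a.
  by rewrite scalerBr scalerA -rmorphM divff ?gt_eqF // scale1r.
have b1 : rn b <= 1.
  by rewrite -(ler_pM2l tp) -rnZ_ge0 // tb mulr1.
have [v [sv vv v1 vc]] := sqrt_contr sb b1.
exists (q%:C *: v); split.
- apply: mposZ; first exact: ltW.
  by split => //; exists 1 => //; rewrite scale1r.
- rewrite -realscaleAl -realscaleAr scalerA -rmorphM qq vv opprB addrC subrK scalerA.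
  by rewrite -rmorphM divff ?gt_eqF // scale1r.
- move=> c ca; rewrite -realscaleAl -realscaleAr vc // /b mulrBr mulrBl mulr1 mul1r.
  by rewrite -realscaleAl -realscaleAr ca.
Qed.

Lemma mpos_bound a t : mpos a -> rn a <= t -> rn (t%:C%:A - a) <= t.
Proof.
move=> /mpos_sqrt[y [[sy _] <- _]]; rewrite -{1}sy rn_starM; exact: mpos_sqr_bound.
Qed.

Lemma mposI a t : star a = a -> 0 <= t -> rn (t%:C%:A - a) <= t -> mpos a.
Proof. by move=> sa t0 h; split => //; exists t. Qed.

Lemma mposD a b : mpos a -> mpos b -> mpos (a + b).
Proof.
move=> [sa [t t0 ht]] [sb [u u0 hu]]; apply: (@mposI _ (t + u)).
- by rewrite starD sa sb.
- by rewrite addr_ge0.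
by rewrite rmorphD scalerDl opprD addrACA (le_trans (rnD _ _)) // lerD.
Qed.

Lemma mpos_sum I (l : seq I) (Q : pred I) (F : I -> A) :
  (forall i, Q i -> mpos (F i)) -> mpos (\sum_(i <- l | Q i) F i).
Proof. by move=> h; elim/big_ind: _ => //; [exact: mpos0|exact: mposD]. Qed.

Lemma star_tends (u : nat -> A) a : tends u a -> tends (fun n => star (u n)) (star a).
Proof.
by apply: tends_lip ler01 _ => x y; rewrite -starB rn_star mul1r.
Qed.

Lemma mpos_closed (u : nat -> A) a : (forall n, mpos (u n)) -> tends u a -> mpos a.
Proof.
move=> hu ua; apply: (@mposI _ (rn a + 1)).
- apply: (tends_uniq _ ua); apply: tends_ext (star_tends ua) => n.
  exact: mpos_sa.
- by rewrite addr_ge0 // rn_ge0.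
have [N hN] := ua _ ltr01.
apply: (@tends_rn_le R A (fun n => (rn a + 1)%:C%:A - u (n + N)%N)) => [n|].
  apply: mpos_bound => //; rewrite addrC (le_trans (rn_sub _ a)) // lerD2r.
  by rewrite hN // leq_addl.
by apply: tendsB (tends_cst _) (tends_shift _ ua).
Qed.

Lemma mpos_scalar t : 0 <= t -> mpos (t%:C%:A).
Proof. by move=> t0; apply: mposZ => //; rewrite -(mulr1 1); apply: mpos_sqr; rewrite star1. Qed.

Lemma mpos_subA a t : star a = a -> rn a <= t -> mpos (t%:C%:A - a).
Proof.
move=> sa at_; apply: (@mposI _ t).
- by rewrite starB starZr star1 sa.
- exact: le_trans (rn_ge0 _) at_.
by rewrite opprB addrC subrK.
Qed.

Lemma mpos_le1 a : mpos a -> mpos (1 - a) -> rn a <= 1.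
Proof.
move=> /mpos_sqrt[y [[sy _] yy yc]] /mpos_sqrt[v [[sv _] vv vc]].
have h : rn y <= 1.
  apply: (@unitary_part y v) => //; last by rewrite yy vv addrC subrK.
  by rewrite vc // -yy mulrBr mulrBl mulr1 mul1r mulrA.
by rewrite -yy -{1}sy rn_starM expr_le1 ?rn_ge0.
Qed.

Lemma mpos_le_norm a b : mpos a -> mpos (b - a) -> rn a <= rn b.
Proof.
move=> pa pba; apply: le_addeps => e e0; pose t := rn b + e.
have t0 : 0 < t by rewrite ltr_wpDl ?rn_ge0.
have sb : star b = b by rewrite -(subrK a b) starD (mpos_sa pa) (mpos_sa pba).
have h : rn (t^-1%:C *: a) <= 1.
  apply: mpos_le1; first by apply: mposZ => //; rewrite invr_ge0 ltW.
  have -> : 1 - t^-1%:C *: a = t^-1%:C *: (t%:C%:A - b + (b - a)).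
    by rewrite subrKA scalerBr scalerA -rmorphM mulVf ?scale1r // gt_eqF.
  apply: mposZ; first by rewrite invr_ge0 ltW.
  apply: mposD => //; apply: mpos_subA => //; by rewrite lerDl ltW.
move: h; rewrite rnZ_ge0 ?invr_ge0 ?(ltW t0) //.
by rewrite ler_pdivrMl // mulr1.
Qed.

Lemma mpos_anti a : mpos a -> mpos (- a) -> a = 0.
Proof.
move=> pa na; apply: rn_eq0; apply/le_anti; rewrite rn_ge0 andbT -(rn0 A).
by apply: mpos_le_norm => //; rewrite sub0r.
Qed.

Lemma mpos_mul a b : mpos a -> mpos b -> a * b = b * a -> mpos (a * b).
Proof.
move=> /mpos_sqrt[x [[sx _] xx xc]] /mpos_sqrt[y [[sy _] yy yc]] ab.
have xb : x * b = b * x by rewrite xc.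
have xy : x * y = y * x by rewrite yc.
have -> : a * b = (x * y) * (x * y) by rewrite -xx -yy -!mulrA (mulrA y) -xy !mulrA.
by apply: mpos_sqr; rewrite star_mul sx sy.
Qed.

Lemma mpos_starM_swap d : mpos (star d * d + d * star d).
Proof.
have h : (star d * d + d * star d) = 2^-1%:C *:
   ((d + star d) * (d + star d) + ('i%R *: (d - star d)) * ('i%R *: (d - star d))).
  rewrite -scalerAl -scalerAr scalerA -(expr2 'i%R) sqrCi scaleN1r.
  have -> : (d + star d) * (d + star d) = (d * d + star d * star d) + (star d * d + d * star d).
    by rewrite mulrDl !mulrDr addrACA [X in _ = _ + X]addrC addrACA [X in _ + X]addrC addrACA.
  have -> : (d - star d) * (d - star d) = (d * d + star d * star d) - (star d * d + d * star d).
    by rewrite mulrBl !mulrBr opprB opprD addrACA [X in _ = _ + X]addrC.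
  set S := star d * d + d * star d; set U := d * d + _.
  have -> : U + S - (U - S) = S + S by rewrite opprB addrC addrA subrK.
  by rewrite scale_half.
rewrite h; apply: mposZ; first by rewrite invr_ge0.
apply: mposD; apply: mpos_sqr; first by rewrite starD starK addrC.
by rewrite starZ conjCi starB starK scaleNr -scalerN opprB.
Qed.

(** If [m = - d* d] were positive and nonzero, then with [k] a square root of
   [m] the element [e = k d*] would have both [e* e = - (d d* )^2] and
   [e e* = - m^2] negative, while their sum is positive. *)
Lemma mpos_negM d : mpos (- (star d * d)) -> d = 0.
Proof.
move=> pm; have [k [[sk _] kk kc]] := mpos_sqrt pm.
pose e := k * star d.
have e1 : star e * e = - ((d * star d) * (d * star d)).
  by rewrite /e star_mul starK sk !mulrA -(mulrA d k k) kk mulrN mulNr !mulrA.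
have e2 : e * star e = - ((star d * d) * (star d * d)).
  rewrite /e star_mul starK sk -mulrA (mulrA (star d)) -[star d * d]opprK -kk.
  by rewrite mulNr mulrN !mulrA mulrN mulNr opprK !mulrA.
have pe := mpos_starM_swap e.
have p1 : mpos ((d * star d) * (d * star d)) by apply: mpos_sqr; rewrite star_mul starK.
have p2 : mpos ((star d * d) * (star d * d)) by apply: mpos_sqr; rewrite star_mul starK.
have z : (d * star d) * (d * star d) + (star d * d) * (star d * d) = 0.
  by apply: mpos_anti; [exact: mposD | rewrite opprD -e1 -e2].
have z2 : (star d * d) * (star d * d) = 0.
  apply: mpos_anti => //.
  suff -> : - (star d * d * (star d * d)) = d * star d * (d * star d) by [].
  by apply/eqP; rewrite eq_sym -addr_eq0 z.
have : rn (star d * d) ^+ 2 = 0 by rewrite -rn_starM star_mul starK z2 rn0.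
move=> /eqP; rewrite sqrf_eq0 rn_starM sqrf_eq0 => /eqP; exact: rn_eq0.
Qed.

(** Kelley and Vaught: with [p] the absolute value of [c = b* b] and [n] twice
   the negative part, [(b n)* (b n) = - p n^2] is negative, so [n = 0]. *)
Lemma mpos_starM b : mpos (star b * b).
Proof.
set c := star b * b; have sc : star c = c by rewrite star_mul starK.
have [p [pp pc2 pcomm]] := mpos_sqrt (mpos_sqr sc).
have pc : c * p = p * c by rewrite pcomm // mulrA.
pose n := p - c.
have sn : star n = n by rewrite starB sc (mpos_sa pp).
have pn : p * n = n * p by rewrite mulrBl mulrBr pc.
have nc : n * c = - (p * n) by rewrite mulrBl mulrBr pc2 opprB.
have d0 : b * n = 0.
  apply: mpos_negM; rewrite star_mul sn mulrA -(mulrA n) -/c nc mulNr opprK -mulrA.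
  by apply: mpos_mul => //; [exact: mpos_sqr | rewrite mulrA pn -!mulrA pn].
have pnn : p * n * n = 0.
  by apply/eqP; rewrite -oppr_eq0 -mulNr -nc /c -!mulrA d0 !mulr0.
have nn : n * n = p * n + p * n.
  by rewrite -[X in _ + X]opprK -nc {1}/n mulrBl pn; congr (_ - _); rewrite /n mulrBl mulrBr pc.
have n3 : n * n * n = 0 by rewrite nn mulrDl pnn addr0.
have n2 : n * n = 0.
  apply/rn_eq0/eqP; rewrite -sqrf_eq0 -rn_starM star_mul sn mulrA n3 mul0r.
  by rewrite rn0.
have n1 : n = 0.
  by apply/rn_eq0/eqP; rewrite -sqrf_eq0 -rn_starM sn n2 rn0.
by move/eqP: n1; rewrite subr_eq0 => /eqP <-.
Qed.

Lemma mpos_conj a s : mpos a -> mpos (star s * a * s).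
Proof.
move=> /mpos_sqrt[y [[sy _] <- _]].
have -> : star s * (y * y) * s = star (y * s) * (y * s) by rewrite star_mul sy !mulrA.
exact: mpos_starM.
Qed.

Lemma mpos_cstar a : mpos a <-> cstar_positive a.
Proof.
split=> [/mpos_sqrt[y [[sy _] yy _]]|[b ->]]; last exact: mpos_starM.
by exists y; rewrite sy.
Qed.

(** The Cauchy-Schwarz inequality: [a], [b] and [c] are the inner products of
   [x] with [x], of [x] with [y] and of [y] with [y], and the hypothesis is the
   positivity of the square of [x s - y], used at [s = b / N]. *)
Lemma cauchy_schwarz a b c : mpos a ->
  (forall s, mpos (star s * a * s - star s * b - star b * s + c)) ->
  rn b ^+ 2 <= rn a * rn c.
Proof.
move=> pa h; have pc : mpos c.
  by have := h 0; rewrite star0 !mul0r mulr0 !subr0 add0r.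
apply: le_addeps => e e0; pose N := rn a + e / (rn c + 1).
have c1 : 0 < rn c + 1 by rewrite ltr_wpDl ?rn_ge0.
have ec : 0 < e / (rn c + 1) by rewrite divr_gt0.
have N0 : 0 < N by rewrite ltr_wpDl ?rn_ge0.
have aN : mpos (N%:C%:A - a).
  by apply: mpos_subA; [exact: mpos_sa|rewrite lerDl ltW].
pose s := N^-1%:C *: b.
have key : rn (N^-1%:C *: (star b * b)) <= rn c.
  apply: mpos_le_norm.
    by apply: mposZ; [rewrite invr_ge0 ltW | exact: mpos_starM].
  have e1 : star s * b = N^-1%:C *: (star b * b) by rewrite starZr -realscaleAl.
  have e2 : star b * s = N^-1%:C *: (star b * b) by rewrite -realscaleAr.
  have e3 : star s * (N%:C%:A) * s = N^-1%:C *: (star b * b).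
    rewrite -(scalerAr _ (star s)) mulr1 -scalerAl -e1 /s -realscaleAr.
    by rewrite scalerA -rmorphM divff ?gt_eqF // scale1r.
  have := mposD (h s) (mpos_conj s aN).
  rewrite mulrBr mulrBl e1 e2 e3; congr mpos.
  set X := _ *: _; set Y := star s * a * s.
  by rewrite [_ + (X - Y)]addrC -!addrA addKr addNKr addrC.
move: key; rewrite rnZ_ge0 ?invr_ge0 ?(ltW N0) // rn_starM ler_pdivrMl // => key.
rewrite (le_trans key) // /N mulrDl lerD2l mulrAC ler_pdivrMr // ler_wpM2l //; first exact: ltW.
by rewrite lerDl.
Qed.

End CStar.

(** * Invariant means on compact groups *)

Section Hall.
Variables (I J : finType) (j0 : J).

Definition neighbors (r : I -> pred J) (S : {set I}) : {set J} :=
  [set j | [exists i in S, r i j]].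

Lemma neighborsP (r : I -> pred J) (S : {set I}) j :
  reflect (exists2 i, i \in S & r i j) (j \in neighbors r S).
Proof. by rewrite inE; exact: exists_inP. Qed.

(** Hall's marriage theorem, by induction on [D]: either every proper subset has
   a neighbour to spare, and any first choice leaves the condition true, or some
   proper subset [S] is tight, and [S] and its complement can be matched
   separately. *)
Lemma hall_in (r : I -> pred J) (D : {set I}) :
  (forall S : {set I}, S \subset D -> (#|S| <= #|neighbors r S|)%N) ->
  exists p : I -> J, {in D &, injective p} /\ {in D, forall i, r i (p i)}.
Proof.
have [n] := ubnP #|D|; elim: n r D => // n IH r D Dn hall.
have [->|[i0 i0D]] := set_0Vmem D.
  by exists (fun=> j0); split => [i i'|i]; rewrite inE.
have [[S SD /andP[S0 tight]]|spare] := pselect (exists2 S : {set I},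
    S \proper D & (S != finset.set0) && (#|neighbors r S| <= #|S|)%N).
  have SD' := proper_sub SD.
  have [||p [pinj pr]] := IH r S.
  - by rewrite (leq_trans (proper_card SD)) // -ltnS.
  - by move=> S' S'S; apply: hall; exact: fintype.subset_trans S'S SD'.
  pose r' i : pred J := fun j => r i j && (j \notin neighbors r S).
  have [||q [qinj qr]] := IH r' (D :\: S).
  - rewrite -ltnS (leq_trans _ Dn) // ltnS -(cardsID S D) (finset.setIidPr SD').
    by rewrite -[X in (X < _)%N]add0n ltn_add2r card_gt0.
  - move=> S' S'D; have dis : S' :&: S = finset.set0.
      apply/setP => i; rewrite !inE; apply/negP => /andP[/(fintype.subsetP S'D)].
      by rewrite !inE => /andP[/negP].
    have h := hall (S' :|: S); rewrite finset.subUset SD' (fintype.subset_trans S'D (finset.subsetDl _ _)) in h.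
    have {h} := h isT; rewrite cardsU dis cards0 subn0 => h.
    rewrite -(leq_add2r #|S|) (leq_trans h) // (leq_trans _ (leq_add (leqnn _) tight)) //.
    have -> : neighbors r (S' :|: S) = neighbors r' S' :|: neighbors r S.
      apply/setP => j; rewrite finset.in_setU; apply/neighborsP/orP.
        move=> [ i ]; rewrite inE => iS rij.
        have [jS|jS] := boolP (j \in neighbors r S); [by right|left].
        case/orP: iS => iS; first by apply/neighborsP; exists i => //; rewrite /r' rij.
        by case/negP: jS; apply/neighborsP; exists i.
      case=> /neighborsP[i iS]; first by move=> /andP[rij _]; exists i => //; rewrite inE iS.
      by move=> rij; exists i => //; rewrite inE iS orbT.
    by rewrite cardsU leq_subr.
  exists (fun i => if i \in S then p i else q i); split.
  - have nq i : i \in D -> i \notin S -> q i \notin neighbors r S.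
      by move=> iD iS; have /andP[] : r' i (q i) by apply: qr; rewrite inE iS.
    have np i : i \in S -> p i \in neighbors r S.
      by move=> iS; apply/neighborsP; exists i => //; exact: pr.
    move=> i i' iD i'D; case: ifPn => iS; case: ifPn => i'S.
    + exact: pinj.
    + by move=> e; have := nq _ i'D i'S; rewrite -e np.
    + by move=> e; have := nq _ iD iS; rewrite e np.
    + by apply: qinj; rewrite inE ?iS ?i'S.
  - move=> i iD; case: ifPn => iS; first exact: pr.
    by have /andP[] : r' i (q i) by apply: qr; rewrite inE iS.
have [j1 rj1] : exists j1, r i0 j1.
  have := hall (finset.set1 i0); rewrite finset.sub1set i0D cards1 => /(_ isT).
  by rewrite card_gt0 => /finset.set0Pn[j /neighborsP[ i ]]; rewrite inE => /eqP -> rj; exists j.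
pose r' i : pred J := fun j => r i j && (j != j1).
have [||p [pinj pr]] := IH r' (D :\ i0).
- by rewrite -ltnS (leq_trans _ Dn) // ltnS [X in (_ < X)%N](cardsD1 i0) i0D.
- move=> S SD; have [->|S0] := eqVneq S finset.set0; first by rewrite cards0.
  have SpD : S \proper D.
    rewrite properE (fintype.subset_trans SD (finset.subsetDl _ _)) /=; apply/negP => /fintype.subsetP/(_ _ i0D).
    by move=> /(fintype.subsetP SD); rewrite !inE eqxx.
  have lt : (#|S| < #|neighbors r S|)%N.
    by rewrite ltnNge; apply/negP => h; apply: spare; exists S => //; rewrite S0 h.
  rewrite -ltnS (leq_trans lt) // (cardsD1 j1 (neighbors r S)) -add1n leq_add ?leq_b1 //.
  apply/subset_leq_card/fintype.subsetP => j; rewrite !inE => /andP[jj1 /exists_inP[ i iS rij]].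
  by apply/exists_inP; exists i => //; rewrite /r' rij.
exists (fun i => if i == i0 then j1 else p i); split.
- have np i : i \in D -> i != i0 -> p i != j1.
    by move=> iD ii0; have /andP[] : r' i (p i) by apply: pr; rewrite !inE ii0.
  move=> i i' iD i'D; case: eqVneq => [->|ii0]; case: eqVneq => [->|ii0'] // e.
  + by have := np _ i'D ii0'; rewrite -e eqxx.
  + by have := np _ iD ii0; rewrite e eqxx.
  + by apply: pinj; rewrite // !inE ?ii0 ?ii0'.
- move=> i iD; case: eqVneq => [->|ii0] //.
  by have /andP[] : r' i (p i) by apply: pr; rewrite !inE ii0.
Qed.

End Hall.

Lemma continuous_after (T X Y : topologicalType) (u : X -> Y) (f : T -> X) :
  continuous u -> continuous f -> continuous (fun t => u (f t)).
Proof. by move=> cu cf t; apply: (@continuous_comp _ _ _ f u); [exact: cf | exact: cu]. Qed.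

Lemma fst_continuous (X Y : topologicalType) : continuous (@fst X Y).
Proof. by move=> p; exact: cvg_fst. Qed.

Lemma snd_continuous (X Y : topologicalType) : continuous (@snd X Y).
Proof. by move=> p; exact: cvg_snd. Qed.

Section GroupContinuity.
Variables (G : topologicalGroupType) (T : topologicalType).
Implicit Types (f h : T -> G).

Lemma continuous_invg f : continuous f -> continuous (fun t => (f t)^-1%g).
Proof. exact/continuous_after/invg_continuous. Qed.

Lemma continuous_mulg f h : continuous f -> continuous h -> continuous (fun t => (f t * h t)%g).
Proof.
move=> cf ch; apply: (@continuous_after _ _ _ (fun p : G * G => (p.1 * p.2)%g) (fun t => (f t, h t))).
  exact: mulg_continuous.
by move=> t; apply: cvg_pair; [exact: cf | exact: ch].
Qed.

End GroupContinuity.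

Lemma mulgl_continuous (G : topologicalGroupType) (h : G) : continuous (fun g => (h * g)%g).
Proof. by apply: continuous_mulg => g; [exact: cvg_cst | exact: cvg_id]. Qed.

Lemma mulgr_continuous (G : topologicalGroupType) (h : G) : continuous (fun g => (g * h)%g).
Proof. by apply: continuous_mulg => g; [exact: cvg_id | exact: cvg_cst]. Qed.

Section Nets.
Variables (R : realType) (G : topologicalGroupType).
Hypothesis compG : compact [set: G].

(** This does the work of uniform continuity on a compact group: the functions
   of two variables to which it is applied come from the multiplication. *)
Lemma compact_uniform (T : topologicalType) (X : normedModType R[i])
    (f : T * G -> X) (t0 : T) (e : R) : continuous f -> 0 < e ->
  \forall t \near t0, forall g, rn (f (t, g) - f (t0, g)) <= e.
Proof.
move=> cf e0; have e2 : 0 < (e / 2)%:C by rewrite ltcR divr_gt0.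
have := (compact_near_coveringP [set: G]).1 compG T (nbhs t0)
  (fun t g => rn (f (t, g) - f (t0, g)) <= e) _.
move=> /(_ _) h; have {}h := h _; apply: filterS (h _).
  by move=> t ht g; exact: ht.
move=> g _.
have /cvgrPdist_le/(_ _ e2) := cf (t0, g).
move=> [[B C] /= [nB nC] BC].
exists (C, B) => //= [[g' t]] /= [Cg Bt].
have h1 := BC (t, g') (conj Bt Cg).
have h2 := BC (t0, g') (conj (nbhs_singleton nB) Cg).
rewrite /= in h1 h2; rewrite (le_trans (rn_tri (f (t0, g)) _ _)) // (splitr e).
by rewrite lerD // -rn_le // rnE rnB -rnE.
Qed.

Definition covers (U : set G) (s : seq G) := forall g, exists2 x, x \in s & U (x^-1 * g)%g.

Lemma covers_exists U : open U -> U 1%g -> exists s, covers U s.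
Proof.
move=> oU U1.
(* Compactness is applied to the filter of large enough finite families. *)
pose F : set_system (seq G) := [set Q : set (seq G) |
  exists s0 : seq G, forall s : seq G, {subset s0 <= s} -> Q s].
have FF : Filter F.
  split; first by exists [::].
    move=> P Q [s hs] [t ht]; exists (s ++ t) => u hu.
    by split; [apply: hs|apply: ht] => x xs; apply: hu; rewrite mem_cat xs ?orbT.
  by move=> P Q PQ [s hs]; exists s => u /hs; exact: PQ.
have [|s0 hs0] := (compact_near_coveringP [set: G]).1 compG _ F
  (fun s g => exists2 x, x \in s & U (x^-1 * g)%g) FF.
  move=> g _; exists ([set g' | U (g^-1 * g')%g], [set s : seq G | g \in s]) => /=.
    split; last by exists [:: g] => s; apply; rewrite mem_head.
    have oV : open [set g' | U (g^-1 * g')%g].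
      apply: (@open_comp _ _ (fun g' => (g^-1 * g')%g)) oU => g' _.
      exact: mulgl_continuous.
    by apply: open_nbhs_nbhs; split => //=; rewrite mulVg.
  by move=> [g' s] /= [Ug gs]; exists g.
by exists s0 => g; exact: (hs0 s0 _ g I).
Qed.

Definition avg (X : lmodType R[i]) (s : seq G) (f : G -> X) : X :=
  ((size s)%:R^-1)%:C *: \sum_(x <- s) f x.

Section Minimal.
Variable U : set G.

Definition min_cover s := covers U s /\ forall t, covers U t -> (size s <= size t)%N.

Lemma min_cover_exists : (exists s, covers U s) -> exists s, min_cover s.
Proof.
move=> [s cs].
have [|n /asboolP[t [ct tn]] nmin] := @ex_minnP (fun n => `[< exists s, covers U s /\ size s = n >]).
  by exists (size s); apply/asboolP; exists s.
exists t; split => // t' ct'; rewrite tn; apply: nmin; apply/asboolP.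
by exists t'.
Qed.

Lemma covers_size s : covers U s -> (0 < size s)%N.
Proof. by move=> /(_ 1%g)[x]; case: s. Qed.

Definition close x y := exists2 g, U (x^-1 * g)%g & U (y^-1 * g)%g.

(** Replacing some points of a minimal cover by the points of another cover
   that are close to them gives a cover, which cannot be smaller: this is
   Hall's condition. *)
Lemma min_cover_matching s t : min_cover s -> min_cover t ->
  exists p : 'I_(size s) -> 'I_(size t), injective p /\
    forall i : 'I_(size s), close (nth 1%g s i) (nth 1%g t (p i)).
Proof.
move=> [cs ms] [ct mt].
have t0 := covers_size ct.
pose r (i : 'I_(size s)) : pred 'I_(size t) := fun j => `[< close (nth 1%g s i) (nth 1%g t j) >].
have [S _|p [pinj pr]] := @hall_in _ _ (Ordinal t0) r finset.setT.
  pose t' := [seq nth 1%g s (i : 'I_(size s)) | i <- enum (~: S)] ++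
    [seq nth 1%g t (j : 'I_(size t)) | j <- enum (neighbors r S)].
  have ct' : covers U t'.
    move=> g; have [x xs Ug] := cs g.
    have ix : (index x s < size s)%N by rewrite index_mem.
    have [iS|iS] := boolP (Ordinal ix \in S).
      have [y yt Uy] := ct g; have jy : (index y t < size t)%N by rewrite index_mem.
      exists y => //; rewrite mem_cat; apply/orP; right; apply/mapP.
      exists (Ordinal jy); last by rewrite /= nth_index.
      rewrite mem_enum; apply/neighborsP; exists (Ordinal ix) => //.
      by apply/asboolP; exists g; rewrite /= nth_index.
    exists x => //; rewrite mem_cat; apply/orP; left; apply/mapP.
    by exists (Ordinal ix); rewrite ?mem_enum ?inE //= nth_index.
  have := ms _ ct'; rewrite size_cat !size_map -!cardE.
  by rewrite -[X in (X <= _)%N]card_ord -(cardsC S) addnC leq_add2l.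
exists p; split; first by move=> i j; apply: pinj; rewrite inE.
by move=> i; apply/asboolP/pr; rewrite inE.
Qed.

(** Minimal covers match bijectively, so that their averages differ by no more
   than the oscillation of [f] between matched points; this is how a Haar mean
   arises without any measure theory. *)
Lemma min_cover_avg (X : normedModType R[i]) s t (f : G -> X) (e : R) :
  min_cover s -> min_cover t -> (forall x y, close x y -> rn (f x - f y) <= e) ->
  rn (avg s f - avg t f) <= e.
Proof.
move=> ms mt hf; have st : size s = size t.
  by apply/eqP; rewrite eqn_leq (ms.2 _ mt.1) (mt.2 _ ms.1).
have s0 : 0 < (size s)%:R :> R by rewrite ltr0n (covers_size ms.1).
have [p [pinj pr]] := min_cover_matching ms mt.
have -> : avg t f = ((size s)%:R^-1)%:C *: \sum_(i < size s) f (nth 1%g t (p i)).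
  rewrite /avg (big_nth 1%g) big_mkord; have -> : (size t)%:R^-1 = (size s)%:R^-1 :> R by rewrite st.
  congr (_ *: _).
  have pbij : bijective p by apply: inj_card_bij; rewrite // !card_ord st.
  by rewrite (reindex p) //; exact: onW_bij.
rewrite /avg (big_nth 1%g) big_mkord -scalerBr -sumrB rnZ_ge0 ?invr_ge0 ?(ltW s0) //.
rewrite ler_pdivrMl // (le_trans (rn_sum _ _)) //.
rewrite (le_trans (ler_sum _ (fun i _ => hf _ _ (pr i)))) //.
by rewrite sumr_const card_ord mulr_natl.
Qed.

Lemma min_cover_translate s h : min_cover s -> min_cover [seq (h * x)%g | x <- s].
Proof.
move=> [cs ms]; split => [g|t /ms]; last by rewrite size_map.
have [x xs Ux] := cs (h^-1 * g)%g; exists (h * x)%g; first exact: map_f.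
by rewrite invgM -mulgA.
Qed.

End Minimal.
End Nets.

Section Average.
Variables (R : realType) (G : topologicalGroupType).

Lemma avgD (X : lmodType R[i]) s (f f' : G -> X) :
  avg s (fun g => f g + f' g) = avg s f + avg s f'.
Proof. by rewrite /avg big_split scalerDr. Qed.

Lemma avgB (X : lmodType R[i]) s (f f' : G -> X) :
  avg s (fun g => f g - f' g) = avg s f - avg s f'.
Proof. by rewrite /avg sumrB scalerBr. Qed.

Lemma avg_cst (X : lmodType R[i]) (s : seq G) (c : X) : (0 < size s)%N -> avg s (fun=> c) = c.
Proof.
move=> s0; rewrite /avg big_const_seq count_predT iter_addr_0 -(scaler_nat _ c) scalerA.
by rewrite -(rmorph_nat (@real_complex R)) -rmorphM mulVf ?scale1r // pnatr_eq0 -lt0n.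
Qed.

Lemma avg_morph (X Y : lmodType R[i]) s (f : G -> X) (L : X -> Y) :
  {morph L : x y / x + y} -> (forall (c : R) x, L (c%:C *: x) = c%:C *: L x) ->
  L (avg s f) = avg s (fun g => L (f g)).
Proof.
move=> LD LZ; rewrite /avg LZ; congr (_ *: _); apply: (big_morph L LD).
by rewrite -(scale0r (0 : X)) -[0]/(0%:C) LZ scale0r.
Qed.

Lemma avg_exchange (X : lmodType R[i]) s t (F : G -> G -> X) :
  avg s (fun x => avg t (F x)) = avg t (fun y => avg s (F^~ y)).
Proof.
rewrite /avg -!scaler_sumr !scalerA mulrC; congr (_ *: _).
by rewrite exchange_big.
Qed.

Lemma avg_le (X : normedModType R[i]) s (f : G -> X) (F : G -> R) :
  (forall g, rn (f g) <= F g) -> rn (avg s f) <= (size s)%:R^-1 * \sum_(g <- s) F g.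
Proof.
move=> h; rewrite rnZ_ge0 ?invr_ge0 ?ler0n // ler_wpM2l ?invr_ge0 ?ler0n //.
by rewrite (le_trans (rn_sum _ _)) // ler_sum.
Qed.

Lemma avg_bound (X : normedModType R[i]) s (f : G -> X) (C : R) : (0 < size s)%N ->
  (forall g, rn (f g) <= C) -> rn (avg s f) <= C.
Proof.
move=> s0 /(@avg_le _ s f (fun=> C))/le_trans; apply.
rewrite big_const_seq count_predT iter_addr_0 -[C *+ _]mulr_natl mulrA mulVf ?mul1r //.
by rewrite pnatr_eq0 -lt0n.
Qed.

Lemma avg_near (X : normedModType R[i]) s (f : G -> X) c (e : R) : (0 < size s)%N ->
  (forall g, rn (f g - c) <= e) -> rn (avg s f - c) <= e.
Proof. by move=> s0 h; rewrite -{1}(avg_cst c s0) -avgB avg_bound. Qed.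

End Average.

Section HaarNet.
Variables (R : realType) (G : topologicalGroupType).

(** The finite families stand in for the Haar measure: these limits are all the
   integrals that the proof needs, and they exist directly in Banach spaces. *)
Definition haar_net (hs : nat -> seq G) : Prop :=
  (forall n, (0 < size (hs n))%N) /\
  forall (X : completeNormedModType R[i]) (f : G -> X), continuous f -> exists c : X,
    forall h, [/\ tends (fun n => avg (hs n) f) c,
      tends (fun n => avg (hs n) (fun g => f (h * g)%g)) c &
      tends (fun n => avg (hs n) (fun g => f (g * h)%g)) c].

Hypothesis compG : compact [set: G].
Variable U : nat -> set G.
Hypothesis oU : forall n, open (U n).
Hypothesis U1 : forall n, U n 1%g.
Hypothesis Ubase : forall V, nbhs 1%g V -> exists N, forall n, (N <= n)%N -> U n `<=` V.

Lemma close_uniform (X : normedModType R[i]) (f : G -> X) (e : R) : continuous f -> 0 < e ->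
  exists N, forall n, (N <= n)%N -> forall x y, close (U n) x y -> rn (f x - f y) <= e.
Proof.
move=> cf e0; have e2 : 0 < e / 2 by rewrite divr_gt0.
have cF : continuous (fun p : G * G => f (p.2 * p.1^-1)%g).
  apply: continuous_after cf _; apply: continuous_mulg; first exact: snd_continuous.
  exact/continuous_invg/fst_continuous.
have [N hN] := Ubase (compact_uniform compG 1%g cF e2).
exists N => n /hN Un x y [g /Un hx /Un hy]; move: (hx g) (hy g) => /=.
rewrite !invgM !invgK !invg1 !mulg1 !mulVKg => h1 h2.
by rewrite (le_trans (rn_tri (f g) _ _)) // (splitr e) lerD // rnB.
Qed.

Let hs_ex n : exists s, min_cover (U n) s.
Proof. exact: min_cover_exists (covers_exists compG (oU n) (U1 n)). Qed.

Let hs n := sval (cid (hs_ex n)).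

Let hsP n : min_cover (U n) (hs n).
Proof. exact: (svalP (cid (hs_ex n))). Qed.

Let hs0 n : (0 < size (hs n))%N.
Proof. exact: covers_size (hsP n).1. Qed.

Let left_uniform (X : normedModType R[i]) (f : G -> X) (e : R) : continuous f -> 0 < e ->
  exists N, forall n, (N <= n)%N -> forall h,
    rn (avg (hs n) (fun g => f (h * g)%g) - avg (hs n) f) <= e.
Proof.
move=> cf e0; have [N hN] := close_uniform cf e0; exists N => n /hN hn h.
have -> : avg (hs n) (fun g => f (h * g)%g) = avg [seq (h * x)%g | x <- hs n] f.
  by rewrite /avg size_map big_map.
by apply: (min_cover_avg (min_cover_translate h (hsP n)) (hsP n)).
Qed.

Let inv_uniform (X : normedModType R[i]) (f : G -> X) (e : R) : continuous f -> 0 < e ->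
  exists N, forall n, (N <= n)%N -> forall h,
    rn (avg (hs n) (fun g => f (g^-1 * h)%g) - avg (hs n) (fun g => f g^-1%g)) <= e.
Proof.
move=> cf e0; have cfi : continuous (fun g : G => f g^-1%g).
  exact: continuous_after cf (@invg_continuous _).
have [N hN] := left_uniform cfi e0; exists N => n /hN hn h.
by have := hn h^-1%g; under eq_fun do rewrite invgM invgK.
Qed.

(** The double average of [f (y^-1 x)] compares the averages of [f] with those
   of its composite with the inverse, whatever the two indices. *)
Let avg_inv (X : normedModType R[i]) (f : G -> X) (e : R) : continuous f -> 0 < e ->
  exists N, forall m n, (N <= m)%N -> (N <= n)%N ->
    rn (avg (hs m) f - avg (hs n) (fun g => f g^-1%g)) <= e.
Proof.
move=> cf e0; have e2 : 0 < e / 2 by rewrite divr_gt0.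
have [N hN] := left_uniform cf e2; have [M hM] := inv_uniform cf e2.
exists (maxn N M) => m n; rewrite !geq_max => /andP[/hN hm _] /andP[_ /hM hn].
pose D := avg (hs n) (fun y => avg (hs m) (fun x => f (y^-1 * x)%g)).
have h1 : rn (D - avg (hs m) f) <= e / 2 by apply: avg_near => // y; exact: hm.
have h2 : rn (D - avg (hs n) (fun g => f g^-1%g)) <= e / 2.
  by rewrite /D avg_exchange; apply: avg_near => // x; exact: hn.
by rewrite (le_trans (rn_tri D _ _)) // (splitr e) lerD // rnB.
Qed.

Lemma haar_net_exists_base : exists hs, haar_net hs.
Proof.
exists hs; split => // X f cf.
have [|c fc] := @tends_complete R X (fun n => avg (hs n) f).
  move=> e e0; have e2 : 0 < e / 2 by rewrite divr_gt0.
  have [N hN] := avg_inv cf e2; exists N => m n Nm mn.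
  rewrite (le_trans (rn_tri (avg (hs N) (fun g => f g^-1%g)) _ _)) // (splitr e).
  by rewrite lerD ?hN // rnB hN // (leq_trans Nm).
exists c => h; split => //.
  move=> e e0; have e2 : 0 < e / 2 by rewrite divr_gt0.
  have [N hN] := left_uniform cf e2; have [M hM] := fc _ e2.
  exists (maxn N M) => n; rewrite geq_max => /andP[/hN hn /hM hn'].
  by rewrite (le_trans (rn_tri (avg (hs n) f) _ _)) // (splitr e) lerD.
move=> e e0; have e4 : 0 < e / 4 by rewrite divr_gt0.
have cfh : continuous (fun g => f (g * h)%g).
  exact: continuous_after cf (@mulgr_continuous _ _).
have [N1 h1] := avg_inv cfh e4; have [N2 h2] := avg_inv cf e4.
have [N3 h3] := inv_uniform cf e4; have [N4 h4] := fc _ e4.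
exists (maxn (maxn N1 N2) (maxn N3 N4)) => n; rewrite !geq_max => /andP[/andP[n1 n2] /andP[n3 n4]].
have := h1 n n n1 n1; have := h2 n n n2 n2; have := h3 n n3 h; have := h4 n n4.
set a := avg _ f; set b := avg _ _; set d := avg _ _; set a' := avg _ _.
move=> ac db ab a'd.
have := rn_tri b a' c; have := rn_tri d b c; have := rn_tri a d c.
by rewrite (rnB d a); lra.
Qed.

End HaarNet.

Lemma nbhs1_base (G : topologicalGroupType) : @second_countable G ->
  exists U : nat -> set G, [/\ forall n, open (U n), forall n, U n 1%g &
    forall V, nbhs 1%g V -> exists N, forall n, (N <= n)%N -> U n `<=` V].
Proof.
move=> [B /countable_injP[f finj] [Bo Bb]].
pose P n : set (set G) := [set b | B b /\ f b = n].
pose V n := xget setT (P n).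
pose W n := if `[< open (V n) /\ V n 1%g >] then V n else setT.
have oW n : open (W n) by rewrite /W; case: asboolP => [H|_]; [by case: H|exact: openT].
have W1 n : W n 1%g by rewrite /W; case: asboolP => [H|_]; [by case: H|].
pose U := fix U n := if n is k.+1 then U k `&` W k else setT.
exists U; split => [n|n|A].
- by elim: n => [|n IH]; [exact: openT|exact: openI].
- by elim: n.
move=> /(Bb 1%g)[b [Bb1 b1] bA]; exists (f b).+1 => n /subnK <-.
have Wb : W (f b) = b.
  have hx : P (f b) (V (f b)) by apply: xgetPex; exists b.
  have -> : W (f b) = V (f b).
    rewrite /W; case: asboolP => // -[]; case: hx => BV fV.
    by rewrite (finj _ _ _ _ fV) ?inE //; split => //; exact: Bo.
  by case: hx => BV fV; apply: finj; rewrite ?inE.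
elim: (n - _)%N => [|k IH]; last by rewrite addSn => g [/IH].
by rewrite add0n => g [_]; rewrite Wb; exact: bA.
Qed.

Lemma haar_net_exists (R : realType) (G : topologicalGroupType) :
  compact [set: G] -> @second_countable G -> exists hs : nat -> seq G, haar_net R hs.
Proof. by move=> compG /nbhs1_base[U [oU U1 Ub]]; exact: haar_net_exists_base oU U1 Ub. Qed.

(** * The complex numbers as a C*-algebra *)

Definition cplx (R : realType) : Type := R[i].

Section Cplx.
Variable R : realType.

HB.instance Definition _ := NormedModule.copy (cplx R) (R[i]^o).

Lemma cplx_complete (F : set_system (cplx R)) : ProperFilter F -> cauchy F -> cvg F.
Proof.
move=> FF /cauchy_ballP Fc.
have proj (p : cplx R -> R) : (forall x y, `|p x - p y|%:C <= `|x - y|) -> cvg (p @ F).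
  move=> hp; apply: R_complete; apply/cauchy_ballP => e e0.
  have e0' : 0 < e%:C by rewrite ltcR.
  have [[A B] /= [FA FB] AB] := Fc _ e0'.
  exists (p @` A, p @` B) => /=.
    by split; [apply: filterS FA|apply: filterS FB] => x Ax; exists x.
  move=> [a b] /= [[x Ax <-] [y By <-]].
  have := AB (x, y) (conj Ax By); rewrite -!ball_normE /= => h.
  by rewrite -ltcR (le_lt_trans (hp _ _)).
have re_le (x y : cplx R) : `|complex.Re x - complex.Re y|%:C <= `|x - y|.
  rewrite [`|x - y|]normc_def lecR.
  case: x y => [a b] [c d] /=; by rewrite -sqrtr_sqr ler_wsqrtr // lerDl sqr_ge0.
have im_le (x y : cplx R) : `|complex.Im x - complex.Im y|%:C <= `|x - y|.
  rewrite [`|x - y|]normc_def lecR.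
  case: x y => [a b] [c d] /=; by rewrite -sqrtr_sqr ler_wsqrtr // lerDr sqr_ge0.
have /cvg_ex[a Fa] := proj _ re_le; have /cvg_ex[b Fb] := proj _ im_le.
apply/cvg_ex; exists (a +i* b : R[i]).
apply/cvgrPdist_le => /= e; case: e => e e'; rewrite ltcE /= => /andP[/eqP -> e0].
have e2 : 0 < e / 2 by rewrite divr_gt0.
move/cvgrPdist_le: Fa => /(_ _ e2) Fa; move/cvgrPdist_le: Fb => /(_ _ e2) Fb.
apply: filterS2 Fa Fb => -[x y] /= hx hy.
rewrite [`|_|]normc_def lecR /=.
have : Num.sqrt ((a - x) ^+ 2 + (b - y) ^+ 2) <= `|a - x| + `|b - y|.
  rewrite -(ger0_norm (addr_ge0 (normr_ge0 (a - x)) (normr_ge0 (b - y)))) -sqrtr_sqr.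
  rewrite ler_wsqrtr // -(real_normK (num_real (a - x))) -(real_normK (num_real (b - y))).
  by rewrite sqrrD addrAC lerDl mulrn_wge0 // mulr_ge0.
by move=> /le_trans; apply; rewrite (splitr e) lerD.
Qed.

HB.instance Definition _ := Uniform_isComplete.Build (cplx R) cplx_complete.

Fact cplx_one_neq0 : (1 : R[i]) != 0. Proof. exact: oner_neq0. Qed.

Fact cplx_scaleAl (c : R[i]) (a b : R[i]) : c * (a * b) = (c * a) * b.
Proof. exact: mulrA. Qed.

Fact cplx_scaleAr (c : R[i]) (a b : R[i]) : c * (a * b) = a * (c * b).
Proof. exact: mulrCA. Qed.

Fact cplx_normM (a b : R[i]) : `|a * b| <= `|a| * `|b|.
Proof. by rewrite normrM. Qed.

Fact cplx_starM (a b : R[i]) : Num.conj (a * b) = Num.conj b * Num.conj a.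
Proof. by rewrite rmorphM mulrC. Qed.

Fact cplx_identity (a : R[i]) : `|Num.conj a * a| = `|a| ^+ 2.
Proof. by rewrite normrM norm_conjC expr2. Qed.

HB.instance Definition _ := @isCStarAlgebra.Build R (cplx R)
  (fun a b : R[i] => a * b) (1 : R[i]) (fun a : R[i] => Num.conj a)
  (@mulrA R[i]) (@mul1r R[i]) (@mulr1 R[i]) (@mulrDl R[i]) (@mulrDr R[i])
  cplx_one_neq0 cplx_scaleAl cplx_scaleAr cplx_normM (@conjCK R[i])
  (fun a b => rmorphD Num.conj a b) (fun a b => rmorphM Num.conj a b)
  cplx_starM cplx_identity.

Lemma cplxM (a b : cplx R) : a * b = (a : R[i]) * (b : R[i]) :> R[i].
Proof. by []. Qed.

Lemma cplxZ (c : R[i]) (a : cplx R) : c *: a = c * (a : R[i]) :> R[i].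
Proof. by []. Qed.

Lemma cplx_star (a : cplx R) : star a = Num.conj (a : R[i]) :> R[i].
Proof. by []. Qed.

Lemma rn_real (r : R) : rn (r%:C : cplx R) = `|r|.
Proof. by rewrite /rn normc_def /= expr0n addr0 sqrtr_sqr. Qed.

Lemma rn_realB (x y : R) : rn ((x%:C : cplx R) - y%:C) = `|x - y|.
Proof. by rewrite -[_ - _](rmorphB (@real_complex R)) rn_real. Qed.

Lemma mpos_cplx (z : cplx R) : mpos z <-> 0 <= (z : R[i]).
Proof.
split.
  by move=> /mpos_sqrt[y [[sy _] <- _]]; rewrite -{1}sy cplxM cplx_star mulrC mul_conjC_ge0.
move=> z0; have zE : z = (complex.Re z)%:C :> R[i].
  by move: z0; case: (z : R[i]) => a b; rewrite lecE /= => /andP[/eqP -> _].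
have r0 : 0 <= complex.Re z by move: z0; rewrite zE lecR.
rewrite zE -[X in mpos X]mulr1 -[X in mpos X]/((complex.Re z)%:C *: (1 : cplx R)).
exact: mpos_scalar.
Qed.

End Cplx.

(** * Hilbert modules *)

Section HilbertModuleTheory.
Variables (R : realType) (A : cstarAlgType R) (E : hilbertModType A).
Implicit Types (x y z : E) (a b : A).

Lemma innerDl x y z : inner (x + y) z = inner x z + inner y z.
Proof. by rewrite inner_star innerDr starD -!inner_star. Qed.

Lemma innerZl (c : R[i]) x y : inner (c *: x) y = Num.conj c *: inner x y.
Proof. by rewrite inner_star innerZr starZ -inner_star. Qed.

Lemma innerNr x y : inner x (- y) = - inner x y.
Proof. by rewrite -scaleN1r innerZr scaleN1r. Qed.

Lemma innerBr x y z : inner x (y - z) = inner x y - inner x z.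
Proof. by rewrite innerDr innerNr. Qed.

Lemma innerNl x y : inner (- x) y = - inner x y.
Proof. by rewrite inner_star innerNr starN -inner_star. Qed.

Lemma innerBl x y z : inner (x - y) z = inner x z - inner y z.
Proof. by rewrite innerDl innerNl. Qed.

Lemma inner0r x : inner x 0 = 0.
Proof. by rewrite -(scale0r 0) innerZr scale0r. Qed.

Lemma inner0l x : inner 0 x = 0.
Proof. by rewrite inner_star inner0r star0. Qed.

Lemma inner_ractl x y a : inner (ract x a) y = star a * inner x y.
Proof. by rewrite inner_star inner_ract star_mul -inner_star. Qed.

Lemma inner_sumr I (s : seq I) (F : I -> E) x :
  inner x (\sum_(i <- s) F i) = \sum_(i <- s) inner x (F i).
Proof. exact: (big_morph _ (innerDr x) (inner0r x)). Qed.

Lemma inner_suml I (s : seq I) (F : I -> E) x :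
  inner (\sum_(i <- s) F i) x = \sum_(i <- s) inner (F i) x.
Proof. exact: (big_morph (fun z => inner z x) (fun y z => innerDl y z x) (inner0l x)). Qed.

Lemma mpos_inner x : mpos (inner x x).
Proof. by apply/mpos_cstar; exact: inner_positive. Qed.

Lemma rn_inner x : rn (inner x x) = rn x ^+ 2.
Proof. by have := inner_norm x; rewrite !rnE -rmorphXn => -[]. Qed.

Lemma inner_le x y : rn (inner x y) <= rn x * rn y.
Proof.
rewrite -ler_sqr ?nnegrE ?rn_ge0 ?mulr_ge0 ?rn_ge0 // exprMn -!rn_inner.
apply: cauchy_schwarz; first exact: mpos_inner.
move=> s; have := mpos_inner (ract x s - y); congr mpos.
rewrite innerBl !innerBr !inner_ract !inner_ractl (inner_star x y) opprB addrA.
by rewrite addrAC.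
Qed.

Lemma inner_eq0 x : (forall y, inner x y = 0) -> x = 0.
Proof.
by move=> h; apply/rn_eq0/eqP; rewrite -sqrf_eq0 -rn_inner h rn0.
Qed.

Lemma inner_inj x y : (forall z, inner x z = inner y z) -> x = y.
Proof.
by move=> h; apply/eqP; rewrite -subr_eq0; apply/eqP/inner_eq0 => z; rewrite innerBl h subrr.
Qed.

Lemma rn_ract x a : rn (ract x a) <= rn x * rn a.
Proof.
rewrite -ler_sqr ?nnegrE ?rn_ge0 ?mulr_ge0 ?rn_ge0 // -rn_inner inner_ract inner_ractl.
rewrite (le_trans (rnM _ _)) // exprMn -rn_inner.
rewrite (le_trans (ler_wpM2r (rn_ge0 _) (rnM _ _))) // rn_star.
by rewrite [rn a * _]mulrC -mulrA -expr2.
Qed.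

Lemma ractBl x y a : ract (x - y) a = ract x a - ract y a.
Proof. by rewrite ractDl -scaleN1r ractZl scaleN1r. Qed.

Lemma rn_sup x (C : R) : 0 <= C -> (forall y, rn (inner x y) <= C * rn y) -> rn x <= C.
Proof.
move=> C0 /(_ x); rewrite rn_inner expr2; have [x0|x0 h] := eqVneq (rn x) 0.
  by rewrite x0.
by rewrite -(@ler_pM2r _ (rn x)) // lt_neqAle eq_sym x0 rn_ge0.
Qed.

Lemma tends_innerr (u : nat -> E) x y : tends u y -> tends (fun n => inner x (u n)) (inner x y).
Proof.
apply: tends_lip (rn_ge0 x) _ => z z'; rewrite -innerBr; exact: inner_le.
Qed.

Lemma tends_innerl (u : nat -> E) x y : tends u x -> tends (fun n => inner (u n) y) (inner x y).
Proof.
apply: (@tends_lip R E A (fun z => inner z y) (rn y)) => [|z z']; first exact: rn_ge0.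
rewrite -innerBl mulrC; exact: inner_le.
Qed.

End HilbertModuleTheory.

(** * Continuity *)

Section Continuity.
Variables (R : realType) (T : topologicalType).

Lemma continuous_rnP (X : normedModType R[i]) (f : T -> X) :
  continuous f <-> forall t (e : R), 0 < e -> \forall t' \near t, rn (f t' - f t) <= e.
Proof.
split=> [cf t e e0|h t].
  have e0' : 0 < e%:C by rewrite ltcR.
  have /cvgrPdist_le/(_ _ e0') := cf t; apply: filterS => t'.
  by rewrite rnB -rn_le.
apply/cvgrPdist_le => /= e; case: e => e e'; rewrite ltcE /= => /andP[/eqP -> e0].
by apply: filterS (h t e e0) => t'; rewrite rnB -rn_le.
Qed.

Lemma continuous_lip (X Y : normedModType R[i]) (L : X -> Y) (C : R) (f : T -> X) :
  0 <= C -> (forall x y, rn (L x - L y) <= C * rn (x - y)) ->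
  continuous f -> continuous (fun t => L (f t)).
Proof.
move=> C0 hL /continuous_rnP cf; apply/continuous_rnP => t e e0.
have C1 : 0 < C + 1 by rewrite ltr_wpDl.
apply: filterS (cf t _ (divr_gt0 e0 C1)) => t' h.
rewrite (le_trans (hL _ _)) // (@le_trans _ _ ((C + 1) * (e / (C + 1)))) //.
  by rewrite ler_pM ?rn_ge0 // lerDl.
by rewrite mulrC divfK // gt_eqF.
Qed.

Lemma continuous_bil (X Y Z : normedModType R[i]) (B : X -> Y -> Z) (C : R) f f' :
  0 <= C -> (forall x x' y, B (x - x') y = B x y - B x' y) ->
  (forall x y y', B x (y - y') = B x y - B x y') ->
  (forall x y, rn (B x y) <= C * rn x * rn y) ->
  continuous f -> continuous f' -> continuous (fun t : T => B (f t) (f' t)).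
Proof.
move=> C0 Bl Br BC /continuous_rnP cf /continuous_rnP cf'; apply/continuous_rnP => t e e0.
set x := f t; set y := f' t; pose K := C * (rn x + rn y + 1) + 1.
have K0 : 0 < K by rewrite ltr_wpDl // mulr_ge0 // !addr_ge0 ?rn_ge0.
pose d := Num.min 1 (e / K); have d0 : 0 < d by rewrite lt_min ltr01 divr_gt0.
have dK : d * K <= e by rewrite -ler_pdivlMr // ge_min lexx orbT.
have d1 : d <= 1 by rewrite ge_min lexx.
apply: filterS2 (cf t d d0) (cf' t d d0) => t'; rewrite -/x -/y.
set x' := f t'; set y' := f' t' => hx hy.
have -> : B x' y' - B x y = B (x' - x) y' + B x (y' - y) by rewrite Bl Br addrA subrK.
rewrite (le_trans (rnD _ _)) // (le_trans (lerD (BC _ _) (BC _ _))) //.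
have y'1 : rn y' <= 1 + rn y by rewrite (le_trans (rn_sub _ y)) // lerD2r (le_trans hy).
rewrite (le_trans _ dK) // /K.
have h1 : rn (x' - x) * rn y' <= d * (1 + rn y) by rewrite ler_pM ?rn_ge0.
have h2 : rn x * rn (y' - y) <= rn x * d by rewrite ler_wpM2l ?rn_ge0.
have h1' := ler_wpM2l C0 h1; have h2' := ler_wpM2l C0 h2.
by rewrite -!mulrA; lra.
Qed.

Lemma continuous_real (f : T -> R) :
  continuous f <-> continuous (fun t => (f t)%:C : cplx R).
Proof.
split=> [cf|/continuous_rnP h t].
  apply/continuous_rnP => t e e0; have /cvgrPdist_le/(_ _ e0) := cf t.
  by apply: filterS => t'; rewrite rn_realB distrC.
by apply/cvgrPdist_le => e e0; apply: filterS (h t e e0) => t'; rewrite rn_realB distrC.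
Qed.

Lemma continuous_scale (X : normedModType R[i]) (f : T -> R) (u : T -> X) :
  continuous f -> continuous u -> continuous (fun t => (f t)%:C *: u t).
Proof.
move=> /continuous_real cf cu.
apply: (@continuous_bil (cplx R) X X (fun c x => (c : R[i]) *: x) 1) cf cu => //.
- by move=> c c' x; exact: scalerBl.
- by move=> c x y; exact: scalerBr.
by move=> c x; rewrite mul1r rn_complex.
Qed.

Lemma continuous_inner (A : cstarAlgType R) (E : hilbertModType A) (u v : T -> E) :
  continuous u -> continuous v -> continuous (fun t => inner (u t) (v t)).
Proof.
apply: (@continuous_bil E E A inner 1) => // *; rewrite ?innerBl ?innerBr //.
by rewrite mul1r inner_le.
Qed.

Lemma continuous_sum (X : normedModType R[i]) I (s : seq I) (F : I -> T -> X) :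
  (forall i, continuous (F i)) -> continuous (fun t => \sum_(i <- s) F i t).
Proof.
move=> cF; elim: s => [|i s IH] t.
  by under eq_fun do rewrite big_nil; exact: cvg_cst.
by under eq_fun do rewrite big_cons; apply: cvgD; [exact: cF|exact: IH].
Qed.

End Continuity.

(** * The invariant mean *)

Section Mean.
Variables (R : realType) (G : topologicalGroupType) (hs : nat -> seq G).
Hypothesis hsP : haar_net R hs.

(** The limit is taken along a fixed net of families, with [0] as a default value;
   it is used only on continuous functions. *)
Definition mean (X : completeNormedModType R[i]) (f : G -> X) : X :=
  xget 0 [set c | tends (fun n => avg (hs n) f) c].

Section OneSpace.
Variable X : completeNormedModType R[i].
Implicit Types (f u : G -> X).

Lemma mean_tends f : continuous f -> tends (fun n => avg (hs n) f) (mean f).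
Proof.
move=> cf; apply: (@xgetPex _ 0 [set c | tends (fun n => avg (hs n) f) c]).
by have [c /(_ 1%g)[h _ _]] := hsP.2 X f cf; exists c.
Qed.

Lemma mean_uniq f c : tends (fun n => avg (hs n) f) c -> mean f = c.
Proof.
move=> h; apply: (tends_uniq _ h).
by apply: (@xgetPex _ 0 [set c | tends (fun n => avg (hs n) f) c]); exists c.
Qed.

Lemma mean_left f h : continuous f -> mean (fun g => f (h * g)%g) = mean f.
Proof.
move=> cf; have [c /(_ h)[h1 h2 _]] := hsP.2 X f cf.
by rewrite (mean_uniq h1) (mean_uniq h2).
Qed.

Lemma mean_right f h : continuous f -> mean (fun g => f (g * h)%g) = mean f.
Proof.
move=> cf; have [c /(_ h)[h1 _ h2]] := hsP.2 X f cf.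
by rewrite (mean_uniq h1) (mean_uniq h2).
Qed.

Lemma meanD f u : continuous f -> continuous u ->
  mean (fun g => f g + u g) = mean f + mean u.
Proof.
move=> cf cu; apply: mean_uniq.
by apply: tends_ext (tendsD (mean_tends cf) (mean_tends cu)) => n; rewrite avgD.
Qed.

Lemma meanB f u : continuous f -> continuous u ->
  mean (fun g => f g - u g) = mean f - mean u.
Proof.
move=> cf cu; apply: mean_uniq.
by apply: tends_ext (tendsB (mean_tends cf) (mean_tends cu)) => n; rewrite avgB.
Qed.

Lemma mean_cst (c : X) : mean (fun=> c) = c.
Proof.
apply: mean_uniq; apply: tends_ext (tends_cst c) => n; rewrite avg_cst //.
exact: hsP.1.
Qed.

Lemma mean_le f (C : R) : continuous f -> (forall g, rn (f g) <= C) -> rn (mean f) <= C.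
Proof.
move=> cf h; apply: tends_rn_le (mean_tends cf) => n.
by apply: avg_bound => //; exact: hsP.1.
Qed.

End OneSpace.

Lemma mean_morph (X Y : completeNormedModType R[i]) (L : X -> Y) (C : R) (f : G -> X) :
  0 <= C -> {morph L : x y / x + y} -> (forall (c : R) x, L (c%:C *: x) = c%:C *: L x) ->
  (forall x, rn (L x) <= C * rn x) -> continuous f ->
  mean (fun g => L (f g)) = L (mean f).
Proof.
move=> C0 LD LZ LC cf; apply: mean_uniq.
have LB x y : rn (L x - L y) <= C * rn (x - y).
  suff -> : L x - L y = L (x - y) by [].
  rewrite LD; congr (_ + _).
  by rewrite -scaleN1r -[X in _ = L X]scaleN1r -[-1](rmorphN1 (@real_complex R)) LZ.
by apply: tends_ext (tends_lip C0 LB (mean_tends cf)) => n; rewrite (avg_morph _ _ LD LZ).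
Qed.

Lemma mean_mpos (A : cstarAlgType R) (f : G -> A) : continuous f ->
  (forall g, mpos (f g)) -> mpos (mean f).
Proof.
move=> cf h; apply: mpos_closed (mean_tends cf) => n.
by apply: mposZ; [rewrite invr_ge0 ler0n | exact: mpos_sum].
Qed.

Definition rmean (f : G -> R) : R := complex.Re (mean (fun g => (f g)%:C : cplx R)).

Lemma rmeanE (f : G -> R) : continuous f -> mean (fun g => (f g)%:C : cplx R) = (rmean f)%:C :> R[i].
Proof.
move=> /continuous_real cf.
apply: (@mean_morph (cplx R) (cplx R) (fun z => (complex.Re z)%:C) 1 (fun g => (f g)%:C) ler01 _ _ _ cf).
- by move=> x y; rewrite -[RHS](rmorphD (@real_complex R)); case: x y => [a b] [c d].
- by move=> c [a b]; rewrite [RHS]cplxZ -[RHS](rmorphM (@real_complex R)) /= mul0r subr0.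
- move=> x; rewrite mul1r rn_real -lecR -rnE normc_def lecR.
  by rewrite -sqrtr_sqr ler_wsqrtr // lerDl sqr_ge0.
Qed.

Lemma rmean_tends (f : G -> R) : continuous f -> forall e : R, 0 < e -> exists N, forall n, (N <= n)%N ->
  `|(size (hs n))%:R^-1 * (\sum_(g <- hs n) f g) - rmean f| <= e.
Proof.
move=> cf e e0; have cf' := (continuous_real f).1 cf.
have [N hN] := mean_tends cf' e0; exists N => n /hN; rewrite rmeanE //.
have -> : avg (hs n) (fun g => (f g)%:C : cplx R) =
    ((size (hs n))%:R^-1 * (\sum_(g <- hs n) f g))%:C :> R[i].
  by rewrite rmorphM rmorph_sum.
by rewrite -[X in rn X](rmorphB (@real_complex R)) rn_real.
Qed.

Lemma rmean_dist (f f' : G -> R) (e : R) : continuous f -> continuous f' ->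
  (forall g, `|f g - f' g| <= e) -> `|rmean f - rmean f'| <= e.
Proof.
move=> cf cf' ff'; apply: le_addeps => d d0; have d2 : 0 < d / 2 by rewrite divr_gt0.
have [N /(_ _ (leq_maxl _ _)) hN] := rmean_tends cf d2.
have [M /(_ _ (leq_maxr _ _)) hM] := rmean_tends cf' d2.
have := hN M; have := hM N; set l := hs _; set a := _^-1 * (\sum_(g <- l) f' g); set a' := _^-1 * (\sum_(g <- l) f g) => h1 h2.
have l0 : 0 < (size l)%:R :> R by rewrite ltr0n hsP.1.
have : `|a' - a| <= e.
  rewrite /a' /a -mulrBr -sumrB normrM ger0_norm ?invr_ge0 ?(ltW l0) // ler_pdivrMl //.
  rewrite (le_trans (ler_norm_sum _ _ _)) // mulr_natl -(count_predT l).
  rewrite -iter_addr_0 -big_const_seq; exact: ler_sum.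
move=> h3; rewrite [leRHS](_ : _ = d / 2 + e + d / 2); last by field.
rewrite distrC in h2; have := ler_distD a' (rmean f) (rmean f'); have := ler_distD a a' (rmean f').
by move=> /le_trans/(_ (lerD h3 h1)) h4 /le_trans/(_ (lerD h2 h4)); rewrite addrA.
Qed.

Lemma rmean_right (f : G -> R) h : continuous f -> rmean (fun g => f (g * h)%g) = rmean f.
Proof. by move=> cf; rewrite /rmean (mean_right h ((continuous_real f).1 cf)). Qed.

Lemma mean_scale (X : completeNormedModType R[i]) (f : G -> R) (x : X) : continuous f ->
  mean (fun g => (f g)%:C *: x) = (rmean f)%:C *: x.
Proof.
move=> cf; rewrite -rmeanE //.
apply: (@mean_morph (cplx R) X (fun z => (z : R[i]) *: x) (rn x)).
- exact: rn_ge0.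
- by move=> y z; exact: scalerDl.
- by move=> c y; rewrite scalerA.
- by move=> y; rewrite rn_complex mulrC.
exact/continuous_real.
Qed.

Lemma mean_le_rmean (X : completeNormedModType R[i]) (u : G -> X) (f : G -> R) :
  continuous u -> continuous f -> (forall g, rn (u g) <= f g) -> rn (mean u) <= rmean f.
Proof.
move=> cu cf h; apply: le_addeps => e e0; have e2 : 0 < e / 2 by rewrite divr_gt0.
have [N /(_ _ (leq_maxl _ _)) hN] := mean_tends cu e2.
have [M /(_ _ (leq_maxr _ _)) hM] := rmean_tends cf e2.
have := avg_le (hs (maxn N M)) h; have := rn_sub (mean u) (avg (hs (maxn N M)) u).
have := hN M; have := hM N; rewrite (rnB (mean u)).
set a := _ * _; rewrite ler_norml => /andP[_ h1] h2 h3 h4; lra.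
Qed.

Lemma rmean_ge0 (f : G -> R) : continuous f -> (forall g, 0 <= f g) -> 0 <= rmean f.
Proof.
move=> cf f0; apply: le_trans (rn_ge0 (mean (fun=> 0 : cplx R))) _.
by apply: mean_le_rmean => // [g|g]; [exact: cvg_cst | rewrite rn0].
Qed.

(** Finitely many translates of [f] add up to a function bounded below by a
   positive constant. *)
Lemma rmean_gt0 (f : G -> R) : compact [set: G] -> continuous f -> (forall g, 0 <= f g) -> 0 < f 1%g ->
  0 < rmean f.
Proof.
move=> compG cf f0 f1; pose U := f @^-1` [set r | f 1%g / 2 < r].
have oU : open U by apply: open_comp => [g _|]; [exact: cf | exact: open_gt].
have [s cs] : exists s, covers U s.
  by apply: covers_exists => //; rewrite /U /= ltr_pdivrMr // ltr_pMr // ltr1n.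
rewrite lt_neqAle rmean_ge0 // andbT; apply/negP => /eqP r0.
pose F g : R := \sum_(x <- s) f (x^-1 * g)%g.
have cf' := (continuous_real f).1 cf.
have cx x : continuous (fun g => (f (x^-1 * g)%g)%:C : cplx R).
  exact: continuous_after cf' (@mulgl_continuous _ _).
have FE : (fun g => (F g)%:C : cplx R) = (fun g => \sum_(x <- s) ((f (x^-1 * g)%g)%:C : cplx R)).
  by apply/funext => g; rewrite /F rmorph_sum.
have cF : continuous F by apply/continuous_real; rewrite FE; exact: continuous_sum.
have F0 : mean (fun g => (F g)%:C : cplx R) = 0.
  rewrite FE; elim: (s : seq G) => [|x l IH].
    by under eq_fun do rewrite big_nil; rewrite mean_cst.
  under eq_fun do rewrite big_cons.
  rewrite (meanD (cx x) (continuous_sum (s := l) cx)) IH addr0.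
  by rewrite (mean_left x^-1%g cf') (rmeanE cf) -r0.
have : rn (mean (fun=> (f 1%g / 2)%:C : cplx R)) <= rmean F.
  apply: (mean_le_rmean _ cF) => g; first exact: cvg_cst.
  have [x xs Ux] := cs g; rewrite rn_real ger0_norm ?divr_ge0 //.
  by rewrite /F (big_rem x) //= ler_wpDr ?sumr_ge0 // ltW.
rewrite mean_cst rn_real ger0_norm ?divr_ge0 // /rmean F0 /=.
by rewrite leNgt divr_gt0.
Qed.

End Mean.

(** * Positive definite kernels *)

Section Gram.
Variables (R : realType) (T : Type) (k : T -> T -> R[i]) (A : cstarAlgType R).
Implicit Types (v w : seq (A * T)) (f : T -> A) (a b : A).

(** A list [w] of pairs [(b, y)] stands for the sum of the [b (x) k_y]; this is
   its inner product with an [f] in the completion. *)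
Definition pair w f : A := \sum_(p <- w) star p.1 * f p.2.

Definition ev v : T -> A := fun x => \sum_(q <- v) k x q.2 *: q.1.

Definition gram w v := pair w (ev v).

Definition wact w a : seq (A * T) := [seq (p.1 * a, p.2) | p <- w].

Definition wdiff w v := w ++ wact v (-1).

Lemma pair_cat w v f : pair (w ++ v) f = pair w f + pair v f.
Proof. by rewrite /pair big_cat. Qed.

Lemma pair_wact w a f : pair (wact w a) f = star a * pair w f.
Proof.
rewrite /pair big_map mulr_sumr; apply: eq_bigr => p _ /=.
by rewrite star_mul mulrA.
Qed.

Lemma pair_wdiff w v f : pair (wdiff w v) f = pair w f - pair v f.
Proof. by rewrite pair_cat pair_wact starN star1 mulN1r. Qed.

Lemma pairD w f f' : pair w (fun x => f x + f' x) = pair w f + pair w f'.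
Proof. by rewrite /pair -big_split; apply: eq_bigr => p _; rewrite mulrDr. Qed.

Lemma pairB w f f' : pair w (fun x => f x - f' x) = pair w f - pair w f'.
Proof. by rewrite /pair -sumrB; apply: eq_bigr => p _; rewrite mulrBr. Qed.

Lemma pairZ w (c : R[i]) f : pair w (fun x => c *: f x) = c *: pair w f.
Proof. by rewrite /pair scaler_sumr; apply: eq_bigr => p _; rewrite -scalerAr. Qed.

Lemma pairM w f a : pair w (fun x => f x * a) = pair w f * a.
Proof. by rewrite /pair mulr_suml; apply: eq_bigr => p _; rewrite mulrA. Qed.

Lemma pair1 a x f : pair [:: (a, x)] f = star a * f x.
Proof. by rewrite /pair big_seq1. Qed.

Lemma ev_cat w v x : ev (w ++ v) x = ev w x + ev v x.
Proof. by rewrite /ev big_cat. Qed.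

Lemma ev_wact w a x : ev (wact w a) x = ev w x * a.
Proof. by rewrite /ev big_map mulr_suml; apply: eq_bigr => p _; rewrite scalerAl. Qed.

Lemma ev_wdiff w v x : ev (wdiff w v) x = ev w x - ev v x.
Proof. by rewrite ev_cat ev_wact mulrN1. Qed.

Lemma gram_wact w a v : gram (wact w a) v = star a * gram w v.
Proof. exact: pair_wact. Qed.

Lemma gram_wactr w a v : gram w (wact v a) = gram w v * a.
Proof. by rewrite -pairM; congr pair; apply/funext => x; rewrite ev_wact. Qed.

Lemma gram_wdiffl w w' v : gram (wdiff w w') v = gram w v - gram w' v.
Proof. exact: pair_wdiff. Qed.

Lemma gram_wdiffr w v v' : gram w (wdiff v v') = gram w v - gram w v'.
Proof. by rewrite -pairB; congr pair; apply/funext => x; rewrite ev_wdiff. Qed.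

Hypothesis k_herm : forall x y, k y x = Num.conj (k x y).

Lemma gram_star w v : star (gram w v) = gram v w.
Proof.
rewrite /gram /pair star_sum.
under eq_bigr => p _ do rewrite star_mul starK /ev star_sum mulr_suml.
rewrite exchange_big; apply: eq_bigr => q _; rewrite /ev mulr_sumr.
by apply: eq_bigr => p _; rewrite starZ -k_herm -scalerAl -scalerAr.
Qed.

Lemma pair_col w x0 b : pair w (fun x => k x x0 *: b) = star (ev w x0) * b.
Proof.
rewrite /pair /ev star_sum mulr_suml; apply: eq_bigr => p _.
by rewrite starZ -k_herm -scalerAl -scalerAr.
Qed.

Lemma gram_cons b x0 w : gram ((b, x0) :: w) ((b, x0) :: w) =
  k x0 x0 *: (star b * b) + star b * ev w x0 + star (ev w x0) * b + gram w w.
Proof.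
have evE x : ev ((b, x0) :: w) x = k x x0 *: b + ev w x by rewrite /ev big_cons.
rewrite /gram {1}/pair big_cons /= -/(pair w _) evE mulrDr -scalerAr -!addrA.
do 2 congr (_ + _); rewrite -pair_col -pairD; congr pair.
by apply/funext => x; rewrite evE.
Qed.

End Gram.

Section Schur.
Variables (R : realType) (T : Type).

Definition psd (k : T -> T -> R[i]) : Prop :=
  (forall x y, k y x = Num.conj (k x y)) /\
  forall w : seq (cplx R * T), mpos (gram k w w).

Definition schur (k : T -> T -> R[i]) x0 x y := k x y - k x x0 * k x0 y / k x0 x0.

Lemma psd_diag k x : psd k -> 0 <= k x x.
Proof.
move=> [_ /(_ [:: (1, x)])/mpos_cplx].
by rewrite /gram pair1 /ev big_seq1 star1 mul1r cplxZ mulr1.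
Qed.

(** Completing the square in the first coefficient. *)
Lemma gram_schur k (A : cstarAlgType R) x0 b (w : seq (A * T)) :
  psd k -> k x0 x0 != 0 ->
  gram k ((b, x0) :: w) ((b, x0) :: w) =
  k x0 x0 *: (star (b + (k x0 x0)^-1 *: ev k w x0) * (b + (k x0 x0)^-1 *: ev k w x0))
  + gram (schur k x0) w w.
Proof.
move=> pk k0; have hk := pk.1; rewrite gram_cons //.
set S := ev k w x0; set d := k x0 x0 in k0 *.
have dreal : Num.conj d^-1 = d^-1 by rewrite fmorphV /= /d -hk.
have -> : gram (schur k x0) w w = gram k w w - d^-1 *: (star S * S).
  rewrite scalerAr -(pair_col hk) /gram -pairB; congr pair; apply/funext => x.
  rewrite /ev scalerA scaler_sumr -sumrB; apply: eq_bigr => q _.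
  by rewrite /schur scalerBl scalerA mulrAC.
rewrite starD starZ dreal mulrDr !mulrDl !scalerDr -!scalerAl -!scalerAr !scalerA.
by rewrite !mulfV // !scale1r mul1r !addrA [RHS]addrAC addrK [in RHS](addrAC _ (star S * b)).
Qed.

Lemma psd_schur k x0 : psd k -> k x0 x0 != 0 -> psd (schur k x0).
Proof.
move=> pk k0; have [hk pos] := pk; split=> [x y|w].
  rewrite /schur rmorphB fmorph_div rmorphM /= -!hk; congr (_ - _ / _).
  by rewrite mulrC.
have := pos ((- ((k x0 x0)^-1 *: ev k w x0), x0) :: w).
by rewrite gram_schur // addNr mulr0 scaler0 add0r.
Qed.

Lemma psd_null k x0 y : psd k -> k x0 x0 = 0 -> k x0 y = 0.
Proof.
move=> pk k0; have [hk pos] := pk; set z := k x0 y.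
(* Positivity on [k_y] minus growing multiples of [k_x0]. *)
have h (s : R) : 0 <= k y y - (s * 2)%:C * (Num.conj z * z).
  have := pos [:: (- (s%:C * z) : cplx R, x0); (1, y)].
  rewrite gram_cons // k0 scale0r add0r => /mpos_cplx; congr (_ <= _).
  rewrite /gram pair1 /ev !big_seq1 star1 mul1r !cplxZ !mulr1 -/z.
  rewrite addrC; congr (_ + _).
  rewrite !cplxM !cplx_star rmorphN rmorphM /= conjC_real.
  rewrite rmorphM rmorphMn /=; ring.
apply/eqP; case: (eqVneq z 0) => // z0.
have zz : 0 < Num.conj z * z by rewrite mulrC -normCK exprn_gt0 // normr_gt0.
have zr : (complex.Re (Num.conj z * z))%:C = Num.conj z * z.
  exact/esym/ge0_ReE/ltW.
have yr : (complex.Re (k y y))%:C = k y y.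
  exact/esym/ge0_ReE/psd_diag.
move: zz; rewrite -zr ltcR => zz.
have := h ((complex.Re (k y y) + 1) / complex.Re (Num.conj z * z)).
rewrite -zr -yr -rmorphM -rmorphB lecR.
have := psd_diag y pk; rewrite -yr lecR /= => y0.
rewrite mulrAC divfK ?gt_eqF //; lra.
Qed.

(** Elimination of one vector after the other, as in the Cholesky decomposition:
   a kernel that is positive over the complex numbers stays so over [A]. *)
Lemma psd_gram k (A : cstarAlgType R) (w : seq (A * T)) : psd k -> mpos (gram k w w).
Proof.
elim: w k => [|[b x0] w IH] k pk; first by rewrite /gram /pair big_nil; exact: mpos0.
have [k0|k0] := eqVneq (k x0 x0) 0.
  rewrite gram_cons; last exact: pk.1.
  have -> : ev k w x0 = 0.
    by rewrite /ev big1 // => q _; rewrite psd_null // scale0r.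
  by rewrite k0 scale0r star0 mulr0 mul0r !add0r; exact: IH.
rewrite gram_schur //; apply: mposD; last exact: IH (psd_schur pk k0).
have r0 := psd_diag x0 pk.
rewrite (ge0_ReE r0); apply: mposZ; [exact: Re_ge0 | exact: mpos_starM].
Qed.

End Schur.

Section GramNorm.
Variables (R : realType) (T : Type) (k : T -> T -> R[i]) (A : cstarAlgType R).
Hypothesis pk : psd k.
Implicit Types (v w : seq (A * T)).

Definition gnorm w : R := Num.sqrt (rn (gram k w w)).

Lemma gnorm_ge0 w : 0 <= gnorm w.
Proof. exact: sqrtr_ge0. Qed.

Lemma gnorm_sqr w : gnorm w ^+ 2 = rn (gram k w w).
Proof. by rewrite sqr_sqrtr // rn_ge0. Qed.

Lemma gram_le w v : rn (gram k w v) <= gnorm w * gnorm v.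
Proof.
rewrite -ler_sqr ?nnegrE ?rn_ge0 ?mulr_ge0 ?gnorm_ge0 // exprMn !gnorm_sqr.
apply: cauchy_schwarz; first exact: psd_gram.
move=> s; have := psd_gram (wdiff (wact w s) v) pk; congr mpos.
rewrite gram_wdiffl !gram_wdiffr !gram_wactr !gram_wact -(gram_star pk.1 w v).
by rewrite opprB addrA addrAC.
Qed.

End GramNorm.

(** * The Hilbert module of a kernel *)

Record pdkernel (R : realType) := PDKernel {
  pk_pt : eqType ;
  pk_fun : pk_pt -> pk_pt -> R[i] ;
  pk_psd : psd pk_fun
}.

(** Completeness is proved for sequences and transferred to Cauchy filters. *)
Section SeqComplete.
Variables (R : realType) (X : normedModType R[i]).

Lemma seq_complete (F : set_system X) :
  (forall u : nat -> X, (forall e : R, 0 < e -> exists N : nat, forall m n,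
     (N <= m)%N -> (m <= n)%N -> rn (u m - u n) <= e) -> exists l, tends u l) ->
  ProperFilter F -> cauchy F -> cvg F.
Proof.
move=> hX FF /cauchy_ballP Fc.
have e_gt0 n : 0 < (n.+1%:R^-1 : R)%:C by rewrite ltcR invr_gt0 ltr0n.
have hC n : exists C, F C /\ forall x y, C x -> C y -> rn (x - y) <= n.+1%:R^-1.
  have [[P Q] /= [FP FQ] PQ] := Fc _ (e_gt0 n).
  exists (P `&` Q); split; first exact: filterI.
  move=> x y [Px _] [_ Qy]; have := PQ (x, y) (conj Px Qy).
  by rewrite -ball_normE /= rnE ltcR => /ltW.
pose C n := sval (cid (hC n)).
have FC n : F (C n) by rewrite /C; case: cid => c [].
have dC n x y : C n x -> C n y -> rn (x - y) <= n.+1%:R^-1.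
  exact: (proj2 (svalP (cid (hC n)))).
pose D := fix D n := if n is m.+1 then D m `&` C n else C 0%N.
have FD n : F (D n) by elim: n => [|n IH] /=; [exact: FC | exact: filterI].
have DC m n : (m <= n)%N -> D n `<=` C m.
  move=> /subnK <-; elim: (n - m)%N => [|j IH] x; last by move=> [/IH].
  by rewrite add0n; case: m => [|m] //= [].
have exD n : exists x, D n x by exact: filter_ex (FD n).
pose u n := sval (cid (exD n)).
have uD n : D n (u n) by rewrite /u; case: cid.
have small (e : R) : 0 < e -> exists N : nat, (N.+1%:R^-1 : R) <= e.
  move=> e0; have := archi_boundP (ltW (divr_gt0 ltr01 e0)).
  set N := Num.bound _ => hN; exists N; rewrite invf_ple ?posrE ?ltr0n // -[e^-1]mul1r.
  by rewrite (le_trans (ltW hN)) // ler_nat.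
have [e e0|l ul] := hX u.
  have [N hN] := small _ e0; exists N => m n Nm mn; apply: le_trans hN.
  by apply: dC; [exact: DC (uD m) | exact: DC (leq_trans Nm mn) _ (uD n)].
apply/cvg_ex; exists l; apply/cvgrPdist_le => /= e; case: e => e e'.
rewrite ltcE /= => /andP[/eqP -> e0]; have e2 : 0 < e / 2 by rewrite divr_gt0.
have [N hN] := small _ e2; have [M hM] := ul _ e2.
apply: filterS (FC N) => x Cx; rewrite rn_le (le_trans (rn_tri (u (maxn N M)) _ _)) // (splitr e).
rewrite lerD //; first by rewrite rnB hM // leq_maxr.
by apply: le_trans hN; apply: dC => //; exact: DC (leq_maxl _ _) _ (uD _).
Qed.

End SeqComplete.

Section KernelSpace.
Variables (R : realType) (A : cstarAlgType R) (K : pdkernel R).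
Notation T := (pk_pt K).
Notation k := (@pk_fun R K).
Notation pk := (pk_psd K).
Implicit Types (v w : seq (A * T)) (f : T -> A) (a b : A).

Definition bounded_by f (r : R) := forall w, rn (pair w f) <= r * gnorm k w.

Definition approx f := forall e : R, 0 < e ->
  exists v, bounded_by (fun x => f x - ev k v x) e.

Definition approx_pred : {pred T -> A} := fun f => `[< approx f >].

Lemma bounded_byD f f' r r' : bounded_by f r -> bounded_by f' r' ->
  bounded_by (fun x => f x + f' x) (r + r').
Proof.
by move=> h h' w; rewrite pairD (le_trans (rnD _ _)) // mulrDl lerD.
Qed.

Lemma bounded_byZ f r (c : R[i]) : bounded_by f r ->
  bounded_by (fun x => c *: f x) (complex.Re `|c| * r).
Proof.
move=> h w; rewrite pairZ rn_complex -mulrA ler_wpM2l //.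
exact: Re_norm_ge0.
Qed.

Lemma bounded_byW f r r' : r <= r' -> bounded_by f r -> bounded_by f r'.
Proof. by move=> rr h w; rewrite (le_trans (h w)) // ler_wpM2r // gnorm_ge0. Qed.

Lemma bounded_by_ev v : bounded_by (ev k v) (gnorm k v).
Proof. by move=> w; rewrite mulrC; exact: gram_le pk w v. Qed.

Lemma bounded_byM f r a : bounded_by f r -> bounded_by (fun x => f x * a) (r * rn a).
Proof.
move=> h w; rewrite pairM (le_trans (rnM _ _)) // mulrAC.
by rewrite ler_wpM2r // rn_ge0.
Qed.

Fact approx_submod : submod_closed approx_pred.
Proof.
split.
  apply/asboolP => e e0; exists [::] => w.
  rewrite /pair big1 ?rn0 ?mulr_ge0 ?gnorm_ge0 // ?ltW // => p _.
  by rewrite /ev big_nil subr0 mulr0.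
move=> c f f' /asboolP hf /asboolP hf'; apply/asboolP => e e0.
have cr := Re_norm_ge0 c.
have e2 : 0 < e / 2 by rewrite divr_gt0.
have c1 : 0 < complex.Re `|c| + 1 by rewrite ltr_wpDl.
have [v hv] := hf _ (divr_gt0 e2 c1); have [v' hv'] := hf' _ e2.
exists (wact v (c%:A) ++ v').
have -> : (fun x => (c *: f + f') x - ev k (wact v (c%:A) ++ v') x) =
    (fun x => c *: (f x - ev k v x) + (f' x - ev k v' x)).
  apply/funext => x; rewrite ev_cat ev_wact -scalerAr mulr1 scalerBr opprD.
  by rewrite addrACA.
have := bounded_byD (bounded_byZ c hv) hv'; apply: bounded_byW.
rewrite [leRHS](splitr e) lerD2r mulrCA ler_piMr ?(ltW e2) // ler_pdivrMr // mul1r.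
by rewrite lerDl.
Qed.

HB.instance Definition _ := GRing.isSubmodClosed.Build _ _ approx_pred approx_submod.

(** Functions approximable by finite combinations of the [k_x] in the norm of
   the bounded functionals on the space of such combinations: a completion made
   of functions on [T]. *)
Record rk := RK { rk_fun :> T -> A ; rk_approx : rk_fun \in approx_pred }.

HB.instance Definition _ := [isSub for rk_fun].
HB.instance Definition _ := [Choice of rk by <:].
HB.instance Definition _ := [SubChoice_isSubLmodule of rk by <:].

Implicit Types (h g : rk).

Lemma rkD h g x : (h + g : rk) x = h x + g x. Proof. by []. Qed.

Lemma rkB h g x : (h - g : rk) x = h x - g x. Proof. by []. Qed.

Lemma rkZ (c : R[i]) h x : (c *: h : rk) x = c *: h x. Proof. by []. Qed.

Lemma rk_ext h g : (forall x, h x = g x) -> h = g.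
Proof. by move=> e; apply/val_inj/funext. Qed.

Lemma rkP h : approx h.
Proof. by have /asboolP := rk_approx h. Qed.

Lemma rk_bounded h : exists2 r, 0 <= r & bounded_by h r.
Proof.
have [v hv] := rkP h ltr01; exists (1 + gnorm k v); first by rewrite addr_ge0 // gnorm_ge0.
have := bounded_byD hv (bounded_by_ev v).
by have -> : (fun x => h x - ev k v x + ev k v x) = h :> (T -> A)
  by apply/funext => x; rewrite subrK.
Qed.

Definition nrm h : R := inf [set r | 0 <= r /\ bounded_by h r].

Lemma nrm_ge0 h : 0 <= nrm h.
Proof.
by have [r r0 hr] := rk_bounded h; apply: lb_le_inf; [exists r | move=> x []].
Qed.

Lemma nrm_le h r : 0 <= r -> bounded_by h r -> nrm h <= r.
Proof. by move=> r0 hr; apply: ge_inf => //; exists 0 => x []. Qed.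

Lemma nrmP h : bounded_by h (nrm h).
Proof.
have [r r0 hr] := rk_bounded h => w.
have [w0|w0] := eqVneq (gnorm k w) 0.
  by have := hr w; rewrite w0 !mulr0.
have wp : 0 < gnorm k w by rewrite lt_neqAle eq_sym w0 gnorm_ge0.
rewrite -ler_pdivrMr //; apply: lb_le_inf; first by exists r.
by move=> s [_ hs]; rewrite ler_pdivrMr.
Qed.

Lemma rn_le_nrm h x : rn (h x) <= nrm h * gnorm k [:: (1 : A, x)].
Proof. by have := nrmP h [:: (1, x)]; rewrite pair1 star1 mul1r. Qed.

Fact nrm_triangle h g : (nrm (h + g))%:C <= (nrm h)%:C + (nrm g)%:C.
Proof.
rewrite -rmorphD lecR nrm_le ?addr_ge0 ?nrm_ge0 //.
exact: bounded_byD (nrmP h) (nrmP g).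
Qed.

Fact nrm_scale (c : R[i]) h : (nrm (c *: h))%:C = `|c| * (nrm h)%:C.
Proof.
have le (d : R[i]) g : nrm (d *: g) <= complex.Re `|d| * nrm g.
  apply: nrm_le; last exact: bounded_byZ (nrmP g).
  by rewrite mulr_ge0 ?nrm_ge0 // Re_norm_ge0.
have cE := ge0_ReE (normr_ge0 c).
rewrite [in RHS]cE -rmorphM; congr (_%:C); apply/le_anti; rewrite le andTb.
have [->|c0] := eqVneq c 0; first by rewrite normr0 mul0r nrm_ge0.
have cp : 0 < complex.Re `|c| by have := normr_gt0 c; rewrite c0 cE ltcR.
have := le c^-1 (c *: h); rewrite scalerA mulVf // scale1r normfV.
have -> : complex.Re (`|c|^-1) = (complex.Re `|c|)^-1 by rewrite cE -fmorphV.
by rewrite ler_pdivlMl // mulrC.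
Qed.

Fact nrm_eq0 h : (nrm h)%:C = 0 :> R[i] -> h = 0.
Proof.
move=> [] h0; apply: rk_ext => x; apply: rn_eq0; apply/le_anti.
by rewrite rn_ge0 andbT (le_trans (rn_le_nrm h x)) // h0 mul0r.
Qed.

HB.instance Definition _ := Lmodule_isNormed.Build R[i] rk
  nrm_triangle nrm_scale nrm_eq0.

Lemma rn_nrm h : rn h = nrm h. Proof. by []. Qed.

Lemma pair_le w h : rn (pair w h) <= rn h * gnorm k w.
Proof. exact: nrmP. Qed.

Lemma rk_rn_le h r : 0 <= r -> (forall w, rn (pair w h) <= r * gnorm k w) -> rn h <= r.
Proof. exact: nrm_le. Qed.

Fact ev_approx v : ev k v \in approx_pred.
Proof.
apply/asboolP => e e0; exists v => w.
rewrite /pair big1 ?rn0 ?mulr_ge0 ?gnorm_ge0 // ?ltW // => p _.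
by rewrite subrr mulr0.
Qed.

Definition rkev v : rk := RK (ev_approx v).

Lemma rk_rkev h (e : R) : 0 < e -> exists v, rn (h - rkev v) <= e.
Proof.
by move=> e0; have [v hv] := rkP h e0; exists v; apply: rk_rn_le => //; exact: ltW.
Qed.

Lemma rn_rkev v : rn (rkev v) = gnorm k v.
Proof.
apply/le_anti; rewrite rk_rn_le ?gnorm_ge0 //; last exact: bounded_by_ev.
have [v0|v0] := eqVneq (gnorm k v) 0; first by rewrite v0 rn_ge0.
have vp : 0 < gnorm k v by rewrite lt_neqAle eq_sym v0 gnorm_ge0.
rewrite andTb -(ler_pM2r vp) -expr2 gnorm_sqr; exact: (pair_le v (rkev v)).
Qed.

Lemma rkev_wdiff w v : rkev (wdiff w v) = rkev w - rkev v.
Proof. by apply: rk_ext => x; rewrite rkB /= ev_wdiff. Qed.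

Lemma tends_eval (u : nat -> rk) h x : tends u h -> tends (fun n => u n x) (h x).
Proof.
apply: (@tends_lip R rk A (fun h : rk => h x) (gnorm k [:: (1 : A, x)])) => [|f g].
  exact: gnorm_ge0.
by rewrite mulrC -rkB rn_le_nrm.
Qed.

Lemma tends_pair w (u : nat -> T -> A) (f : T -> A) : (forall x, tends (u ^~ x) (f x)) ->
  tends (fun n => pair w (u n)) (pair w f).
Proof.
move=> uf; elim: w => [|p w IH].
  rewrite /pair big_nil; apply: tends_ext (tends_cst _) => n.
  by rewrite /pair big_nil.
rewrite /pair big_cons -/(pair w f).
have h : tends (fun n => star p.1 * u n p.2) (star p.1 * f p.2).
  apply: (@tends_lip R A A (fun x => star p.1 * x) (rn (star p.1))) (uf _); first exact: rn_ge0.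
  by move=> x y; rewrite -mulrBr rnM.
by apply: tends_ext (tendsD h IH) => n; rewrite /pair big_cons.
Qed.

Lemma rk_seq_complete (u : nat -> rk) :
  (forall e : R, 0 < e -> exists N : nat, forall m n, (N <= m)%N -> (m <= n)%N ->
    rn (u m - u n) <= e) -> exists l, tends u l.
Proof.
move=> uc; have hx x : exists l, tends (fun n => u n x) l.
  apply: tends_complete => e e0; set c := gnorm k [:: (1 : A, x)].
  have c1 : 0 < c + 1 by rewrite ltr_wpDl // gnorm_ge0.
  have [N hN] := uc _ (divr_gt0 e0 c1); exists N => m n Nm mn.
  rewrite -rkB (le_trans (rn_le_nrm _ _)) // -/c (@le_trans _ _ (e / (c + 1) * (c + 1))) //.
    by rewrite ler_pM ?nrm_ge0 ?gnorm_ge0 ?lerDl // hN.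
  by rewrite divfK // gt_eqF.
pose f x := sval (cid (hx x)).
have uf x : tends (u ^~ x) (f x) by exact: (svalP (cid (hx x))).
have key e : 0 < e -> exists N, forall n, (N <= n)%N -> bounded_by (fun x => u n x - f x) e.
  move=> e0; have [N hN] := uc _ e0; exists N => n Nn w.
  apply: (@tends_rn_le R A (fun m => pair w (fun x => u n x - u (m + n)%N x))).
    move=> m; rewrite (le_trans (pair_le w (u n - u (m + n)%N))) //.
    by rewrite ler_wpM2r ?gnorm_ge0 // hN // leq_addl.
  apply: tends_pair => x; apply: tendsB (tends_cst _) _.
  exact: tends_shift (uf x).
have fa : f \in approx_pred.
  apply/asboolP => e e0; have e2 : 0 < e / 2 by rewrite divr_gt0.
  have [N /(_ N (leqnn N)) hN] := key _ e2; have [v hv] := rkP (u N) e2; exists v => w.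
  have -> : pair w (fun x => f x - ev k v x) =
      pair w (fun x => u N x - ev k v x) - pair w (fun x => u N x - f x).
    by rewrite !pairB opprB [RHS]addrC addrA subrK.
  rewrite (le_trans (rnBD _ _)) // (splitr e) mulrDl lerD //.
exists (RK fa) => e e0; have [N hN] := key _ e0; exists N => n Nn.
by apply: rk_rn_le; [exact: ltW | exact: hN].
Qed.

Fact rk_complete (F : set_system rk) : ProperFilter F -> cauchy F -> cvg F.
Proof. exact: seq_complete rk_seq_complete. Qed.

HB.instance Definition _ := Uniform_isComplete.Build rk rk_complete.

Lemma cvg_approx h : exists vs : nat -> seq (A * T), tends (fun n => rkev (vs n)) h.
Proof.
have e0 n : 0 < (n.+1%:R^-1 : R) by rewrite invr_gt0 ltr0n.
exists (fun n => sval (cid (rk_rkev h (e0 n)))) => e ep.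
have := archi_boundP (ltW (divr_gt0 ltr01 ep)); set N := Num.bound _ => hN.
exists N => n Nn; rewrite rnB (le_trans (svalP (cid (rk_rkev h (e0 n))))) //.
rewrite invf_ple ?posrE ?ltr0n // -[e^-1]mul1r (le_trans (ltW hN)) // ler_nat.
exact: leqW.
Qed.

Lemma inner_cvg h g (vs : nat -> seq (A * T)) : tends (fun n => rkev (vs n)) h ->
  exists a, tends (fun n => pair (vs n) g) a.
Proof.
move=> hvs; apply: tends_complete => e e0.
have g1 : 0 < rn g + 1 by rewrite ltr_wpDl ?rn_ge0.
have e2 : 0 < e / (rn g + 1) / 2 by rewrite !divr_gt0.
have [N hN] := hvs _ e2; exists N => m n Nm mn.
rewrite -pair_wdiff (le_trans (pair_le _ _)) // -rn_rkev rkev_wdiff.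
have := rn_tri h (rkev (vs m)) (rkev (vs n)); rewrite (rnB h) => tri.
have := hN _ Nm; have := hN _ (leq_trans Nm mn).
set d := e / _ / 2 in e2 *; have de : (rn g + 1) * (d + d) = e.
  by rewrite /d -splitr mulrC divfK // gt_eqF.
move=> h1 h2; rewrite -de ler_pM ?rn_ge0 ?lerDl //.
exact: le_trans tri (lerD h2 h1).
Qed.

Definition rk_inner h g : A :=
  xget 0 [set a | exists2 vs, tends (fun n => rkev (vs n)) h & tends (fun n => pair (vs n) g) a].

Lemma inner_tends h g vs : tends (fun n => rkev (vs n)) h ->
  tends (fun n => pair (vs n) g) (rk_inner h g).
Proof.
move=> hvs; have [a ha] := inner_cvg g hvs.
suff -> : rk_inner h g = a by [].
have [ws hws wa] : exists2 vs, tends (fun n => rkev (vs n)) h &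
    tends (fun n => pair (vs n) g) (rk_inner h g).
  apply: (@xgetPex _ 0 [set a | exists2 vs, tends (fun n => rkev (vs n)) h &
    tends (fun n => pair (vs n) g) a]).
  by exists a; exists vs.
apply/eqP; rewrite -subr_eq0; apply/eqP; apply: tends_uniq (tendsB wa ha) _ => e e0.
have g1 : 0 < rn g + 1 by rewrite ltr_wpDl ?rn_ge0.
have [N hN] := tendsB hws hvs (divr_gt0 e0 g1); exists N => n /hN.
rewrite subrr !subr0 => hn; rewrite -pair_wdiff (le_trans (pair_le _ _)) //.
rewrite -rn_rkev rkev_wdiff (@le_trans _ _ ((rn g + 1) * (e / (rn g + 1)))) //.
  by rewrite ler_pM ?rn_ge0 ?lerDl.
by rewrite mulrC divfK // gt_eqF.
Qed.

Lemma rk_inner_ev w g : rk_inner (rkev w) g = pair w g.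
Proof.
have hw : tends (fun=> rkev w) (rkev w) by exact: tends_cst.
exact: (tends_uniq (inner_tends (vs := fun=> w) g hw) (tends_cst _)).
Qed.

Lemma inner_tends2 h g vs ws : tends (fun n => rkev (vs n)) h ->
  tends (fun n => rkev (ws n)) g -> tends (fun n => gram k (vs n) (ws n)) (rk_inner h g).
Proof.
move=> hvs gws.
have small : tends (fun n => pair (vs n) (rkev (ws n) - g)) (0 : A).
  move=> e e0; have h1 : 0 < rn h + 1 by rewrite ltr_wpDl ?rn_ge0.
  have [N hN] := hvs _ ltr01; have [M hM] := gws _ (divr_gt0 e0 h1).
  exists (maxn N M) => n; rewrite geq_max subr0 => /andP[/hN h2 /hM h3].
  rewrite (le_trans (pair_le _ _)) // -rn_rkev.
  rewrite (@le_trans _ _ (e / (rn h + 1) * (rn h + 1))) //; last by rewrite divfK // gt_eqF.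
  rewrite ler_pM ?rn_ge0 //.
  by rewrite (le_trans (rn_sub _ h)) // addrC lerD2l.
rewrite -[rk_inner h g]addr0; apply: tends_ext (tendsD (inner_tends g hvs) small) => n.
rewrite -pairD; congr pair; apply/funext => x; rewrite rkB /=.
by rewrite addrC subrK.
Qed.

Fact rk_innerDr h g g' : rk_inner h (g + g') = rk_inner h g + rk_inner h g'.
Proof.
have [vs hvs] := cvg_approx h; apply: tends_uniq (inner_tends _ hvs) _.
by apply: tends_ext (tendsD (inner_tends g hvs) (inner_tends g' hvs)) => n; rewrite -pairD.
Qed.

Fact rk_innerZr (c : R[i]) h g : rk_inner h (c *: g) = c *: rk_inner h g.
Proof.
have [vs hvs] := cvg_approx h; apply: tends_uniq (inner_tends _ hvs) _.
have lip : forall x y : A, rn (c *: x - c *: y) <= complex.Re `|c| * rn (x - y).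
  by move=> x y; rewrite -scalerBr rn_complex.
have c0 := Re_norm_ge0 c.
by apply: tends_ext (tends_lip c0 lip (inner_tends g hvs)) => n; rewrite -pairZ.
Qed.

Fact rk_inner_star h g : rk_inner g h = star (rk_inner h g).
Proof.
have [vs hvs] := cvg_approx h; have [ws gws] := cvg_approx g.
apply: tends_uniq (inner_tends2 gws hvs) _.
apply: tends_ext (star_tends (inner_tends2 hvs gws)) => n.
by rewrite (gram_star pk.1).
Qed.

Fact rk_inner_positive h : cstar_positive (rk_inner h h).
Proof.
apply/mpos_cstar; have [vs hvs] := cvg_approx h.
by apply: (mpos_closed _ (inner_tends2 hvs hvs)) => n; exact: (psd_gram _ pk).
Qed.

Fact rk_inner_norm h : `|h| ^+ 2 = `|rk_inner h h|.
Proof.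
have [vs hvs] := cvg_approx h.
suff e : rn h ^+ 2 = rn (rk_inner h h) by rewrite !rnE -rmorphXn e.
have rn_lip (V : normedModType R[i]) (x y : V) : `|rn x - rn y| <= rn (x - y).
  rewrite ler_norml; have := rn_sub x y; have := rn_sub y x; rewrite (rnB y x) => h1 h2.
  by apply/andP; split; lra.
apply/eqP; rewrite -subr_eq0 -normr_eq0; apply/eqP/le_anti.
rewrite normr_ge0 andbT; apply/ler_addgt0Pr => e e0; rewrite add0r.
have h0 := rn_ge0 h; have h1 : 0 < 2 * rn h + 2 by lra.
pose d := Num.min 1 (e / (2 * rn h + 2)).
have d0 : 0 < d by rewrite lt_min ltr01 divr_gt0.
have d1 : d <= 1 by rewrite ge_min lexx.
have de : d * (2 * rn h + 2) <= e by rewrite -ler_pdivlMr // ge_min lexx orbT.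
have [N hN] := hvs _ d0; have [M hM] := inner_tends2 hvs hvs d0.
have := le_trans (rn_lip _ _ _) (hN _ (leq_maxl N M)).
have := le_trans (rn_lip _ _ _) (hM _ (leq_maxr N M)).
rewrite -gnorm_sqr rn_rkev; set a := gnorm _ _; set b := rn _; set c := rn _ in h0 h1 de *.
by rewrite !ler_norml => /andP[u1 u2] /andP[u3 u4]; apply/andP; split; nra.
Qed.

Fact rk_ract_approx h a : (fun x => h x * a) \in approx_pred.
Proof.
apply/asboolP => e e0; have a1 : 0 < rn a + 1 by rewrite ltr_wpDl ?rn_ge0.
have [v hv] := rkP h (divr_gt0 e0 a1); exists (wact v a).
have -> : (fun x => h x * a - ev k (wact v a) x) = (fun x => (h x - ev k v x) * a).
  by apply/funext => x; rewrite ev_wact mulrBl.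
apply: bounded_byW (bounded_byM a hv).
by rewrite mulrAC ler_pdivrMr // ler_wpM2l ?(ltW e0) // lerDl.
Qed.

Definition rk_ract h a : rk := RK (rk_ract_approx h a).

Fact rk_inner_ract h g a : rk_inner h (rk_ract g a) = rk_inner h g * a.
Proof.
have [vs hvs] := cvg_approx h; apply: tends_uniq (inner_tends _ hvs) _.
have lip : forall x y : A, rn (x * a - y * a) <= rn a * rn (x - y).
  by move=> x y; rewrite -mulrBl mulrC rnM.
by apply: tends_ext (tends_lip (rn_ge0 a) lip (inner_tends g hvs)) => n; rewrite -pairM.
Qed.

Fact rk_ractDl h g a : rk_ract (h + g) a = rk_ract h a + rk_ract g a.
Proof. by apply: rk_ext => x; exact: mulrDl. Qed.

Fact rk_ractDr h a b : rk_ract h (a + b) = rk_ract h a + rk_ract h b.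
Proof. by apply: rk_ext => x; rewrite rkD /= mulrDr. Qed.

Fact rk_ractZl (c : R[i]) h a : rk_ract (c *: h) a = c *: rk_ract h a.
Proof. by apply: rk_ext => x; symmetry; exact: scalerAl. Qed.

Fact rk_ractZr (c : R[i]) h a : rk_ract h (c *: a) = c *: rk_ract h a.
Proof. by apply: rk_ext => x; rewrite rkZ /= scalerAr. Qed.

Fact rk_ractM h a b : rk_ract h (a * b) = rk_ract (rk_ract h a) b.
Proof. by apply: rk_ext => x /=; rewrite mulrA. Qed.

Fact rk_ract1 h : rk_ract h 1 = h.
Proof. by apply: rk_ext => x /=; rewrite mulr1. Qed.

HB.instance Definition _ := isHilbertModule.Build R A rk rk_ractDl rk_ractDr
  rk_ractZl rk_ractZr rk_ractM rk_ract1 rk_innerDr rk_innerZr rk_inner_ract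
  rk_inner_star rk_inner_positive rk_inner_norm.

Lemma inner_rkev w g : inner (rkev w) g = pair w g.
Proof. exact: rk_inner_ev. Qed.

End KernelSpace.

(** * Tensor products *)

Section HilbertOfKernel.
Variables (R : realType) (K : pdkernel R).

Definition rkH : Type := rk (cplx R) K.

HB.instance Definition _ := CompleteNormedModule.copy rkH (rk (cplx R) K).

Definition rkH_dot (x y : rkH) : R[i] := inner (x : rk (cplx R) K) y.

Fact rkH_dotDr x y z : rkH_dot x (y + z) = rkH_dot x y + rkH_dot x z.
Proof. exact: (@innerDr R (cplx R) (rk (cplx R) K) x y z). Qed.

Fact rkH_dotZr (c : R[i]) x y : rkH_dot x (c *: y) = c * rkH_dot x y.
Proof. exact: (@innerZr R (cplx R) (rk (cplx R) K) c x y). Qed.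

Fact rkH_dot_conj x y : rkH_dot y x = Num.conj (rkH_dot x y).
Proof. exact: (@inner_star R (cplx R) (rk (cplx R) K) x y). Qed.

Fact rkH_dot_norm (x : rkH) : `|x| ^+ 2 = rkH_dot x x.
Proof.
rewrite (inner_norm (x : rk (cplx R) K)) /rkH_dot.
exact: ger0_norm ((mpos_cplx _).1 (mpos_inner (x : rk (cplx R) K))).
Qed.

HB.instance Definition _ := isHilbertSpace.Build R rkH
  rkH_dotDr rkH_dotZr rkH_dot_conj rkH_dot_norm.

End HilbertOfKernel.

Section Tensor.
Variables (R : realType) (A : cstarAlgType R) (K : pdkernel R).
Notation T := (pk_pt K).
Notation k := (@pk_fun R K).
Notation pk := (pk_psd K).
Implicit Types (v w : seq (cplx R * T)) (a b : A) (h : rkH K).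

(** The combination [v] of points tensored with [a]. *)
Definition tl v a : seq (A * T) := [seq ((q.1 : R[i]) *: a, q.2) | q <- v].

Lemma ev_tl v a x : ev k (tl v a) x = (ev k v x : R[i]) *: a.
Proof.
rewrite /ev big_map scaler_suml; apply: eq_bigr => q _ /=.
by rewrite scalerA.
Qed.

Lemma gram_tl v a w b :
  gram k (tl v a) (tl w b) = (gram k v w : R[i]) *: (star a * b).
Proof.
rewrite /gram /pair big_map scaler_suml; apply: eq_bigr => q _ /=.
by rewrite ev_tl starZ -scalerAl -scalerAr scalerA.
Qed.

Lemma gnorm_tl v a : gnorm k (tl v a) = gnorm k v * rn a.
Proof.
rewrite /gnorm gram_tl rn_complex rn_starM -[complex.Re _]/(rn (gram k v v)).
by rewrite sqrtrM ?rn_ge0 // sqrtr_sqr ger0_norm ?rn_ge0.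
Qed.

Lemma tens_bounded h a (w : seq (A * T)) :
  rn (pair w (fun x => (h x : R[i]) *: a)) <= rn h * rn a * gnorm k w.
Proof.
have [vs hvs] := cvg_approx (h : rk (cplx R) K).
have lim : tends (fun n => pair w (ev k (tl (vs n) a))) (pair w (fun x => (h x : R[i]) *: a)).
  apply: tends_pair => x.
  have lip (y z : cplx R) : rn ((y : R[i]) *: a - (z : R[i]) *: a) <= rn a * rn (y - z).
    by rewrite -scalerBl rn_complex mulrC.
  by apply: tends_ext (tends_lip (rn_ge0 a) lip (tends_eval x hvs)) => n; rewrite ev_tl.
apply: le_addeps => e e0; set c := rn a * gnorm k w.
have c0 : 0 <= c by rewrite mulr_ge0 ?rn_ge0 ?gnorm_ge0.
have c1 : 0 < c + 1 by rewrite ltr_wpDl.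
have [N hN] := hvs _ (divr_gt0 e0 c1).
apply: (tends_rn_le _ (tends_shift N lim)) => n.
rewrite (le_trans (gram_le pk w (tl (vs (n + N)%N) a))) // gnorm_tl mulrC -!mulrA -/c.
have vh : gnorm k (vs (n + N)%N) <= rn h + e / (c + 1).
  by rewrite -rn_rkev addrC (le_trans (rn_sub _ h)) // lerD2r hN // leq_addl.
rewrite (le_trans (ler_wpM2r c0 vh)) // mulrDl lerD2l.
by rewrite mulrAC ler_pdivrMr // ler_wpM2l ?(ltW e0) // lerDl.
Qed.

(** The tensor [a (x) h] is the function [x |-> h x *: a]. *)
Fact tens_approx a h : (fun x => (h x : R[i]) *: a) \in @approx_pred R A K.
Proof.
apply/asboolP => e e0; have a1 : 0 < rn a + 1 by rewrite ltr_wpDl ?rn_ge0.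
have [v hv] := rk_rkev (h : rk (cplx R) K) (divr_gt0 e0 a1); exists (tl v a) => w.
have -> : (fun x => (h x : R[i]) *: a - ev k (tl v a) x) =
    (fun x => (((h : rk (cplx R) K) - rkev v) x : R[i]) *: a).
  by apply/funext => x; rewrite ev_tl -scalerBl.
rewrite (le_trans (tens_bounded _ _ _)) // ler_wpM2r ?gnorm_ge0 //.
rewrite (le_trans (ler_wpM2r (rn_ge0 a) hv)) // mulrAC ler_pdivrMr //.
by rewrite ler_wpM2l ?(ltW e0) // lerDl.
Qed.

Definition tens a h : rk A K := RK (tens_approx a h).

Fact tens_bilinear : bilinear_for ( *:%R : R[i] -> rk A K -> rk A K)
  ( *:%R : R[i] -> rk A K -> rk A K) (tens : A -> rkH K -> rk A K).
Proof.
split=> [h c a b|a c h g]; apply: rk_ext => x.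
  by rewrite rkD rkZ /= scalerDr !scalerA mulrC.
by rewrite rkD rkZ /= scalerDl scalerA.
Qed.

HB.instance Definition _ := bilinear_isBilinear.Build R[i] A (rkH K) (rk A K) *:%R *:%R
  tens tens_bilinear.

Lemma rn_tens a h : rn (tens a h) <= rn h * rn a.
Proof. by apply: rk_rn_le => [|w]; [rewrite mulr_ge0 ?rn_ge0 | exact: tens_bounded]. Qed.

Lemma tens_rkev a v : tens a (rkev v) = rkev (tl v a).
Proof. by apply: rk_ext => x; rewrite /= ev_tl. Qed.

Lemma tends_tens a (u : nat -> rkH K) h : tends u h -> tends (fun n => tens a (u n)) (tens a h).
Proof.
apply: tends_lip (rn_ge0 a) _ => x y.
have -> : tens a x - tens a y = tens a (x - y) by rewrite -linearBr.
by rewrite mulrC rn_tens.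
Qed.

Lemma inner_tens a b (x y : rkH K) : inner (tens a x) (tens b y) = hdot x y *: (star a * b).
Proof.
have [vs xvs] := cvg_approx (x : rk (cplx R) K).
have [ws yws] := cvg_approx (y : rk (cplx R) K).
have lim v : inner (tens a (rkev v)) (tens b y) = (inner (rkev v : rk (cplx R) K) y : R[i]) *: (star a * b).
  apply: (tends_uniq (tends_innerr _ (tends_tens b yws))).
  have lip (z z' : cplx R) : rn ((z : R[i]) *: (star a * b) - (z' : R[i]) *: (star a * b)) <= rn (star a * b) * rn (z - z').
    by rewrite -scalerBl rn_complex mulrC.
  apply: tends_ext (tends_lip (rn_ge0 _) lip (tends_innerr (rkev v : rk (cplx R) K) yws)) => n.
  by rewrite !tens_rkev !inner_rkev -[pair (tl _ _) _]/(gram k _ _) gram_tl.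
apply: (tends_uniq (tends_innerl _ (tends_tens a xvs))).
have lip (z z' : cplx R) : rn ((z : R[i]) *: (star a * b) - (z' : R[i]) *: (star a * b)) <= rn (star a * b) * rn (z - z').
  by rewrite -scalerBl rn_complex mulrC.
by apply: tends_ext (tends_lip (rn_ge0 _) lip (tends_innerl (y : rk (cplx R) K) xvs)) => n; rewrite lim.
Qed.

Definition kpt (x : T) : rkH K := rkev [:: (1 : cplx R, x)].

Lemma tens_kpt a x : tens a (kpt x) = rkev [:: (a, x)].
Proof. by rewrite tens_rkev /tl /= scale1r. Qed.

Lemma rkev_sum (w : seq (A * T)) : rkev w = \sum_(p <- w) tens p.1 (kpt p.2).
Proof.
elim: w => [|[a x] w IH].
  by rewrite big_nil; apply: rk_ext => x; rewrite /= /ev big_nil.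
rewrite big_cons -IH tens_kpt; apply: rk_ext => y.
by rewrite rkD /= /ev big_cons big_seq1.
Qed.

Lemma tens_is_tensor : is_hilbert_tensor (tens : {bilinear A -> rkH K -> rk A K}).
Proof.
split=> [a b x|a b x y|].
- by apply: rk_ext => z /=; rewrite scalerAl.
- exact: inner_tens.
move=> O [h Oh] oO; have /nbhs_ballP[e /= e0 hO] : nbhs h O by exact: open_nbhs_nbhs.
have e0' := Re_gt0 e0; have eE := ge0_ReE (ltW e0).
have [w hw] := rk_rkev h (divr_gt0 e0' (ltr0n R 2)).
exists (rkev w); split; last first.
  exists (size w), (fun i => (tnth (in_tuple w) i).1), (fun i => kpt (tnth (in_tuple w) i).2).
  by rewrite rkev_sum (big_tnth _ _ w).
apply: hO; rewrite -ball_normE /= rnE eE ltcR (le_lt_trans hw) //.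
by rewrite ltr_pdivrMr // ltr_pMr // ltr1n.
Qed.

End Tensor.

(** * Automorphisms of kernels and trivial modules *)

Section StarMorphism.
Variables (R : realType) (A : cstarAlgType R) (th : {lrmorphism A -> A}).
Hypothesis th_star : forall a, th (star a) = star (th a).

Lemma mpos_morph a : mpos a -> mpos (th a).
Proof.
move=> /mpos_sqrt[y [[sy _] <- _]]; rewrite rmorphM; apply: mpos_sqr.
by rewrite -th_star sy.
Qed.

Lemma rn_morph a : rn (th a) <= rn a.
Proof.
rewrite -ler_sqr ?nnegrE ?rn_ge0 // -!rn_starM.
rewrite -[leRHS](rnA A (rn_ge0 _)); apply: mpos_le_norm; first exact: mpos_starM.
have := mpos_subA (mpos_sa (mpos_starM a)) (lexx _) => /mpos_morph.
by rewrite raddfB /= linearZ /= rmorph1 rmorphM /= th_star.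
Qed.

End StarMorphism.

(** An automorphism of [A] and a bijection of the points that preserves the
   kernel; together they act on the functions on the points. *)
Record kaut (R : realType) (A : cstarAlgType R) (K : pdkernel R) := KAut {
  ka_th : {lrmorphism A -> A} ;
  ka_thi : {lrmorphism A -> A} ;
  ka_pt : pk_pt K -> pk_pt K ;
  ka_pti : pk_pt K -> pk_pt K ;
  ka_thK : forall a, ka_th (ka_thi a) = a ;
  ka_star : forall a, ka_th (star a) = star (ka_th a) ;
  ka_stari : forall a, ka_thi (star a) = star (ka_thi a) ;
  ka_ptK : forall x, ka_pti (ka_pt x) = x ;
  ka_ptiK : forall x, ka_pt (ka_pti x) = x ;
  ka_kf : forall x y, pk_fun (ka_pt x) (ka_pt y) = pk_fun x y
}.

Section Move.
Variables (R : realType) (A : cstarAlgType R) (K : pdkernel R) (u : kaut A K).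
Notation T := (pk_pt K).
Notation k := (@pk_fun R K).
Notation pk := (pk_psd K).
Notation th := (ka_th u).
Notation pt := (ka_pt u).
Notation pti := (ka_pti u).
Implicit Types (v w : seq (A * T)) (f : T -> A) (a b : A) (h g : rk A K).

Definition kmove f : T -> A := fun x => th (f (pti x)).

Definition wmove v : seq (A * T) := [seq (th q.1, pt q.2) | q <- v].

Definition wmovei w : seq (A * T) := [seq (ka_thi u q.1, pti q.2) | q <- w].

Lemma pair_kmove w f : pair w (kmove f) = th (pair (wmovei w) f).
Proof.
rewrite /pair big_map raddf_sum; apply: eq_bigr => p _ /=.
by rewrite rmorphM /= ka_star ka_thK.
Qed.

Lemma pair_wmove v f : pair (wmove v) (kmove f) = th (pair v f).
Proof.
rewrite /pair big_map raddf_sum; apply: eq_bigr => p _ /=.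
by rewrite rmorphM /= ka_star /kmove ka_ptK.
Qed.

Lemma gnorm_wmovei w : gnorm k (wmovei w) <= gnorm k w.
Proof.
rewrite ler_wsqrtr // (_ : gram k _ _ = ka_thi u (gram k w w)).
  exact: rn_morph (@ka_stari _ _ _ u) _.
rewrite /gram /pair big_map raddf_sum; apply: eq_bigr => p _ /=.
rewrite rmorphM /= ka_stari; congr (_ * _); rewrite /ev big_map raddf_sum.
by apply: eq_bigr => q _ /=; rewrite linearZ -[in RHS](ka_ptiK u p.2) -[in RHS](ka_ptiK u q.2) ka_kf.
Qed.

Lemma kmove_bounded f r : 0 <= r -> bounded_by f r -> bounded_by (kmove f) r.
Proof.
move=> r0 hf w; rewrite pair_kmove (le_trans (rn_morph (@ka_star _ _ _ u) _)) //.
by rewrite (le_trans (hf _)) // ler_wpM2l // gnorm_wmovei.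
Qed.

Lemma ev_wmove v x : ev k (wmove v) x = kmove (ev k v) x.
Proof.
rewrite /kmove /ev big_map raddf_sum; apply: eq_bigr => q _ /=.
by rewrite linearZ -{1}(ka_ptiK u x) ka_kf.
Qed.

Fact kmove_approx h : kmove h \in @approx_pred R A K.
Proof.
apply/asboolP => e e0; have [v hv] := rkP h e0; exists (wmove v).
have -> : (fun x => kmove h x - ev k (wmove v) x) = kmove (fun x => h x - ev k v x).
  by apply/funext => x; rewrite ev_wmove /kmove -raddfB.
by apply: kmove_bounded => //; exact: ltW.
Qed.

Definition move h : rk A K := RK (kmove_approx h).

Fact move_linear : linear move.
Proof.
move=> c h g; apply: rk_ext => x; rewrite rkD rkZ /= /kmove.
by rewrite -linearP.
Qed.

HB.instance Definition _ := GRing.isLinear.Build R[i] (rk A K) (rk A K) *:%R move move_linear.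

Lemma move_rkev v : move (rkev v) = rkev (wmove v).
Proof. by apply: rk_ext => x; rewrite /= ev_wmove. Qed.

Lemma rn_move h : rn (move h) <= rn h.
Proof.
apply: rk_rn_le; first exact: rn_ge0.
by apply: kmove_bounded; [exact: rn_ge0 | move=> w; exact: pair_le].
Qed.

Lemma inner_move h g : inner (move h) (move g) = th (inner h g).
Proof.
have [vs hvs] := cvg_approx h.
have lip1 x y : rn (move x - move y) <= 1 * rn (x - y) by rewrite -raddfB mul1r rn_move.
have lip2 x y : rn (th x - th y) <= 1 * rn (x - y).
  by rewrite -raddfB mul1r rn_morph //; exact: ka_star.
apply: (tends_uniq (tends_innerl _ (tends_lip ler01 lip1 hvs))).
apply: tends_ext (tends_lip ler01 lip2 (tends_innerl g hvs)) => n.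
by rewrite move_rkev !inner_rkev pair_wmove.
Qed.

Lemma move_ract h a : move (ract h a) = ract (move h) (th a).
Proof. by apply: rk_ext => x; rewrite /= /kmove rmorphM. Qed.

End Move.

(** Moving is isometric, so its continuity can be tested on the [a (x) k_x]. *)
Lemma move_continuous (R : realType) (A : cstarAlgType R) (K : pdkernel R)
    (Z : topologicalType) (U : Z -> kaut A K) :
  (forall a, continuous (fun z => ka_th (U z) a)) ->
  (forall x, continuous (fun z => kpt (ka_pt (U z) x))) ->
  forall h, continuous (fun z => move (U z) h).
Proof.
move=> cth cpt h; apply/continuous_rnP => z e e0.
have e3 : 0 < e / 3 by rewrite divr_gt0.
have eE : e = e / 3 + (e / 3 + e / 3) by field.
have [v hv] := rk_rkev h e3.
have cv : continuous (fun z => move (U z) (rkev v)).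
  have -> : (fun z => move (U z) (rkev v)) =
      (fun z => \sum_(p <- v) tens (ka_th (U z) p.1) (kpt (ka_pt (U z) p.2))).
    by apply/funext => z'; rewrite move_rkev rkev_sum /wmove big_map.
  apply: continuous_sum => p.
  apply: (@continuous_bil R Z A (rkH K) (rk A K) (@tens R A K) 1) => //.
  - by move=> a b x; rewrite linearBl.
  - by move=> a x y; rewrite linearBr.
  - by move=> a x; rewrite mul1r mulrC rn_tens.
move/continuous_rnP: cv => /(_ z _ e3); apply: filterS => z' hz.
have h1 : rn (move (U z') h - move (U z') (rkev v)) <= e / 3.
  by rewrite -raddfB (le_trans (rn_move _ _)).
have h2 : rn (move (U z) (rkev v) - move (U z) h) <= e / 3.
  by rewrite -raddfB (le_trans (rn_move _ _)) // rnB.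
rewrite [leRHS]eE.
exact: le_trans (rn_tri _ _ _) (lerD h1 (le_trans (rn_tri _ _ _) (lerD hz h2))).
Qed.

Section TrivialModule.
Variables (R : realType) (G : topologicalGroupType) (A : cstarAlgType R).
Variables (alpha : G -> {lrmorphism A -> A}) (K : pdkernel R).
Variable act : G -> pk_pt K -> pk_pt K.
Hypothesis alphaP : strongly_continuous_action alpha.
Hypothesis actM : forall g h x, act (g * h)%g x = act g (act h x).
Hypothesis act1 : forall x, act 1%g x = x.
Hypothesis act_kf : forall g x y, pk_fun (act g x) (act g y) = pk_fun x y.
Hypothesis act_continuous : forall x, continuous (fun g => kpt (act g x)).

Let alphaK g a : alpha g (alpha g^-1%g a) = a.
Proof. by rewrite -(actionM alphaP) mulgV (action1 alphaP). Qed.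

Let actK g x : act g^-1%g (act g x) = x.
Proof. by rewrite -actM mulVg act1. Qed.

Let actKV g x : act g (act g^-1%g x) = x.
Proof. by rewrite -actM mulgV act1. Qed.

Definition act_aut (g : G) : kaut A K :=
  @KAut R A K (alpha g) (alpha g^-1%g) (act g) (act g^-1%g) (alphaK g)
    (action_star alphaP g) (action_star alphaP g^-1%g) (actK g) (actKV g) (act_kf g).

Definition cplx_aut (g : G) : kaut (cplx R) K :=
  @KAut R (cplx R) K idfun idfun (act g) (act g^-1%g) (fun=> erefl)
    (fun=> erefl) (fun=> erefl) (actK g) (actKV g) (act_kf g).

Definition rk_act (g : G) : {linear rk A K -> rk A K} := move (act_aut g).

Definition rk_rep (g : G) : {linear rkH K -> rkH K} := move (cplx_aut g).

Lemma rk_actE g (h : rk A K) x : rk_act g h x = alpha g (h (act g^-1%g x)).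
Proof. by []. Qed.

Lemma rk_rep_unitary : unitary_representation rk_rep.
Proof.
split.
- by move=> g h x; apply: rk_ext => y; rewrite /= /kmove /= /kmove /= invgM actM.
- by move=> x; apply: rk_ext => y; rewrite /= /kmove /= invg1 act1.
- by move=> g x y; exact: (inner_move (cplx_aut g)).
- by move=> x; apply: (@move_continuous R (cplx R) K G cplx_aut) => // a; exact: cst_continuous.
Qed.

Lemma rk_act_module : hilbert_GA_module alpha rk_act.
Proof.
split.
- by move=> g h x; apply: rk_ext => y; rewrite !rk_actE invgM actM (actionM alphaP).
- by move=> x; apply: rk_ext => y; rewrite rk_actE invg1 act1 (action1 alphaP).
- by move=> g x a; exact: (move_ract (act_aut g)).
- by move=> x; apply: (@move_continuous R A K G act_aut) => // a; exact: (action_continuous alphaP).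
- by move=> g x y; exact: (inner_move (act_aut g)).
Qed.

Lemma rk_act_tens g a (x : rkH K) : rk_act g (tens a x) = tens (alpha g a) (rk_rep g x).
Proof. by apply: rk_ext => y; rewrite rk_actE /= linearZ. Qed.

Definition rk_trivial : trivial_module alpha rk_rep :=
  @TrivialModule R G A alpha (rkH K) rk_rep (rk A K) (@tens R A K : {bilinear A -> rkH K -> rk A K})
    (@tens_is_tensor R A K) rk_act rk_act_module rk_act_tens.

End TrivialModule.

(** * Sums of copies of a kernel *)

Section SumKernel.
Variables (R : realType) (J : eqType) (K : pdkernel R).
Notation T := (pk_pt K).
Notation k := (@pk_fun R K).

(** Points over different indices are orthogonal, so that the module of this
   kernel is the direct sum of copies of the module of [K]. *)
Definition sum_fun (p q : J * T) : R[i] := if p.1 == q.1 then k p.2 q.2 else 0.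

Section Components.
Variable A : cstarAlgType R.
Implicit Types (v : seq (A * T)) (w : seq (A * (J * T))) (f : J * T -> A).

Definition comp j w : seq (A * T) := [seq (p.1, p.2.2) | p <- w & p.2.1 == j].

Definition copy j v : seq (A * (J * T)) := [seq (q.1, (j, q.2)) | q <- v].

Definition idx w : seq J := undup [seq p.2.1 | p <- w].

Lemma pair_comp w f : pair w f = \sum_(j <- idx w) pair (comp j w) (fun x => f (j, x)).
Proof.
rewrite /pair; under [RHS]eq_bigr => j _ do rewrite big_map big_filter big_mkcond.
rewrite exchange_big /= [LHS]big_seq [RHS]big_seq; apply: eq_bigr => p pw /=.
have jp : p.2.1 \in idx w by rewrite mem_undup; exact: map_f.
rewrite (bigD1_seq _ jp) ?undup_uniq //= eqxx big1 ?addr0; first by case: p {pw jp} => a [].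
by move=> j; rewrite eq_sym => /negbTE ->.
Qed.

Lemma ev_comp w j x : ev sum_fun w (j, x) = ev k (comp j w) x.
Proof.
rewrite /ev big_map big_filter [RHS]big_mkcond; apply: eq_bigr => p _.
by rewrite /sum_fun /= eq_sym; case: eqP => // _; rewrite scale0r.
Qed.

Lemma gram_comp w : gram sum_fun w w = \sum_(j <- idx w) gram k (comp j w) (comp j w).
Proof.
rewrite /gram pair_comp; apply: eq_bigr => j _; congr pair.
by apply/funext => x; rewrite ev_comp.
Qed.

Lemma gnorm_comp j w : gnorm k (comp j w) <= gnorm sum_fun w.
Proof.
rewrite ler_wsqrtr // gram_comp; have [jw|jw] := boolP (j \in idx w).
  apply: mpos_le_norm; first exact: psd_gram (pk_psd K).
  rewrite (bigD1_seq _ jw) ?undup_uniq //= addrC addrK.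
  by apply: mpos_sum => i _; exact: psd_gram (pk_psd K).
have -> : comp j w = [::].
  rewrite /comp (_ : [seq p <- w | p.2.1 == j] = [::]) //; apply/nilP.
  rewrite /nilp size_filter -leqn0 leqNgt -has_count.
  by apply: contra jw => /hasP[p pw /eqP <-]; rewrite mem_undup; exact: map_f.
by rewrite /gram /pair big_nil rn0 rn_ge0.
Qed.

Lemma ev_copy j v i x : ev sum_fun (copy j v) (i, x) = if i == j then ev k v x else 0.
Proof.
rewrite /ev big_map /sum_fun /=; case: eqP => // _.
by rewrite big1 // => q _; rewrite scale0r.
Qed.

Lemma pair_copy j v f : pair (copy j v) f = pair v (fun x => f (j, x)).
Proof. by rewrite /pair big_map. Qed.

End Components.

Fact sum_psd : psd sum_fun.
Proof.
have [hk _] := pk_psd K; split=> [p q|w].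
  by rewrite /sum_fun eq_sym; case: eqP => // _; rewrite conjC0.
by rewrite gram_comp; apply: mpos_sum => j _; exact: psd_gram (pk_psd K).
Qed.

Definition sumk : pdkernel R := PDKernel sum_psd.

End SumKernel.

Section Iota.
Variables (R : realType) (J : eqType) (K : pdkernel R) (A : cstarAlgType R).
Notation T := (pk_pt K).
Notation k := (@pk_fun R K).
Notation KJ := (sumk J K).
Implicit Types (v : seq (A * T)) (w : seq (A * (J * T))) (h g : rk A K).

Definition iota_fun (j : J) (f : T -> A) : pk_pt KJ -> A :=
  fun p => if p.1 == j then f p.2 else 0.

Lemma pair_iota j w (f : T -> A) : pair (w : seq (A * pk_pt KJ)) (iota_fun j f) = pair (comp j w) f.
Proof.
rewrite /pair big_map big_filter [RHS]big_mkcond; apply: eq_bigr => p _ /=.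
by rewrite /iota_fun; case: eqP => // _; rewrite mulr0.
Qed.

Lemma iota_bounded j (f : T -> A) r : 0 <= r -> bounded_by f r -> bounded_by (iota_fun j f) r.
Proof.
move=> r0 hf w; rewrite pair_iota (le_trans (hf _)) // ler_wpM2l //.
exact: gnorm_comp.
Qed.

Fact iota_approx j h : iota_fun j h \in @approx_pred R A KJ.
Proof.
apply/asboolP => e e0; have [v hv] := rkP h e0; exists (copy j v).
have -> : (fun x => iota_fun j h x - ev (@pk_fun R KJ) (copy j v) x) =
    iota_fun j (fun x => h x - ev k v x).
  apply/funext => -[i x]; rewrite ev_copy /iota_fun /=.
  by case: eqP => // _; rewrite subr0.
by apply: iota_bounded => //; exact: ltW.
Qed.

Definition iota j h : rk A KJ := RK (iota_approx j h).

Fact iota_linear j : linear (iota j).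
Proof.
move=> c h g; apply: rk_ext => p; rewrite rkD rkZ /= /iota_fun.
by case: eqP => // _; rewrite scaler0 addr0.
Qed.

HB.instance Definition _ j := GRing.isLinear.Build R[i] (rk A K) (rk A KJ) *:%R (iota j) (iota_linear j).

Lemma iotaE j h i x : iota j h (i, x) = if i == j then h x else 0.
Proof. by []. Qed.

Lemma inner_iota j i h g : inner (iota j h) (iota i g) = if j == i then inner h g else 0.
Proof.
have [vs hvs] := cvg_approx h.
have lip x y : rn (iota j x - iota j y) <= 1 * rn (x - y).
  rewrite -raddfB mul1r; apply: rk_rn_le; first exact: rn_ge0.
  by apply: iota_bounded; [exact: rn_ge0 | move=> w; exact: pair_le].
apply: (tends_uniq (tends_innerl _ (tends_lip ler01 lip hvs))).
have lim : tends (fun n => if j == i then pair (vs n) g else 0) (if j == i then inner h g else 0).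
  case: eqP => _; last exact: tends_cst.
  by apply: tends_ext (tends_innerl g hvs) => n; rewrite inner_rkev.
apply: tends_ext lim => n.
have -> : iota j (rkev (vs n)) = rkev (copy j (vs n) : seq (A * pk_pt KJ)).
  by apply: rk_ext => -[l x]; rewrite iotaE /= ev_copy.
rewrite inner_rkev pair_copy /= /iota_fun /=; case: eqP => // _.
by rewrite /pair big1 // => p _; rewrite mulr0.
Qed.

Lemma rn_iota j h : rn (iota j h) = rn h.
Proof.
apply/eqP; rewrite -(@eqrXn2 _ 2) ?rn_ge0 // -!rn_inner inner_iota eqxx.
exact: eqxx.
Qed.

End Iota.

(** * Bump functions *)

Section Bump.
Variables (R : realType) (G : topologicalGroupType) (hs : nat -> seq G).
Hypothesis hsP : haar_net R hs.
Hypothesis compG : compact [set: G].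
Hypothesis hausG : hausdorff_space G.

Definition is_bump (U : set G) (f : G -> R) : Prop :=
  [/\ continuous f, forall g, 0 <= f g <= 1, f 1%g = 1, forall g, ~ U g -> f g = 0 &
    forall g h, f (h * g * h^-1)%g = f g].

Lemma conj_continuous2 : continuous (fun p : G * G => (p.2 * p.1 * p.2^-1)%g).
Proof.
have c2 := @snd_continuous G G; apply: continuous_mulg (continuous_invg c2).
by apply: continuous_mulg c2 _; exact: fst_continuous.
Qed.

(** A bump that need not be a class function exists because compact Hausdorff
   spaces are normal; its average over conjugations is a class function, and by
   compactness it can be kept supported in [U]. *)
Lemma bump_exists (U : set G) : open U -> U 1%g -> exists f, is_bump U f.
Proof.
move=> oU U1.
have hU : \forall u \near (1%g : G), forall h, U (h * u * h^-1)%g.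
  have := (compact_near_coveringP [set: G]).1 compG G (nbhs 1%g)
    (fun u h => U (h * u * h^-1)%g) _.
  move=> /(_ _) near1; have {}near1 := near1 _; apply: filterS (near1 _).
    by move=> u hu h; exact: hu.
  move=> h _; have oc : open [set p : G * G | U (p.2 * p.1 * p.2^-1)%g].
    by apply: (@open_comp _ _ (fun p : G * G => (p.2 * p.1 * p.2^-1)%g)) oU => p _; exact: conj_continuous2.
  have : nbhs ((1%g : G), h) [set p : G * G | U (p.2 * p.1 * p.2^-1)%g].
    by apply: open_nbhs_nbhs; split => //=; rewrite mulg1 mulgV.
  move=> [[B C] /= [nB nC] BC]; exists (C, B) => //= -[x u] /= [Cx Bu].
  by exact: (BC (u, x)).
pose V := interior [set u | forall h, U (h * u * h^-1)%g].
have oV : open V by exact: open_interior.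
have V1 : V 1%g by exact: hU.
have VU u : V u -> forall h, U (h * u * h^-1)%g by move=> /interior_subset.
have [|f0 [cf0 f001 f0a f0b]] := (@uniform_separatorP G R [set (1%g : G)] (~` V)).1 _.
  apply: (@normal_completely_regular R).
  - exact: compact_normal hausG compG.
  - exact: hausdorff_accessible.
  - exact: open_closedC.
  - by move=> /(_ V1).
pose b g := 1 - f0 g.
have cb : continuous b by move=> g; apply: cvgB; [exact: cvg_cst | exact: cf0].
have b01 g : 0 <= b g <= 1.
  have /= := f001 (f0 g) (ex_intro2 _ _ g I erefl); rewrite in_itv /= /b => /andP[h1 h2].
  by apply/andP; split; lra.
have b1 : b 1%g = 1.
  by rewrite /b (f0a (f0 1%g)) ?subr0 //; exists 1%g.
have bV g : ~ V g -> b g = 0.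
  by move=> Vg; rewrite /b (f0b (f0 g)) ?subrr //; exists g.
pose F g h := b (h * g * h^-1)%g.
have cF2 : continuous (fun p : G * G => F p.1 p.2).
  exact: continuous_after cb conj_continuous2.
have cF g : continuous (F g).
  apply: (continuous_after cF2 (f := fun h => (g, h))) => h.
  by apply: cvg_pair; [exact: cvg_cst|exact: cvg_id].
have F01 g h : 0 <= F g h <= 1 by exact: b01.
exists (fun g => rmean hs (F g)); split.
- apply/continuous_real/continuous_rnP => g e e0.
  have := compact_uniform compG g ((continuous_real _).1 cF2) e0.
  apply: filterS => g' /= hg'; rewrite rn_realB.
  by apply: (rmean_dist hsP (cF g') (cF g)) => h; rewrite -rn_realB; exact: hg'.
- move=> g; apply/andP; split.
    by apply: (rmean_ge0 hsP (cF g)) => h; have /andP[] := F01 g h.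
  have : rn (mean hs (fun h => (F g h)%:C : cplx R)) <= 1.
    apply: (mean_le hsP) => [|h]; first exact/continuous_real.
    by rewrite rn_real; have /andP[h0 h1] := F01 g h; rewrite ger0_norm.
  rewrite (rmeanE hsP (cF g)) rn_real; exact: le_trans (ler_norm _).
- have -> : F 1%g = fun=> 1 by apply/funext => h; rewrite /F mulg1 mulgV b1.
  by rewrite /rmean mean_cst.
- move=> g Ug; have -> : F g = fun=> 0.
    apply/funext => h; apply: bV => Vh; apply: Ug.
    by have := VU _ Vh h^-1%g; rewrite invgK !mulgA mulVg mul1g -mulgA mulVg mulg1.
  by rewrite /rmean mean_cst.
- move=> g h; rewrite -[RHS](rmean_right hsP h (cF g)).
  have -> // : F (h * g * h^-1)%g = fun t => F g (t * h)%g.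
  by apply/funext => t; rewrite /F invgM !mulgA.
Qed.

End Bump.

(** * The invariant state and the smoothed vectors *)

Section MeanSum.
Variables (R : realType) (G : topologicalGroupType) (hs : nat -> seq G).
Hypothesis hsP : haar_net R hs.

Lemma mean_sum (X : completeNormedModType R[i]) I (s : seq I) (F : I -> G -> X) :
  (forall i, continuous (F i)) ->
  mean hs (fun g => \sum_(i <- s) F i g) = \sum_(i <- s) mean hs (F i).
Proof.
move=> cF; elim: s => [|i s IH].
  by rewrite big_nil; under eq_fun do rewrite big_nil; rewrite (mean_cst hsP).
rewrite big_cons -IH; under eq_fun do rewrite big_cons.
by rewrite (meanD hsP (cF i) (continuous_sum (s := s) cF)).
Qed.

(** The difference is the mean of the square of [v - mean v]. *)
Lemma mean_jensen (A : cstarAlgType R) (E : hilbertModType A) (v : G -> E) : continuous v ->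
  mpos (mean hs (fun g => inner (v g) (v g)) - inner (mean hs v) (mean hs v)).
Proof.
move=> cv; set m := mean hs v.
have cm : continuous (fun _ : G => m) by move=> g; exact: cvg_cst.
have cvv := continuous_inner cv cv; have cvm := continuous_inner cv cm.
have cmv := continuous_inner cm cv.
have e1 : mean hs (fun g => inner m (v g)) = inner m m.
  apply: (@mean_morph R G hs hsP E A (inner m) (rn m)) => //; first exact: rn_ge0.
  - by move=> x y; rewrite innerDr.
  - by move=> c x; rewrite innerZr.
  - by move=> x; exact: inner_le.
have e2 : mean hs (fun g => inner (v g) m) = inner m m.
  apply: (@mean_morph R G hs hsP E A (fun x => inner x m) (rn m)) => //; first exact: rn_ge0.
  - by move=> x y; rewrite innerDl.
  - by move=> c x; rewrite innerZl conjC_real.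
  - by move=> x; rewrite mulrC; exact: inner_le.
have cd : continuous (fun g => inner (v g - m) (v g - m)).
  by apply: continuous_inner => g; apply: cvgB; [exact: cv | exact: cvg_cst | exact: cv | exact: cvg_cst].
have := mean_mpos hsP cd (fun g => mpos_inner _); congr mpos.
have -> : (fun g => inner (v g - m) (v g - m)) =
    (fun g => (inner (v g) (v g) - inner (v g) m) - (inner m (v g) - inner m m)).
  by apply/funext => g; rewrite innerBl !innerBr.
have c1 : continuous (fun g => inner (v g) (v g) - inner (v g) m).
  by move=> g; apply: cvgB; [exact: cvv | exact: cvm].
have cc : continuous (fun _ : G => inner m m) by move=> g; exact: cvg_cst.
have c2 : continuous (fun g => inner m (v g) - inner m m).
  by move=> g; apply: cvgB; [exact: cmv | exact: cc].
rewrite (meanB hsP c1 c2) (meanB hsP cvv cvm) (meanB hsP cmv cc) (mean_cst hsP) e1 e2.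
by rewrite subrr subr0.
Qed.

End MeanSum.

Section State.
Variables (R : realType) (G : topologicalGroupType) (hs : nat -> seq G).
Hypothesis hsP : haar_net R hs.
Variables (A : cstarAlgType R) (alpha : G -> {lrmorphism A -> A}).
Hypothesis alphaP : strongly_continuous_action alpha.
Hypothesis erg : ergodic alpha.

Let calpha a : continuous (fun g => alpha g a).
Proof. exact: action_continuous alphaP a. Qed.

Lemma rn_alpha g a : rn (alpha g a) <= rn a.
Proof. exact: rn_morph (action_star alphaP g) a. Qed.

Lemma mean_alpha_scalar a : exists c : R[i], mean hs (fun g => alpha g a) = c%:A.
Proof.
apply: (erg _).1 => h.
rewrite -(@mean_morph R G hs hsP A A (alpha h) 1 (fun g => alpha g a)) //.
- have -> : (fun g => alpha h (alpha g a)) = (fun g => alpha (h * g)%g a).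
    by apply/funext => g; rewrite (actionM alphaP).
  exact: (mean_left hsP h (@calpha a)).
- by move=> x y; rewrite raddfD.
- by move=> c x; rewrite linearZ.
- by move=> x; rewrite mul1r rn_alpha.
Qed.

Lemma scalarA_inj (c d : R[i]) : c%:A = d%:A :> A -> c = d.
Proof.
move=> /eqP; rewrite -subr_eq0 -scalerBl scaler_eq0 subr_eq0.
by rewrite (negbTE (oner_neq0 A)) orbF => /eqP.
Qed.

(** The invariant state: by ergodicity the average of an orbit is a scalar. *)
Definition phi a : R[i] := xget 0 [set c | mean hs (fun g => alpha g a) = c%:A].

Lemma phiE a : mean hs (fun g => alpha g a) = (phi a)%:A.
Proof. exact: xgetPex (mean_alpha_scalar a). Qed.

Lemma phiD a b : phi (a + b) = phi a + phi b.
Proof.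
apply: scalarA_inj; rewrite scalerDl -!phiE -(meanD hsP (@calpha a) (@calpha b)).
by congr mean; apply/funext => g; rewrite raddfD.
Qed.

Lemma phi0 : phi 0 = 0.
Proof.
apply: scalarA_inj; rewrite -phiE scale0r.
by under eq_fun do rewrite raddf0; rewrite (mean_cst hsP).
Qed.

Lemma phiZ (c : R[i]) a : phi (c *: a) = c * phi a.
Proof.
apply: scalarA_inj; rewrite -scalerA -!phiE.
have c0 := Re_norm_ge0 c.
rewrite -(@mean_morph R G hs hsP A A (fun x => c *: x) (complex.Re `|c|) _ c0) //.
- by congr mean; apply/funext => g; rewrite linearZ.
- by move=> x y; rewrite scalerDr.
- by move=> d x; rewrite !scalerA mulrC.
- by move=> x; rewrite rn_complex.
Qed.

Lemma phi_star a : phi (star a) = Num.conj (phi a).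
Proof.
apply: scalarA_inj; rewrite -[in RHS]star1 -starZ -!phiE.
rewrite -(@mean_morph R G hs hsP A A star 1) //.
- by congr mean; apply/funext => g; rewrite (action_star alphaP).
- exact: starD.
- exact: starZr.
- by move=> x; rewrite mul1r rn_star.
Qed.

Lemma phi_alpha g a : phi (alpha g a) = phi a.
Proof.
apply: scalarA_inj; rewrite -!phiE.
have -> : (fun h => alpha h (alpha g a)) = (fun h => alpha (h * g)%g a).
  by apply/funext => h; rewrite (actionM alphaP).
exact: (mean_right hsP g (@calpha a)).
Qed.

Lemma phi_ge0 a : mpos a -> 0 <= phi a.
Proof.
move=> pa; have pm : mpos ((phi a)%:A : A).
  by rewrite -phiE; apply: (mean_mpos hsP) => // g; exact: mpos_morph (action_star alphaP g) _ pa.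
have cr : Num.conj (phi a) = phi a.
  by apply: scalarA_inj; rewrite -[in LHS]star1 -starZ (mpos_sa pm).
have [r rE] : exists r : R, phi a = r%:C.
  exists (complex.Re (phi a)); move/eqP: cr.
  case: (phi a) => x y; rewrite eq_complex /= => /andP[_ /eqP yy].
  by congr Complex; lra.
rewrite rE lecR leNgt; apply/negP => r0; have : mpos (- ((phi a)%:A) : A).
  by rewrite rE -scaleNr -rmorphN; apply: mpos_scalar; rewrite oppr_ge0 ltW.
move=> /(mpos_anti pm)/eqP; rewrite scaler_eq0 (negbTE (oner_neq0 A)) orbF rE.
by move/eqP => [] r00; rewrite r00 ltxx in r0.
Qed.

Lemma phi_le a : complex.Re `|phi a| <= rn a.
Proof.
have : rn ((phi a)%:A : A) <= rn a.
  by rewrite -phiE; apply: (mean_le hsP) => // g; exact: rn_alpha.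
by rewrite rn_complex rn1 mulr1.
Qed.

Lemma phi_re a : mpos a -> phi a = (complex.Re (phi a))%:C /\ 0 <= complex.Re (phi a) <= rn a.
Proof.
move=> /phi_ge0; have := phi_le a; rewrite normc_def.
case: (phi a) => x y /=; rewrite lecE /= => xr /andP[/eqP -> x0].
split => //; rewrite x0 /=; apply: le_trans xr.
by rewrite -{1}(ger0_norm x0) -sqrtr_sqr ler_wsqrtr // lerDl sqr_ge0.
Qed.

Section Module.
Variables (E : hilbertModType A) (beta : G -> {linear E -> E}).
Hypothesis betaP : hilbert_GA_module alpha beta.

Let cbeta x : continuous (fun g => beta g x).
Proof. exact: gam_continuous betaP x. Qed.

Lemma rn_beta g x : rn (beta g x) <= rn x.
Proof. by rewrite -ler_sqr ?nnegrE ?rn_ge0 // -!rn_inner (gam_inner betaP) rn_alpha. Qed.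

Definition phi_form (x y : E) : R[i] := phi (inner x y).

Fact phi_form_psd : psd phi_form.
Proof.
split=> [x y|w]; first by rewrite /phi_form inner_star phi_star.
pose X := \sum_(p <- w) (p.1 : R[i]) *: p.2.
have phi_sumr z : phi (inner z X) = \sum_(p <- w) phi_form z p.2 * (p.1 : R[i]).
  rewrite /X inner_sumr (big_morph phi phiD phi0); apply: eq_bigr => p _.
  by rewrite innerZr phiZ mulrC.
apply/mpos_cplx; have := phi_ge0 (mpos_inner X); congr (_ <= _).
rewrite {1}/X inner_suml (big_morph phi phiD phi0) /gram /pair; apply: eq_bigr => p _.
by rewrite innerZl phiZ phi_sumr /ev cplxM cplx_star.
Qed.

Definition K0 : pdkernel R := @PDKernel R E phi_form phi_form_psd.

Notation k0 := phi_form.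
Implicit Types (w v : seq (A * E)) (f : G -> R) (x y z : E).

Definition orb w g : E := \sum_(p <- w) ract (beta g p.2) p.1.

Lemma orb_continuous w : continuous (orb w).
Proof.
apply: continuous_sum => p; apply: (@continuous_lip R G E E (fun x => ract x p.1) (rn p.1)) => //.
  exact: rn_ge0.
by move=> x y; rewrite -ractBl mulrC rn_ract.
Qed.

Lemma gram_orb w v : gram k0 w v = mean hs (fun g => inner (orb w g) (orb v g)).
Proof.
have -> : (fun g => inner (orb w g) (orb v g)) =
   (fun g => \sum_(p <- w) \sum_(q <- v) star p.1 * alpha g (inner p.2 q.2) * q.1).
  apply/funext => g; rewrite /orb inner_suml; apply: eq_bigr => p _.
  rewrite inner_sumr; apply: eq_bigr => q _.
  by rewrite inner_ract inner_ractl (gam_inner betaP).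
have lip (a b : A) (z z' : A) : rn (star a * z * b - star a * z' * b) <= rn a * rn b * rn (z - z').
  rewrite -mulrBl -mulrBr (le_trans (rnM _ _)) // mulrAC ler_wpM2r ?rn_ge0 //.
  by rewrite (le_trans (rnM _ _)) // rn_star.
have c1 (p q : A * E) : continuous (fun g => star p.1 * alpha g (inner p.2 q.2) * q.1 : A).
  by apply: continuous_lip (lip p.1 q.1) (@calpha _); rewrite mulr_ge0 ?rn_ge0.
have c2 p : continuous (fun g => \sum_(q <- v) (star p.1 * alpha g (inner p.2 q.2) * q.1 : A)).
  exact: continuous_sum.
rewrite (mean_sum hsP w c2); apply: eq_bigr => p _.
rewrite (mean_sum hsP v (c1 p)) /ev mulr_sumr; apply: eq_bigr => q _.
rewrite (@mean_morph R G hs hsP A A (fun z : A => star p.1 * z * q.1) (rn p.1 * rn q.1)) //.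
- by rewrite phiE -[in RHS]scalerAr mulr1 -scalerAl -scalerAr.
- by rewrite mulr_ge0 ?rn_ge0.
- by move=> z z'; rewrite mulrDr mulrDl.
- by move=> c z; rewrite -scalerAr -scalerAl.
- by move=> z; have := lip p.1 q.1 z 0; rewrite mulr0 mul0r !subr0.
Qed.

Definition smear f x : E := mean hs (fun g => (f g)%:C *: beta g x).

Definition smooth f w : E := \sum_(p <- w) ract (smear f p.2) p.1.

Lemma smooth_mean f w : continuous f -> smooth f w = mean hs (fun g => (f g)%:C *: orb w g).
Proof.
move=> cf; have c1 x : continuous (fun g => (f g)%:C *: beta g x) by exact: continuous_scale.
have -> : (fun g => (f g)%:C *: orb w g) =
    (fun g => \sum_(p <- w) ract ((f g)%:C *: beta g p.2) p.1).
  by apply/funext => g; rewrite /orb scaler_sumr; apply: eq_bigr => p _; rewrite ractZl.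
have lip (a : A) (x y : E) : rn (ract x a - ract y a) <= rn a * rn (x - y).
  by rewrite -ractBl mulrC rn_ract.
have c2 p : continuous (fun g => ract ((f g)%:C *: beta g p.2) p.1 : E).
  exact: continuous_lip (rn_ge0 _) (lip p.1) (c1 p.2).
rewrite (mean_sum hsP w c2); apply: eq_bigr => p _.
rewrite (@mean_morph R G hs hsP E E (fun x => ract x p.1) (rn p.1)) //.
- exact: rn_ge0.
- by move=> x y; rewrite ractDl.
- by move=> c x; rewrite ractZl.
- by move=> x; rewrite mulrC rn_ract.
Qed.

(** The square of a mean is at most the mean of the squares, and by ergodicity
   the mean of [inner (orb w g) (orb w g)] is the Gram matrix of the scalar form
   [phi (inner x y)]. So the smoothing by [f] is bounded from the norm of the
   state to the norm of the module, even with coefficients in [A]. *)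
Lemma smooth_bound f (B : R) w : continuous f -> (forall g, `|f g| <= B) ->
  rn (smooth f w) <= B * gnorm k0 w.
Proof.
move=> cf fB; have B0 : 0 <= B := le_trans (normr_ge0 _) (fB 1%g).
have cu := @orb_continuous w; have cv : continuous (fun g => (f g)%:C *: orb w g).
  exact: continuous_scale.
rewrite -ler_sqr ?nnegrE ?mulr_ge0 ?rn_ge0 ?gnorm_ge0 // exprMn gnorm_sqr -rn_inner.
rewrite -rnZ_ge0 ?sqr_ge0 //; apply: mpos_le_norm; first exact: mpos_inner.
have := mean_jensen hsP cv; rewrite -smooth_mean //.
have cuu := continuous_inner cu cu; have cvv := continuous_inner cv cv.
have cB : continuous (fun g => (B ^+ 2)%:C *: inner (orb w g) (orb w g)).
  by apply: (continuous_scale _ cuu) => g; exact: cvg_cst.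
have lem : mpos (mean hs (fun g => (B ^+ 2)%:C *: inner (orb w g) (orb w g) -
     inner ((f g)%:C *: orb w g) ((f g)%:C *: orb w g))).
  apply: (mean_mpos hsP) => [g|g]; first by apply: cvgB; [exact: cB | exact: cvv].
  rewrite innerZr innerZl conjC_real scalerA -rmorphM -scalerBl -rmorphB.
  apply: mposZ; last exact: mpos_inner.
  by rewrite subr_ge0 -expr2 -real_normK ?num_real // ler_sqr ?nnegrE.
move=> /(mposD lem); rewrite (meanB hsP cB cvv) subrKA; congr mpos; congr (_ - _).
rewrite gram_orb (@mean_morph R G hs hsP A A (fun z : A => (B ^+ 2)%:C *: z) (B ^+ 2)) //.
- exact: sqr_ge0.
- by move=> x y; rewrite scalerDr.
- by move=> c x; rewrite !scalerA mulrC.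
- by move=> x; rewrite rnZ_ge0 ?sqr_ge0.
Qed.

Lemma beta_smear h f x : continuous f -> beta h (smear f x) = smear (fun g => f (h^-1 * g)%g) x.
Proof.
move=> cf; have c1 : continuous (fun g => (f g)%:C *: beta g x) by exact: continuous_scale.
have c2 : continuous (fun g => (f (h^-1 * g)%g)%:C *: beta g x).
  by apply: continuous_scale => //; exact: continuous_after cf (@mulgl_continuous _ _).
rewrite /smear -(mean_left hsP h c2) -(@mean_morph R G hs hsP E E (beta h) 1) //.
- congr mean; apply/funext => g; rewrite linearZ /= mulKg (gam_mul betaP) //.
- by move=> y z; rewrite raddfD.
- by move=> c y; rewrite linearZ.
- by move=> y; rewrite mul1r rn_beta.
Qed.

Lemma smear_beta h f x : continuous f -> (forall g t, f (t * g * t^-1)%g = f g) ->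
  smear f (beta h x) = beta h (smear f x).
Proof.
move=> cf fclass; rewrite beta_smear // /smear.
have c2 : continuous (fun g => (f (h^-1 * g)%g)%:C *: beta g x).
  by apply: continuous_scale => //; exact: continuous_after cf (@mulgl_continuous _ _).
rewrite -(mean_right hsP h c2); congr mean; apply/funext => g.
rewrite (gam_mul betaP) -(fclass (h^-1 * (g * h))%g h) !mulgA mulgV mul1g -mulgA mulgV mulg1 //.
Qed.

Lemma smearB f f' x : continuous f -> continuous f' ->
  smear (fun g => f g - f' g) x = smear f x - smear f' x.
Proof.
move=> cf cf'; rewrite /smear -(meanB hsP); try exact: continuous_scale.
by congr mean; apply/funext => g; rewrite rmorphB scalerBl.
Qed.

End Module.
End State.

(** * Orthonormal families *)

Section Orthonormal.
Variables (R : realType) (E : lmodType R[i]) (k : E -> E -> R[i]).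
Hypothesis pk : psd k.
Hypothesis kD : forall z x y, k z (x + y) = k z x + k z y.
Hypothesis kZ : forall (c : R[i]) z x, k z (c *: x) = c * k z x.
Implicit Types (d e : seq E) (x y z : E).

Fixpoint orthon d : Prop :=
  if d is x :: d' then [/\ k x x = 1, forall y, y \in d' -> k x y = 0 & orthon d'] else True.

Lemma kC x y : k x y = 0 -> k y x = 0.
Proof. by move=> h; rewrite pk.1 h conjC0. Qed.

Lemma k_sum z I (s : seq I) (F : I -> E) : k z (\sum_(i <- s) F i) = \sum_(i <- s) k z (F i).
Proof.
have k0 : k z 0 = 0 by rewrite -(scale0r 0) kZ mul0r.
exact: (big_morph (k z) (kD z) k0).
Qed.

Lemma orthon_sum (V : lmodType R[i]) (c : E -> V) d x : orthon d -> x \in d ->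
  \sum_(y <- d) k x y *: c y = c x.
Proof.
elim: d => // y d IH [yy yd od]; rewrite inE big_cons => /orP[/eqP ->|xd].
  rewrite yy scale1r big_seq big1 ?addr0 // => z zd.
  by rewrite yd // scale0r.
by rewrite kC ?yd // scale0r add0r IH.
Qed.

Lemma orthon_catl d e : orthon (d ++ e) -> orthon d.
Proof.
elim: d => //= x d IH [xx xd /IH od]; split=> // y yd.
by apply: xd; rewrite mem_cat yd.
Qed.

(** [y] lies in the span of [e], up to vectors of norm zero. *)
Definition inspan e y := forall z, k z y = \sum_(x <- e) k z x * k x y.

Lemma inspan_cat d e y : orthon (d ++ e) -> inspan e y -> inspan (d ++ e) y.
Proof.
elim: d => //= x d IH [xx xd od] ye z; rewrite big_cons -IH //.
have -> : k x y = 0; last by rewrite mulr0 add0r.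
rewrite ye big_seq big1 // => x' x'e; rewrite xd ?mul0r //.
by rewrite mem_cat x'e orbT.
Qed.

Lemma gram_schmidt1 e y : orthon e -> exists d, orthon (d ++ e) /\ inspan (d ++ e) y.
Proof.
move=> oe; pose r := y - \sum_(x <- e) k x y *: x.
have kr z : k z r = k z y - \sum_(x <- e) k z x * k x y.
  rewrite /r kD -scaleN1r kZ mulN1r k_sum; congr (_ - _).
  by apply: eq_bigr => x _; rewrite kZ mulrC.
have er x : x \in e -> k x r = 0.
  by move=> xe; rewrite kr (orthon_sum (V := R[i]^o) (k^~ y) oe xe) subrr.
have [r0|r0] := eqVneq (k r r) 0.
  exists [::]; split=> // z; apply/eqP; rewrite -subr_eq0 -kr; apply/eqP.
  exact: kC (psd_null z pk r0).
have rp := psd_diag r pk; pose s := complex.Re (k r r).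
have rE : k r r = s%:C := ge0_ReE rp.
have s0 : 0 < s.
  rewrite lt_neqAle; apply/andP; split; last by move: rp; rewrite rE lecR.
  by apply: contraNneq r0 => s0; rewrite rE -s0.
pose q := Num.sqrt s; have q0 : 0 < q by rewrite sqrtr_gt0.
have qq : q * q = s by rewrite -expr2 sqr_sqrtr // ltW.
pose r' := q^-1%:C *: r.
have kr' z : k z r' = q^-1%:C * k z r by rewrite kZ.
have k'r z : k r' z = q^-1%:C * k r z by rewrite pk.1 kr' rmorphM /= conjC_real -pk.1.
have r'r : k r' r = q%:C.
  by rewrite k'r rE -rmorphM -qq mulrA mulVf ?mul1r // gt_eqF.
have r'e x : x \in e -> k r' x = 0 by move=> xe; rewrite k'r kC ?mulr0 // er.
exists [:: r']; split.
  split=> //; by rewrite kr' r'r -rmorphM mulVf ?gt_eqF.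
move=> z; rewrite big_cons; have -> : k r' y = q%:C.
  rewrite -r'r kr big_seq big1 ?subr0 // => x xe.
  by rewrite r'e // mul0r.
by rewrite kr' mulrAC -rmorphM mulVf ?gt_eqF // mul1r kr subrK.
Qed.

Lemma gram_schmidt (ys : seq E) e : orthon e ->
  exists d, orthon (d ++ e) /\ forall y, y \in ys -> inspan (d ++ e) y.
Proof.
elim: ys e => [|y ys IH] e oe; first by exists [::].
have [d [od yd]] := gram_schmidt1 y oe; have [d' [od' ysd]] := IH _ od.
exists (d' ++ d); rewrite -catA; split=> // x; rewrite inE => /orP[/eqP ->|/ysd //].
exact: inspan_cat.
Qed.

Section Columns.
Variable A : cstarAlgType R.
Implicit Types (c : E -> A).

Definition col c d : seq (A * E) := [seq (c x, x) | x <- d].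

Lemma ev_col c d x : ev k (col c d) x = \sum_(y <- d) k x y *: c y.
Proof. by rewrite /ev big_map. Qed.

Lemma pair_col_list c d (f : E -> A) : pair (col c d) f = \sum_(x <- d) star (c x) * f x.
Proof. by rewrite /pair big_map. Qed.

Lemma gram_col c c' d : orthon d ->
  gram k (col c d) (col c' d) = \sum_(x <- d) star (c x) * c' x.
Proof.
move=> od; rewrite /gram pair_col_list big_seq [RHS]big_seq; apply: eq_bigr => x xd.
by rewrite ev_col orthon_sum.
Qed.

Lemma ev_respan e (w : seq (A * E)) x : (forall p, p \in w -> inspan e p.2) ->
  ev k w x = ev k (col (ev k w) e) x.
Proof.
move=> we; rewrite ev_col /ev; under [RHS]eq_bigr => y _ do rewrite scaler_sumr.
rewrite exchange_big big_seq [RHS]big_seq; apply: eq_bigr => p pw.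
by rewrite we // scaler_suml; apply: eq_bigr => y _; rewrite scalerA.
Qed.

End Columns.
End Orthonormal.

(** * Smoothed vectors in the tensor product *)

Lemma rmean_mulr (R : realType) (G : topologicalGroupType) (hs : nat -> seq G) (u : G -> R) (c : R) :
  haar_net R hs -> continuous u -> rmean hs (fun g => u g * c) = rmean hs u * c.
Proof.
move=> hsP cu; have := mean_scale hsP (c%:C : cplx R) cu.
have -> : (fun g => (u g)%:C *: (c%:C : cplx R)) = (fun g => (u g * c)%:C : cplx R).
  by apply/funext => g; rewrite cplxZ -rmorphM.
by rewrite /rmean => ->; rewrite cplxZ -rmorphM.
Qed.

Section SmoothVector.
Variables (R : realType) (G : topologicalGroupType) (hs : nat -> seq G).
Hypothesis hsP : haar_net R hs.
Hypothesis compG : compact [set: G].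
Hypothesis hausG : hausdorff_space G.
Variables (A : cstarAlgType R) (alpha : G -> {lrmorphism A -> A}).
Hypothesis alphaP : strongly_continuous_action alpha.
Hypothesis erg : ergodic alpha.
Variables (E : hilbertModType A) (beta : G -> {linear E -> E}).
Hypothesis betaP : hilbert_GA_module alpha beta.

Notation k0 := (@phi_form R G hs A alpha E).
Notation K := (K0 hsP alphaP erg E).
Notation Phi := (phi hs alpha).
Notation B := (smear hs beta).
Implicit Types (w v : seq (A * E)) (f : G -> R) (x y z xi : E) (d e : seq E).

Let pk : psd k0 := phi_form_psd hsP alphaP erg E.

Let kD z x y : k0 z (x + y) = k0 z x + k0 z y.
Proof. by rewrite /phi_form innerDr (phiD hsP alphaP erg). Qed.

Let kZ (c : R[i]) z x : k0 z (c *: x) = c * k0 z x.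
Proof. by rewrite /phi_form innerZr (phiZ hsP alphaP erg). Qed.

(** As an [A]-valued function of [x], this is the functional to be represented by
   a vector of the tensor product; [proj] is its projection onto the span of the
   orthonormal family [d], and [mass] the square of that projection. *)
Definition coef f xi : E -> A := fun x => inner (B f x) xi.

Definition proj f xi d : rk A K := rkev (col (coef f xi) d : seq (A * pk_pt K)).

Definition mass f xi d : A := \sum_(x <- d) star (coef f xi x) * coef f xi x.

Lemma pair_coef f xi w : pair w (coef f xi) = inner (smooth hs beta f w) xi.
Proof.
rewrite /smooth inner_suml; apply: eq_bigr => p _.
by rewrite inner_ractl.
Qed.

Lemma inner_proj f xi d : orthon k0 d -> inner (proj f xi d) (proj f xi d) = mass f xi d.
Proof.
move=> od; rewrite /proj inner_rkev.
exact: (gram_col pk (coef f xi) (coef f xi) od).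
Qed.

Lemma mass_mpos f xi d : mpos (mass f xi d).
Proof. by apply: mpos_sum => x _; exact: mpos_starM. Qed.

Lemma rn_proj f (C : R) xi d : orthon k0 d -> continuous f -> (forall g, `|f g| <= C) ->
  rn (proj f xi d) <= C * rn xi.
Proof.
move=> od cf fC; have C0 : 0 <= C := le_trans (normr_ge0 _) (fC 1%g).
have [p0|p0] := eqVneq (rn (proj f xi d)) 0.
  by rewrite p0 mulr_ge0 ?rn_ge0.
have pp : 0 < rn (proj f xi d) by rewrite lt_neqAle eq_sym p0 rn_ge0.
rewrite -(ler_pM2l pp) -expr2 -rn_inner inner_proj //.
have -> : mass f xi d = inner (smooth hs beta f (col (coef f xi) d)) xi.
  by rewrite -pair_coef pair_col_list.
rewrite (le_trans (inner_le _ _)) // mulrA ler_wpM2r ?rn_ge0 // mulrC.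
rewrite /proj rn_rkev; exact: (smooth_bound hsP alphaP erg betaP).
Qed.

Lemma rn_mass f xi d : orthon k0 d -> rn (mass f xi d) = rn (proj f xi d) ^+ 2.
Proof. by move=> od; rewrite -inner_proj // rn_inner. Qed.

Lemma projB f f' xi xi' d : continuous f -> continuous f' ->
  proj f' xi' d - proj f xi d = proj f' (xi' - xi) d + proj (fun g => f' g - f g) xi d.
Proof.
move=> cf cf'; apply: rk_ext => x; rewrite rkB rkD /= !ev_col -sumrB -big_split /=.
apply: eq_bigr => y _; rewrite -scalerBr -scalerDr; congr (_ *: _).
rewrite /coef (smearB hsP betaP) // innerBr innerBl addrACA.
by rewrite [RHS]addrA addrK.
Qed.

Lemma alpha_mass h f xi d : continuous f ->
  alpha h (mass f xi d) = mass (fun g => f (h^-1 * g)%g) (beta h xi) d.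
Proof.
move=> cf; rewrite /mass raddf_sum; apply: eq_bigr => x _ /=.
rewrite rmorphM /= (action_star alphaP) /coef -(beta_smear hsP alphaP betaP) //.
by rewrite -(gam_inner betaP).
Qed.

(** The automorphism [alpha h] replaces [f] and [xi] by their translates; as
   [proj] depends linearly on both and is bounded independently of [d], the
   masses move little, uniformly in [d]. *)
Lemma mass_equicontinuous f xi (e : R) : continuous f -> (forall g, `|f g| <= 1) -> 0 < e ->
  \forall h \near (1%g : G), forall d, orthon k0 d ->
    rn (alpha h (mass f xi d) - mass f xi d) <= e.
Proof.
move=> cf f1 e0; pose C := rn xi + 1.
have C0 : 0 < C by rewrite ltr_wpDl ?rn_ge0.
have xiC : rn xi <= C by rewrite lerDl.
pose t := e / (2 * C ^+ 2).
have t0 : 0 < t by rewrite divr_gt0 // mulr_gt0 // exprn_gt0.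
have cF : continuous (fun p : G * G => (f (p.1^-1 * p.2)%g)%:C : cplx R).
  apply: (continuous_after ((continuous_real f).1 cf) (f := fun p : G * G => (p.1^-1 * p.2)%g)).
  by apply: continuous_mulg; [exact/continuous_invg/fst_continuous | exact: snd_continuous].
have nf := compact_uniform compG 1%g cF t0.
have nb := (continuous_rnP _).1 (@gam_continuous _ _ _ _ _ _ betaP xi) 1%g t t0.
apply: filterS2 nf nb => h /= hf hb d od.
pose f' g := f (h^-1 * g)%g.
have cf' : continuous f'.
  exact: continuous_after cf (@mulgl_continuous _ _).
have cff : continuous (fun g => f' g - f g) by move=> g; apply: cvgB; [exact: cf'|exact: cf].
have fft g : `|f' g - f g| <= t.
  by have := hf g; rewrite invg1 mul1g rn_realB.
have bx : rn (beta h xi - xi) <= t by move: hb; rewrite (gam_one betaP).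
set P := proj f xi d; set P' := proj f' (beta h xi) d.
have PP : rn (P' - P) <= t * C.
  rewrite projB // (le_trans (rnD _ _)) // /C mulrDr mulr1 addrC lerD //.
    exact: rn_proj.
  by rewrite (le_trans (rn_proj _ od cf' (C := 1) _)) ?mul1r // => g; exact: f1.
have PC : rn P <= C by rewrite (le_trans (rn_proj _ od cf f1)) // mul1r.
have P'C : rn P' <= C.
  rewrite (le_trans (rn_proj _ od cf' (C := 1) _)) ?mul1r //; first by move=> g; exact: f1.
  exact: le_trans (rn_beta alphaP betaP _ _) xiC.
rewrite (alpha_mass h xi d cf) -!inner_proj // -/P -/P'.
have -> : inner P' P' - inner P P = inner (P' - P) P' + inner P (P' - P).
  by rewrite innerBl innerBr addrA subrK.
rewrite (le_trans (rnD _ _)) // (le_trans (lerD (inner_le _ _) (inner_le _ _))) //.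
have te : t * (2 * C ^+ 2) = e by rewrite divfK // gt_eqF // mulr_gt0 // exprn_gt0.
have h1 := ler_pM (rn_ge0 _) (rn_ge0 _) PP P'C.
have h2 := ler_pM (rn_ge0 _) (rn_ge0 _) PC PP.
rewrite (le_trans (lerD h1 h2)) // -te expr2 [C * (t * C)]mulrCA -[t * C * C]mulrA -mulrDr.
by rewrite -[C * C + C * C]mulr2n mulr_natl.
Qed.

(** Averaging against a bump on which the masses hardly move bounds their norm
   by their state: on positive elements the average against the bump is at most
   the average against [1], which is the state. *)
Lemma mass_small f xi (e : R) : continuous f -> (forall g, `|f g| <= 1) -> 0 < e ->
  exists2 t : R, 0 < t & forall d, orthon k0 d ->
    complex.Re (Phi (mass f xi d)) <= t -> rn (mass f xi d) <= e.
Proof.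
move=> cf f1 e0; have e2 : 0 < e / 2 by rewrite divr_gt0.
have near1 := mass_equicontinuous xi cf f1 e2.
set Q := [set h | forall d, orthon k0 d -> rn (alpha h (mass f xi d) - mass f xi d) <= e / 2].
have [u [cu u01 u1 uQ _]] : exists u : G -> R, is_bump (interior Q) u.
  by apply: (bump_exists hsP compG hausG); [exact: open_interior | exact: near1].
have u0 g : 0 <= u g by have /andP[] := u01 g.
pose c := rmean hs u; have c0 : 0 < c.
  by apply: (rmean_gt0 hsP compG cu u0); rewrite u1.
exists (c * (e / 2)); first by rewrite mulr_gt0.
move=> d od hm; set Y := mass f xi d in hm *.
have pY : mpos Y := mass_mpos f xi d.
have ca := @action_continuous _ _ _ _ alphaP Y.
have cua : continuous (fun h => (u h)%:C *: alpha h Y) by exact: continuous_scale.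
have cuY : continuous (fun h => (u h)%:C *: Y).
  by apply: (continuous_scale cu) => g; exact: cvg_cst.
have h1 : rn (mean hs (fun h => (u h)%:C *: alpha h Y)) <= c * (e / 2).
  have [re _] := phi_re hsP alphaP erg pY.
  apply: le_trans hm; have [_ /andP[p0 _]] := phi_re hsP alphaP erg pY.
  rewrite -[leRHS](rnA A p0) -re -(phiE hsP alphaP erg).
  apply: mpos_le_norm.
    by apply: (mean_mpos hsP cua) => g; apply: mposZ => //; exact: mpos_morph (action_star alphaP g) _ pY.
  rewrite -(meanB hsP ca cua); apply: (mean_mpos hsP) => [g|g].
    by apply: cvgB; [exact: ca | exact: cua].
  rewrite -{1}[alpha g Y]scale1r -[1]/(1%:C) -scalerBl -rmorphB; apply: mposZ.
    by rewrite subr_ge0; have /andP[] := u01 g.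
  exact: mpos_morph (action_star alphaP g) _ pY.
have h2 : rn (mean hs (fun h => (u h)%:C *: alpha h Y) - c%:C *: Y) <= c * (e / 2).
  rewrite -(mean_scale hsP Y cu) -(meanB hsP cua cuY) -(rmean_mulr _ hsP cu).
  have cd : continuous (fun h => (u h)%:C *: alpha h Y - (u h)%:C *: Y).
    by move=> g; apply: cvgB; [exact: cua | exact: cuY].
  have cue : continuous (fun h => u h * (e / 2)).
    by move=> g; apply: cvgM; [exact: cu | exact: cvg_cst].
  apply: (mean_le_rmean hsP cd cue) => h; rewrite -scalerBr rnZ_ge0 //.
  have [Qh|Qh] := pselect (interior Q h); last by rewrite (uQ _ Qh) !mul0r.
  by rewrite ler_wpM2l //; exact: (interior_subset Qh d od).
have : rn (c%:C *: Y) <= c * (e / 2) + c * (e / 2).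
  rewrite (le_trans (rn_sub _ (mean hs (fun h => (u h)%:C *: alpha h Y)))) // lerD //.
  by rewrite rnB.
rewrite rnZ_ge0 ?(ltW c0) // -mulrDr -splitr.
by rewrite ler_pM2l.
Qed.

Lemma smooth_wdiff f w v :
  smooth hs beta f (wdiff w v) = smooth hs beta f w - smooth hs beta f v.
Proof.
rewrite /smooth big_cat big_map -sumrN; congr (_ + _); apply: eq_bigr => p _ /=.
by rewrite mulrN1 -scaleN1r ractZr scaleN1r.
Qed.

(** The functional [coef f xi] is approximated by its projection onto a
   finite orthonormal family [d] that catches almost all of its mass as measured
   by the state: the mass on any further orthonormal family is small in the
   state, hence in norm. Thus a bounded functional, which in a Hilbert module
   need not be an inner product with a vector, is one here. *)
Lemma coef_approx f xi : continuous f -> (forall g, `|f g| <= 1) ->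
  coef f xi \in @approx_pred R A K.
Proof.
move=> cf f1; apply/asboolP => e e0.
have [t t0 small] := mass_small xi cf f1 (exprn_gt0 2 e0).
pose M := [set r : R | exists2 d, orthon k0 d & r = complex.Re (Phi (mass f xi d))].
have hsM : has_sup M.
  split; first by exists (complex.Re (Phi (mass f xi [::]))), [::].
  exists (rn xi ^+ 2) => _ [d od ->].
  have [_ /andP[_ /le_trans]] := phi_re hsP alphaP erg (mass_mpos f xi d); apply.
  by rewrite rn_mass // ler_sqr ?nnegrE ?rn_ge0 // (le_trans (rn_proj _ od cf f1)) // mul1r.
have [_ [d od ->] hd] := sup_adherent t0 hsM.
exists (col (coef f xi) d) => w.
have [d' [od' wd]] := gram_schmidt pk kD kZ [seq p.2 | p <- w] od.
have {}wd p : p \in w -> inspan k0 (d' ++ d) p.2 by move=> pw; apply: wd; exact: map_f.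
pose c := ev k0 w; pose w' := col c (d' ++ d).
have evw : ev k0 w = ev k0 w'.
  by apply/funext => x; exact: ev_respan.
have gw v : gram k0 v w = gram k0 v w' by rewrite /gram evw.
have gw' v : gram k0 w v = gram k0 w' v by rewrite -!(gram_star pk.1 v) gw.
have gn : gnorm k0 w' = gnorm k0 w by rewrite /gnorm -gw -gw'.
have sm : smooth hs beta f w = smooth hs beta f w'.
  apply/eqP; rewrite -subr_eq0; apply/eqP/rn_eq0/le_anti; rewrite rn_ge0 andbT -smooth_wdiff.
  rewrite (le_trans (smooth_bound hsP alphaP erg betaP _ cf f1)) // mul1r /gnorm.
  by rewrite gram_wdiffl gw' subrr rn0 sqrtr0.
have gd : gram k0 w (col (coef f xi) d) = \sum_(x <- d) star (c x) * coef f xi x.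
  rewrite gw' -(gram_star pk.1) /gram pair_col_list star_sum big_seq [RHS]big_seq.
  apply: eq_bigr => x xd; rewrite ev_col (orthon_sum pk c od') ?mem_cat ?xd ?orbT //.
  by rewrite star_mul starK.
have od1 := orthon_catl od'.
have -> : pair w (fun x => coef f xi x - ev k0 (col (coef f xi) d) x) =
    gram k0 (col c d') (col (coef f xi) d').
  rewrite pairB pair_coef sm -pair_coef -/(gram k0 w _) gd pair_col_list big_cat /= addrK.
  by rewrite gram_col.
rewrite (le_trans (gram_le pk _ _)) // mulrC ler_pM ?gnorm_ge0 //.
  rewrite -[leRHS](ger0_norm (ltW e0)) -sqrtr_sqr ler_wsqrtr // gram_col //.
  apply: small => //.
  have massD : mass f xi (d' ++ d) = mass f xi d' + mass f xi d by rewrite /mass big_cat.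
  have : complex.Re (Phi (mass f xi (d' ++ d))) <= sup M.
    by apply: (sup_upper_bound hsM); exists (d' ++ d).
  rewrite massD (phiD hsP alphaP erg) raddfD /= => h1.
  by rewrite -(lerD2r (complex.Re (Phi (mass f xi d)))) (le_trans h1) // addrC -lerBlDr ltW.
rewrite -gn ler_wsqrtr // !gram_col //; apply: mpos_le_norm.
  by apply: mpos_sum => x _; exact: mpos_starM.
rewrite big_cat /= [X in X - _]addrC addrK.
by apply: mpos_sum => x _; exact: mpos_starM.
Qed.

End SmoothVector.

(** * From a dense contraction to an isometry *)

Section TendsMore.
Variable R : realType.

Lemma tends_small (V W : normedModType R[i]) (u : nat -> V) (v : nat -> W) (C : R) :
  0 <= C -> (forall n, rn (u n) <= C * rn (v n)) -> tends v 0 -> tends u 0.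
Proof.
move=> C0 uv v0 e e0; have C1 : 0 < C + 1 by rewrite ltr_wpDl.
have [N hN] := v0 _ (divr_gt0 e0 C1); exists N => n /hN; rewrite !subr0 => h.
rewrite (le_trans (uv n)) // (@le_trans _ _ ((C + 1) * (e / (C + 1)))) //.
  by rewrite ler_pM ?rn_ge0 // lerDl.
by rewrite mulrC divfK // gt_eqF.
Qed.

Lemma tends_inner (A : cstarAlgType R) (E : hilbertModType A) (u v : nat -> E) x y (C : R) :
  0 <= C -> (forall n, rn (u n) <= C) -> tends u x -> tends v y ->
  tends (fun n => inner (u n) (v n)) (inner x y).
Proof.
move=> C0 uC ux vy.
have h0 : tends (fun n => inner (u n) (v n - y)) (0 : A).
  apply: (@tends_small A E _ (fun n => v n - y) C) => // [n|].
    by rewrite (le_trans (inner_le _ _)) // ler_wpM2r ?rn_ge0.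
  by have := tendsB vy (tends_cst y); rewrite subrr.
rewrite -[inner x y]addr0; apply: tends_ext (tendsD (tends_innerl y ux) h0) => n.
by rewrite -innerDr addrC subrK.
Qed.

Lemma rk_sum (A : cstarAlgType R) (K : pdkernel R) I (s : seq I) (F : I -> rk A K) x :
  (\sum_(i <- s) F i) x = \sum_(i <- s) F i x.
Proof. exact: (big_morph (fun h : rk A K => h x) (fun h g => rkD h g x) erefl). Qed.

End TendsMore.

Section Ladder.
Variables (R : realType) (A : cstarAlgType R) (E : hilbertModType A) (K : pdkernel R).
Variables (d : pk_pt K -> E) (W : E -> rk A K).
Hypothesis WE : forall x p, W x p = inner (d p) x.
Hypothesis W_le : forall x, rn (W x) <= rn x.
Hypothesis d_dense : forall x (e : R), 0 < e -> exists p (c : R), rn (c%:C *: d p - x) <= e.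
Implicit Types (x y z : E) (h : rk A K).

Lemma W_linear : linear W.
Proof. by move=> c x y; apply: rk_ext => p; rewrite rkD rkZ !WE innerDr innerZr. Qed.

HB.instance Definition _ := GRing.isLinear.Build R[i] E (rk A K) *:%R W W_linear.

Lemma W_ract x a : W (ract x a) = ract (W x) a.
Proof. by apply: rk_ext => p; rewrite WE inner_ract -WE. Qed.

(** A bounded map of Hilbert modules need not have an adjoint; this one does,
   since the values of the adjoint on the [rkev w] are combinations of the [d p]
   and the rest follows by continuity. *)
Lemma adjoint_exists h : exists s, forall y, inner s y = inner h (W y).
Proof.
pose S w : E := \sum_(q <- w) ract (d q.2) q.1.
have SE w y : inner (S w) y = inner (rkev w) (W y).
  rewrite inner_rkev inner_suml; apply: eq_bigr => q _.
  by rewrite inner_ractl WE.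
have [vs hvs] := cvg_approx h.
have [|s hs] := @tends_complete R E (fun n => S (vs n)).
  move=> e e0; have e2 : 0 < e / 2 by rewrite divr_gt0.
  have [N hN] := hvs _ e2; exists N => m n Nm mn.
  apply: rn_sup => [|y]; first exact: ltW.
  rewrite innerBl !SE -innerBl.
  have h1 := hN _ Nm; have := hN _ (leq_trans Nm mn); rewrite rnB => h2.
  have h3 := le_trans (rn_tri h _ _) (lerD h1 h2); rewrite -splitr in h3.
  exact: le_trans (inner_le _ _) (ler_pM (rn_ge0 _) (rn_ge0 _) h3 (W_le y)).
exists s => y; apply: tends_uniq (tends_innerl y hs) _.
by apply: tends_ext (tends_innerl (W y) hvs) => n; rewrite SE.
Qed.

(** The composite of [W] with its adjoint. *)
Definition P x : E := sval (cid (adjoint_exists (W x))).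

Lemma innerP x y : inner (P x) y = inner (W x) (W y).
Proof. by rewrite /P; case: cid => s /= ->. Qed.

Lemma innerPr x y : inner x (P y) = inner (W x) (W y).
Proof. by rewrite inner_star innerP -inner_star. Qed.

Lemma P_linear : linear P.
Proof.
move=> c x y; apply: inner_inj => z.
by rewrite innerDl innerZl !innerP linearP innerDl innerZl.
Qed.

HB.instance Definition _ := GRing.isLinear.Build R[i] E E *:%R P P_linear.

Lemma P_le x : rn (P x) <= rn x.
Proof.
apply: rn_sup => [|y]; first exact: rn_ge0.
by rewrite innerP; exact: le_trans (inner_le _ _) (ler_pM (rn_ge0 _) (rn_ge0 _) (W_le x) (W_le y)).
Qed.

Fact lock_key : unit. Proof. exact: tt. Qed.

(* Locked, lest unification unfold it to a difference. *)
Definition Y : E -> E := locked_with lock_key (sqrt1B P_le).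

Lemma Y_def : Y = sqrt1B P_le.
Proof. by rewrite /Y unlock. Qed.

Lemma Y_linear : linear Y.
Proof. by rewrite Y_def; exact: sqrt1B_lin. Qed.

HB.instance Definition _ := GRing.isLinear.Build R[i] E E *:%R Y Y_linear.

Lemma YY x : Y (Y x) = x - P x.
Proof. by rewrite Y_def; exact: sqrt1B_sqr. Qed.

Lemma PY x : P (Y x) = Y (P x).
Proof.
have PE y : P y = y - Y (Y y) by rewrite YY opprB addrC subrK.
by rewrite (PE x) (PE (Y x)) raddfB.
Qed.

Lemma innerY x y : inner (Y x) y = inner x (Y y).
Proof.
have pevP (p : {poly R}) : inner (pev P p x) y = inner x (pev P p y).
  rewrite /pev inner_suml inner_sumr; apply: eq_bigr => i _.
  rewrite innerZl innerZr conjC_real; congr (_ *: _).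
  elim: (i : nat) x y => //= n IH x' y'.
  by rewrite innerP -innerPr IH -iterSr.
rewrite Y_def; apply: tends_uniq (tends_innerl y (sqrt1B_tends P_le x)) _.
apply: tends_ext (tends_innerr x (sqrt1B_tends P_le y)) => n.
by rewrite innerBl innerBr pevP.
Qed.

Lemma Y_commute (L : E -> E) (C : R) x : 0 <= C ->
  {morph L : y z / y + z} -> (forall (c : R) y, L (c%:C *: y) = c%:C *: L y) ->
  (forall y, rn (L y) <= C * rn y) -> (forall y, L (P y) = P (L y)) -> L (Y x) = Y (L x).
Proof. by rewrite Y_def => C0 LD LZ LC LP; exact: sqrt1B_commute C0 LD LZ LC LP. Qed.

Definition Yk k x : E := iter k Y x.

Lemma Yk_linear k : linear (Yk k).
Proof. by move=> c x y; elim: k => //= k ->; rewrite linearP. Qed.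

HB.instance Definition _ k := GRing.isLinear.Build R[i] E E *:%R (Yk k) (Yk_linear k).

Lemma inner_Yk k x y : inner (Yk k x) y = inner x (Yk k y).
Proof. by elim: k x y => //= k IH x y; rewrite innerY IH /Yk -iterSr. Qed.

Lemma Yk_ract k x a : Yk k (ract x a) = ract (Yk k x) a.
Proof.
elim: k => //= k ->; apply/esym.
apply: (@Y_commute (fun x => ract x a) (rn a)) => [|y z|c y|y|y].
- exact: rn_ge0.
- by rewrite ractDl.
- by rewrite ractZl.
- by rewrite mulrC rn_ract.
- apply: inner_inj => z.
  by rewrite inner_ractl !innerP W_ract inner_ractl.
Qed.

(** The amount by which the [k]-th power of [Y] fails to preserve inner products
   at the next step. *)
Definition defect k x y : A := inner (W (Yk k x)) (W (Yk k y)).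

Lemma defectE k x y :
  defect k x y = inner (Yk k x) (Yk k y) - inner (Yk k.+1 x) (Yk k.+1 y).
Proof. by rewrite /defect /= innerY YY innerBr innerPr opprB addrC subrK. Qed.

Lemma defect_decr k x : mpos (defect k x x - defect k.+1 x x).
Proof.
have -> : defect k x x - defect k.+1 x x = inner (P (Yk k x)) (P (Yk k x)).
  rewrite /defect /= -!innerPr PY -innerY YY innerBl.
  by rewrite opprB addrC subrK.
exact: mpos_inner.
Qed.

(** The first [m] defects add up to [inner x x - inner (Yk m x) (Yk m x)], and
   none of them is smaller than the next. *)
Lemma defect_sum m x : mpos (inner x x - inner (Yk m x) (Yk m x) - (m%:R : R)%:C *: defect m x x).
Proof.
elim: m => [|m IH]; first by rewrite subrr scale0r subrr; exact: mpos0.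
have h := mposZ (ler0n R m.+1) (defect_decr m x).
have := mposD IH h; congr mpos.
set a := inner (Yk m x) _; set b := inner (Yk m.+1 x) _.
have -> : b = a - defect m x x by rewrite defectE opprB addrC subrK.
rewrite scalerBr; set w := _ *: defect m.+1 x x; set u := _ *: defect m x x.
have -> : (m.+1%:R : R)%:C *: defect m x x = u + defect m x x.
  by rewrite -natr1 rmorphD scalerDl rmorph1 scale1r.
by rewrite opprB !addrA subrK (addrAC (inner x x)).
Qed.

Lemma Yk_le m x : rn (Yk m x) <= rn x.
Proof.
rewrite -ler_sqr ?nnegrE ?rn_ge0 // -!rn_inner; apply: mpos_le_norm; first exact: mpos_inner.
have h := mposZ (ler0n R m) (mpos_inner (W (Yk m x))).
by have := mposD (defect_sum m x) h; rewrite subrK.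
Qed.

Lemma W_Yk_le m x : Num.sqrt m%:R * rn (W (Yk m x)) <= rn x.
Proof.
rewrite -ler_sqr ?nnegrE ?mulr_ge0 ?sqrtr_ge0 ?rn_ge0 // exprMn sqr_sqrtr ?ler0n //.
rewrite -!rn_inner -rnZ_ge0 ?ler0n //; apply: mpos_le_norm.
  by apply: mposZ (mpos_inner _); exact: ler0n.
have := mposD (defect_sum m x) (mpos_inner (Yk m x)).
by rewrite addrAC subrK.
Qed.

(** By duality the bound on [W (Yk m y)] becomes a bound on [Yk m (d p)], as [Y]
   is self-adjoint and [d p] represents the evaluation of [W] at [p]. *)
Lemma Yk_d p : tends (fun m => Yk m (d p)) 0.
Proof.
move=> e e0; set g := gnorm (@pk_fun R K) [:: (1 : A, p)].
have g0 : 0 <= g := gnorm_ge0 _ _.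
pose N := Num.bound ((g / e) ^+ 2); exists N.+1 => m Nm; rewrite subr0.
have m0 : 0 < Num.sqrt (m%:R : R) by rewrite sqrtr_gt0 ltr0n (leq_trans _ Nm).
have gm : g <= e * Num.sqrt m%:R.
  rewrite -ler_pdivrMl // mulrC -[g / e]ger0_norm ?divr_ge0 ?(ltW e0) // -sqrtr_sqr ler_wsqrtr //.
  have := archi_boundP (sqr_ge0 (g / e)); rewrite -/N => /ltW/le_trans; apply.
  by rewrite ler_nat ltnW.
apply: rn_sup => [|y]; first exact: ltW.
rewrite inner_Yk -WE (le_trans (rn_le_nrm _ _)) // -rn_nrm -/g.
rewrite (le_trans (ler_wpM2l (rn_ge0 _) gm)) // mulrCA ler_wpM2l ?(ltW e0) // mulrC.
exact: W_Yk_le.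
Qed.

(** The powers of [Y] are contractions that tend to [0] on the [d p], whose
   multiples are dense. *)
Lemma Yk_tends x : tends (fun m => Yk m x) 0.
Proof.
move=> e e0; have e2 : 0 < e / 2 by rewrite divr_gt0.
have [p [c hc]] := d_dense x e2.
have c1 : 0 < `|c| + 1 by rewrite ltr_wpDl.
have [N hN] := Yk_d p (divr_gt0 e2 c1); exists N => m /hN; rewrite !subr0 => h.
rewrite (le_trans (rn_sub _ (Yk m (c%:C *: d p)))) // (splitr e) lerD //.
  by rewrite -linearB (le_trans (Yk_le _ _)) // rnB.
rewrite linearZ rnZ (@le_trans _ _ ((`|c| + 1) * (e / 2 / (`|c| + 1)))) //.
  by rewrite ler_pM ?rn_ge0 // lerDl.
by rewrite mulrC divfK // gt_eqF.
Qed.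

Notation KN := (sumk nat K).

Definition rung k x : rk A KN := iota k (W (Yk k x)).

Lemma inner_rung k l x y : inner (rung k x) (rung l y) = if k == l then defect k x y else 0.
Proof. by rewrite inner_iota; case: eqP => // ->. Qed.

Definition rungs M N x : rk A KN := \sum_(M <= k < N) rung k x.

Lemma inner_rungs M N x y : (M <= N)%N ->
  inner (rungs M N x) (rungs M N y) = inner (Yk M x) (Yk M y) - inner (Yk N x) (Yk N y).
Proof.
move=> /subnKC <-; elim: (N - M)%N => [|n IH].
  by rewrite addn0 /rungs !big_geq // inner0l subrr.
rewrite addnS /rungs !big_nat_recr ?leq_addr //= -!/(rungs _ _ _).
have orth u v : inner (rungs M (M + n) u) (rung (M + n) v) = 0.
  rewrite inner_suml big_nat big1 // => k /andP[_ km]; rewrite inner_rung.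
  by rewrite ltn_eqF.
rewrite innerDl (innerDr (rungs _ _ x)) (innerDr (rung _ x)) orth.
rewrite (inner_star (rungs M (M + n) y) (rung (M + n) x)) orth star0 addr0 add0r IH inner_rung eqxx.
by rewrite defectE addrA subrK.
Qed.

Lemma rungs_le M N x : (M <= N)%N -> rn (rungs M N x) <= rn (Yk M x).
Proof.
move=> MN; rewrite -ler_sqr ?nnegrE ?rn_ge0 // -!rn_inner.
apply: mpos_le_norm; first exact: mpos_inner.
by rewrite inner_rungs // opprB addrC subrK; exact: mpos_inner.
Qed.

Lemma ladder_exists x : exists l, tends (fun N => rungs 0 N x) l.
Proof.
apply: tends_complete => e e0; have [N hN] := Yk_tends x e0; exists N => m n Nm mn.
rewrite rnB /rungs (big_cat_nat (leq0n m) mn) [X in X - _]addrC addrK.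
by rewrite (le_trans (rungs_le x mn)) //; have := hN _ Nm; rewrite subr0.
Qed.

(** Since [inner (W x) (W y) = inner x y - inner (Y x) (Y y)], the copies of
   [W], [W Y], [W Y^2] and so on telescope to an isometry. *)
Definition ladder : E -> rk A KN := locked_with lock_key (fun x => sval (cid (ladder_exists x))).

Lemma ladder_tends x : tends (fun N => rungs 0 N x) (ladder x).
Proof. by rewrite /ladder unlock; exact: (svalP (cid (ladder_exists x))). Qed.

Lemma inner_ladder x y : inner (ladder x) (ladder y) = inner x y.
Proof.
have h : tends (fun N => inner (rungs 0 N x) (rungs 0 N y)) (inner (ladder x) (ladder y)).
  apply: (@tends_inner R A _ _ _ _ _ (rn x) (rn_ge0 _)) (ladder_tends x) (ladder_tends y) => N.
  exact: rungs_le.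
apply: (tends_uniq h).
have Y0 : tends (fun N => inner (Yk N x) (Yk N y)) (0 : A).
  apply: (@tends_small R A E _ (fun N => Yk N x) (rn y)); [exact: rn_ge0 | | exact: Yk_tends].
  move=> N; rewrite (le_trans (inner_le _ _)) // mulrC ler_wpM2r ?rn_ge0 //.
  exact: Yk_le.
rewrite -[inner x y]subr0; apply: tends_ext (tendsB (tends_cst (inner x y)) Y0) => N.
by rewrite inner_rungs.
Qed.

Lemma ladderE x k p : ladder x (k, p) = inner (d p) (Yk k x).
Proof.
have h := @tends_eval R A KN _ _ (k, p) (ladder_tends x).
apply: (tends_uniq h) => e e0; exists k.+1 => N kN.
rewrite /rungs rk_sum (bigD1_seq k) ?mem_index_iota ?iota_uniq //=.
rewrite {1}/iota_fun eqxx WE big1 ?addr0 ?subrr ?rn0 ?(ltW e0) // => i ik.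
by rewrite /iota_fun eq_sym (negbTE ik).
Qed.

Lemma ladder_linear : linear ladder.
Proof.
move=> c x y; apply: rk_ext => -[k p].
by rewrite rkD rkZ !ladderE Yk_linear innerDr innerZr.
Qed.

HB.instance Definition _ := GRing.isLinear.Build R[i] E (rk A KN) *:%R ladder ladder_linear.

Lemma ladder_ract x a : ladder (ract x a) = ract (ladder x) a.
Proof. by apply: rk_ext => -[k p]; rewrite ladderE Yk_ract inner_ract -ladderE. Qed.

End Ladder.

(** * Equivariance *)

Section SumAction.
Variables (R : realType) (G : topologicalGroupType) (J : eqType) (K : pdkernel R).
Variable act : G -> pk_pt K -> pk_pt K.
Hypothesis actM : forall g h x, act (g * h)%g x = act g (act h x).
Hypothesis act1 : forall x, act 1%g x = x.
Hypothesis act_kf : forall g x y, pk_fun (act g x) (act g y) = pk_fun x y.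
Hypothesis act_continuous : forall x, continuous (fun g => kpt (act g x)).

Definition sum_act g (p : pk_pt (sumk J K)) : pk_pt (sumk J K) := (p.1, act g p.2).

Lemma sum_actM g h p : sum_act (g * h)%g p = sum_act g (sum_act h p).
Proof. by rewrite /sum_act actM. Qed.

Lemma sum_act1 p : sum_act 1%g p = p.
Proof. by rewrite /sum_act act1; case: p. Qed.

Lemma sum_act_kf g p q : pk_fun (sum_act g p) (sum_act g q) = pk_fun p q.
Proof. by rewrite /= /sum_fun /= act_kf. Qed.

Lemma sum_act_continuous p : continuous (fun g => kpt (sum_act g p)).
Proof.
case: p => j x.
have -> : (fun g => kpt (sum_act g (j, x))) = (fun g => @iota R J K (cplx R) j (kpt (act g x))).
  apply/funext => g; apply: (@rk_ext R (cplx R) (sumk J K)) => -[i z].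
  rewrite iotaE /= /ev !big_seq1 /sum_fun /=; case: eqP => // _.
  exact: scale0r.
have lip (y z : rk (cplx R) K) : rn (iota j y - iota j z) <= 1 * rn (y - z).
  by rewrite -raddfB mul1r rn_iota.
have h := @continuous_lip R G (rk (cplx R) K) (rk (cplx R) (sumk J K)) (iota j) 1 _ ler01 lip (@act_continuous x).
exact: h.
Qed.

End SumAction.

Section EquivariantLadder.
Variables (R : realType) (G : topologicalGroupType) (A : cstarAlgType R).
Variables (alpha : G -> {lrmorphism A -> A}) (E : hilbertModType A) (beta : G -> {linear E -> E}).
Hypothesis alphaP : strongly_continuous_action alpha.
Hypothesis betaP : hilbert_GA_module alpha beta.
Variables (K : pdkernel R) (act : G -> pk_pt K -> pk_pt K).
Hypothesis actM : forall g h x, act (g * h)%g x = act g (act h x).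
Hypothesis act1 : forall x, act 1%g x = x.
Hypothesis act_kf : forall g x y, pk_fun (act g x) (act g y) = pk_fun x y.
Hypothesis act_continuous : forall x, continuous (fun g => kpt (act g x)).
Variables (d : pk_pt K -> E) (W : E -> rk A K).
Hypothesis WE : forall x p, W x p = inner (d p) x.
Hypothesis W_le : forall x, rn (W x) <= rn x.
Hypothesis d_dense : forall x (e : R), 0 < e -> exists p (c : R), rn (c%:C *: d p - x) <= e.
Hypothesis d_act : forall g p, d (act g p) = beta g (d p).
Implicit Types (x y z : E).

Let betaK g x : beta g (beta g^-1%g x) = x.
Proof. by rewrite -(gam_mul betaP) mulgV (gam_one betaP). Qed.

Let inner_beta g x p : inner (d p) (beta g x) = alpha g (inner (d (act g^-1%g p)) x).
Proof. by rewrite d_act -(gam_inner betaP) betaK. Qed.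

Lemma W_beta g x : W (beta g x) = rk_act alphaP actM act1 act_kf g (W x).
Proof. by apply: rk_ext => p; rewrite rk_actE !WE. Qed.

Lemma P_beta g x : beta g (P WE W_le x) = P WE W_le (beta g x).
Proof.
apply: inner_inj => z; rewrite -(betaK g z) (gam_inner betaP) !innerP !W_beta.
by rewrite (gam_inner (rk_act_module alphaP actM act1 act_kf act_continuous)).
Qed.

Lemma Yk_beta g k x : Yk WE W_le k (beta g x) = beta g (Yk WE W_le k x).
Proof.
elim: k => //= k ->; apply/esym.
apply: (@Y_commute R A E K d W WE W_le (beta g) 1) => [|y z|c y|y|y].
- exact: ler01.
- exact: raddfD.
- exact: linearZ.
- rewrite mul1r; have h := @rn_beta R G A alpha alphaP E beta betaP g y; exact: h.
- exact: P_beta.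
Qed.

Lemma ladder_embeds : embeddable alpha beta.
Proof.
have sM := sum_actM (J := nat) actM; have s1 := sum_act1 (J := nat) act1.
have skf := sum_act_kf (J := nat) act_kf.
have sc := sum_act_continuous (J := nat) act_continuous.
exists (rkH (sumk nat K)), (rk_rep sM s1 skf); split; first exact: rk_rep_unitary.
exists (rk_trivial alphaP sM s1 skf sc), (ladder WE W_le d_dense : {linear E -> rk A (sumk nat K)}).
split.
- exact: ladder_ract.
- exact: inner_ladder.
- move=> g x; apply: rk_ext => -[k p].
  by rewrite [RHS]rk_actE !ladderE Yk_beta inner_beta.
Qed.

End EquivariantLadder.

(** * Combining a sequence of contractions *)

(** The weights [2 ^- n.+1] make the sum of a sequence of contractions, placed in
   orthogonal copies, a contraction. *)
Section Geometric.
Variables (R : realType) (X : completeNormedModType R[i]).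

Lemma geometric_sum n : \sum_(0 <= i < n) (2^-1 : R) ^+ i.+1 = 1 - 2^-1 ^+ n.
Proof.
elim: n => [|n IH]; first by rewrite big_geq // expr0 subrr.
by rewrite big_nat_recr //= IH !exprS; field.
Qed.

Lemma geometric_series (u : nat -> X) (C : R) : 0 <= C ->
  (forall n, rn (u n) <= 2^-1 ^+ n.+1 * C) ->
  exists l, tends (fun N => \sum_(0 <= n < N) u n) l /\ rn l <= C.
Proof.
move=> C0 uC; pose a n : R := \sum_(0 <= i < n) 2^-1 ^+ i.+1 * C.
have aE n : a n = (1 - 2^-1 ^+ n) * C by rewrite /a -mulr_suml geometric_sum.
have a0 n : 0 <= (2^-1 : R) ^+ n * C by rewrite mulr_ge0 // exprn_ge0 // invr_ge0.
have aC n : a n <= C by rewrite aE mulrBl mul1r gerBl.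
have am : {homo a : m n / (m <= n)%N >-> m <= n}.
  move=> m n mn; rewrite /a (big_cat_nat (leq0n m) mn) lerDl.
  by apply: sumr_ge0 => i _; exact: a0.
have [|l hl] := @tends_complete R X (fun N => \sum_(0 <= n < N) u n).
  move=> e e0; have [N hN] := bounded_mono_cauchy am aC e0; exists N => m n Nm mn.
  rewrite rnB (big_cat_nat (leq0n m) mn) [X in X - _]addrC addrK (le_trans (rn_sum _ _)) //.
  apply: le_trans (hN _ _ Nm mn); rewrite /a (big_cat_nat (leq0n m) mn) [leRHS]addrC addKr.
  by apply: ler_sum => i _.
exists l; split=> //; apply: tends_rn_le hl => N.
by rewrite (le_trans (rn_sum _ _)) // (le_trans _ (aC N)) //; exact: ler_sum.
Qed.

End Geometric.

Section Combine.
Variables (R : realType) (A : cstarAlgType R) (E : hilbertModType A) (K : pdkernel R).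
Variables (b : nat -> pk_pt K -> E) (T : nat -> E -> rk A K).
Hypothesis TE : forall n x p, T n x p = inner (b n p) x.
Hypothesis T_le : forall n x, rn (T n x) <= rn x.

Let c n : R := 2^-1 ^+ n.+1.

Let c_ge0 n : 0 <= c n.
Proof. by rewrite exprn_ge0 // invr_ge0. Qed.

Definition weighted (p : pk_pt (sumk nat K)) : E := (2^-1 ^+ p.1.+1 : R)%:C *: b p.1 p.2.

Lemma combine_exists x : exists h : rk A (sumk nat K),
  (forall p, h p = inner (weighted p) x) /\ rn h <= rn x.
Proof.
pose u n : rk A (sumk nat K) := iota n ((c n)%:C *: T n x).
have uC n : rn (u n) <= 2^-1 ^+ n.+1 * rn x.
  by rewrite /u rn_iota rnZ_ge0 // ler_wpM2l //; exact: c_ge0.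
have [h [hu hx]] := geometric_series (rn_ge0 x) uC.
exists h; split=> // -[k p]; have lim := @tends_eval R A (sumk nat K) _ _ (k, p) hu.
apply: (tends_uniq lim) => e e0; exists k.+1 => N kN.
rewrite rk_sum (bigD1_seq k) ?mem_index_iota ?iota_uniq //=.
have -> : iota_fun k ((c k)%:C *: T k x) (k, p) = inner (weighted (k, p)) x.
  by rewrite /weighted innerZl conjC_real -TE /iota_fun eqxx.
rewrite big1 => [|i ik]; first by rewrite addr0 subrr rn0 ltW.
by rewrite /iota_fun eq_sym (negbTE ik).
Qed.

Definition combine x : rk A (sumk nat K) := sval (cid (combine_exists x)).

Lemma combineE x p : combine x p = inner (weighted p) x.
Proof. by rewrite /combine; case: cid => h []. Qed.

Lemma combine_le x : rn (combine x) <= rn x.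
Proof. by rewrite /combine; case: cid => h []. Qed.

End Combine.

(** * The embedding *)

Section Embedding.
Variables (R : realType) (G : topologicalGroupType) (hs : nat -> seq G).
Hypothesis hsP : haar_net R hs.
Hypothesis compG : compact [set: G].
Hypothesis hausG : hausdorff_space G.
Variables (A : cstarAlgType R) (alpha : G -> {lrmorphism A -> A}).
Hypothesis alphaP : strongly_continuous_action alpha.
Hypothesis erg : ergodic alpha.
Variables (E : hilbertModType A) (beta : G -> {linear E -> E}).
Hypothesis betaP : hilbert_GA_module alpha beta.

Notation K := (K0 hsP alphaP erg E).
Notation B := (smear hs beta).
Implicit Types (x y xi : E) (f : G -> R).

Let act g : pk_pt K -> pk_pt K := beta g.

Let actM g h x : act (g * h)%g x = act g (act h x).
Proof. exact: gam_mul betaP g h x. Qed.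

Let act1 x : act 1%g x = x.
Proof. exact: gam_one betaP x. Qed.

Let act_kf g (x y : pk_pt K) : pk_fun (act g x) (act g y) = pk_fun x y.
Proof.
rewrite /= /phi_form; have := gam_inner betaP g x y; rewrite /act => ->.
have h := @phi_alpha R G hs hsP A alpha alphaP erg g (inner (x : E) y); exact: h.
Qed.

Lemma rn_kptB (x y : pk_pt K) : rn (kpt x - kpt y : rkH K) <= rn (x - y : E).
Proof.
rewrite /kpt -[X in rn X](rkev_wdiff [:: (1 : cplx R, x)] [:: (1 : cplx R, y)]).
rewrite [leLHS](rn_rkev (wdiff [:: (1 : cplx R, x)] [:: (1 : cplx R, y)])).
rewrite -ler_sqr ?nnegrE ?gnorm_ge0 ?rn_ge0 // gnorm_sqr -rn_inner.
have gE (p q : pk_pt K) : gram (@pk_fun R K) [:: (1 : cplx R, p)] [:: (1 : cplx R, q)] = phi_form hs alpha p q.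
  by rewrite /gram pair1 /ev big_seq1 star1 mul1r cplxZ mulr1.
rewrite gram_wdiffl !gram_wdiffr !gE.
have -> : phi_form hs alpha x x - phi_form hs alpha x y - (phi_form hs alpha y x - phi_form hs alpha y y)
    = phi hs alpha (inner (x - y) (x - y)).
  have pB a b' : phi hs alpha (a - b') = phi hs alpha a - phi hs alpha b'.
    by rewrite -scaleN1r (phiD hsP alphaP erg) (phiZ hsP alphaP erg) mulN1r.
  by rewrite innerBl !innerBr !pB.
have h := @phi_le R G hs hsP A alpha alphaP erg (inner (x - y : E) (x - y)); exact: h.
Qed.

Let act_continuous (x : pk_pt K) : continuous (fun g => kpt (act g x)).
Proof.
apply: (@continuous_lip R G E (rkH K) (fun y => kpt (y : pk_pt K)) 1) (@gam_continuous _ _ _ _ _ _ betaP (x : E)) => [|y z].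
  exact: ler01.
by rewrite mul1r; exact: rn_kptB.
Qed.

Section OneBump.
Variable f : G -> R.
Hypothesis cf : continuous f.
Hypothesis f01 : forall g, 0 <= f g <= 1.

Let f1 g : `|f g| <= 1.
Proof. by have /andP[f0 f1'] := f01 g; rewrite ger0_norm. Qed.

Definition transform xi : rk A K := RK (coef_approx hsP compG hausG alphaP erg betaP xi cf f1).

Lemma transformE xi (x : pk_pt K) : transform xi x = inner (B f x) xi.
Proof. by []. Qed.

Lemma transform_le xi : rn (transform xi) <= rn xi.
Proof.
apply: rk_rn_le => [|w]; first exact: rn_ge0.
have -> : pair w (transform xi) = inner (smooth hs beta f w) xi by exact: pair_coef.
have := smooth_bound hsP alphaP erg betaP w cf f1; rewrite mul1r => h.
by rewrite (le_trans (inner_le _ _)) // mulrC ler_wpM2l ?rn_ge0.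
Qed.

End OneBump.

(** The normalised smoothing of [x] is an average of translates of [x], all of
   them within [e] of [x] on the support of [f]. *)
Lemma smear_near f x (e : R) : continuous f -> (forall g, 0 <= f g <= 1) -> f 1%g = 1 ->
  (forall g, f g != 0 -> rn (beta g x - x) <= e) ->
  rn ((rmean hs f)^-1%:C *: B f x - x) <= e.
Proof.
move=> cf f01 f1 fe; have f0 g : 0 <= f g by have /andP[] := f01 g.
have r0 : 0 < rmean hs f by apply: (rmean_gt0 hsP compG cf f0); rewrite f1.
have cb := @gam_continuous _ _ _ _ _ _ betaP x.
have c1 : continuous (fun g => (f g)%:C *: beta g x) by exact: continuous_scale.
have c2 : continuous (fun g => (f g)%:C *: x) by apply: (continuous_scale cf) => g; exact: cvg_cst.
have c3 : continuous (fun g => f g * e) by move=> g; apply: cvgM; [exact: cf | exact: cvg_cst].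
have c4 : continuous (fun g => (f g)%:C *: beta g x - (f g)%:C *: x).
  by move=> g; apply: cvgB; [exact: c1 | exact: c2].
have h : rn (B f x - (rmean hs f)%:C *: x) <= rmean hs f * e.
  rewrite -(mean_scale hsP x cf) -(meanB hsP c1 c2) -(rmean_mulr _ hsP cf).
  apply: (mean_le_rmean hsP c4 c3) => g; rewrite -scalerBr rnZ_ge0 //.
  by have [->|fg] := eqVneq (f g) 0; rewrite ?mul0r // ler_wpM2l // fe.
have -> : (rmean hs f)^-1%:C *: B f x - x = (rmean hs f)^-1%:C *: (B f x - (rmean hs f)%:C *: x).
  by rewrite scalerBr scalerA -rmorphM mulVf ?gt_eqF // scale1r.
by rewrite rnZ_ge0 ?invr_ge0 ?(ltW r0) // ler_pdivrMl.
Qed.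

Lemma ergodic_embeddable : @second_countable G -> embeddable alpha beta.
Proof.
move=> /nbhs1_base[U [oU U1 Ub]].
have bump n := bump_exists (R := R) hsP compG hausG (oU n) (U1 n).
pose f n := sval (cid (bump n)).
have fP n : is_bump (U n) (f n) := svalP (cid (bump n)).
have cf n : continuous (f n) by have [] := fP n.
have f01 n g : 0 <= f n g <= 1 by have [_ h _ _ _] := fP n; exact: h.
pose b n : pk_pt K -> E := B (f n).
pose T n := transform (cf n) (f01 n).
have TE n x p : T n x p = inner (b n p) x by exact: transformE.
have T_le n x : rn (T n x) <= rn x by exact: transform_le.
have d_dense x (e : R) : 0 < e -> exists p (c : R), rn (c%:C *: weighted b p - x) <= e.
  move=> e0; have cx := (continuous_rnP _).1 (@gam_continuous _ _ _ _ _ _ betaP x) 1%g e e0.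
  have [n /(_ n (leqnn n)) Un] := Ub _ cx; have [_ _ fn1 fU _] := fP n.
  exists (n, x : pk_pt K), ((rmean hs (f n))^-1 / (2^-1 ^+ n.+1)).
  have -> : ((rmean hs (f n))^-1 / (2^-1 ^+ n.+1))%:C *: weighted b (n, x : pk_pt K) =
      (rmean hs (f n))^-1%:C *: B (f n) x.
    rewrite /weighted scalerA -rmorphM divfK //.
  apply: smear_near => // g fg; have Ug : U n g by apply: contrapT => /fU; move/eqP: fg.
  by have := Un g Ug; rewrite /= (gam_one betaP).
have d_act g p : weighted b (sum_act act g p) = beta g (weighted b p).
  case: p => n x; rewrite /weighted /= linearZ; congr (_ *: _).
  have [_ _ _ _ fc] := fP n.
  by have h := smear_beta hsP alphaP betaP g x (cf n) fc; exact: h.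
have h := @ladder_embeds R G A alpha E beta alphaP betaP (sumk nat K) (sum_act act)
  (sum_actM (J := nat) (K := K) (act := act) actM) (sum_act1 (J := nat) (K := K) (act := act) act1)
  (sum_act_kf (J := nat) (K := K) (act := act) act_kf) (sum_act_continuous (J := nat) (K := K) (act := act) act_continuous)
  (weighted b) (combine TE T_le) (combineE TE T_le) (combine_le TE T_le) d_dense d_act.
exact: h.
Qed.

End Embedding.

Theorem theorem3p3 (R : realType) (G : lieGroupType R) (A : cstarAlgType R)
    (alpha : G -> {lrmorphism A -> A}) (E : hilbertModType A)
    (beta : G -> {linear E -> E}) :
  compact [set: G] ->
  strongly_continuous_action alpha ->
  ergodic alpha ->
  hilbert_GA_module alpha beta ->
  embeddable alpha beta.
Proof.
move=> compG alphaP erg betaP; have sc := @lie_second_countable R G.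
have [hs hsP] := haar_net_exists R compG sc.
have h := ergodic_embeddable hsP compG (@lie_hausdorff R G) alphaP erg betaP sc.
exact: h.
Qed.
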